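(* Let $f:S^2\to S^6$ be a linearly full almost complex curve, and let $(\psi_p)_{p=0}^6$ be the harmonic sequence determined by $f$. Then the ramification indices $R_p$ ($p=1,\dots,6$) of the associated osculating curves $\sigma_{p-1}$ satisfy (i) $R_j=R_{7-j}$ for $j=1,\dots,6$; (ii) $R_3=R_1$.
   Context: Cross product: $\mathbb{R}^7$ carries the 7-dimensional cross product $\times$ given on the standard basis $e_1,\dots,e_7$ by $e_a\times e_b=e_c$ for every cyclic permutation $(a,b,c)$ of the triples $(1,2,3),(1,4,5),(2,4,6),(3,4,7),(1,7,6),(2,5,7),(3,6,5)$, extended skew-symmetrically and bilinearly. Almost complex curves: $S^6\subset\mathbb{R}^7$ is the unit sphere with almost complex structure $J_p(u)=p\times u$. A smooth map $f$ from a Riemann surface to $S^6$ is an almost complex curve if $\partial_y f=f\times\partial_x f$ for every local complex coordinate $z=x+iy$. It is linearly full if the image of $[f]:S\to\mathbb{C}P^6$ lies in no proper projective subspace. Harmonic sequence and directrix: if $f:S^2\to S^6$ is a linearly full almost complex curve, then $[f]$ is an element of a finite sequence of harmonic maps $\psi_j=[f_j]:S^2\to\mathbb{C}P^6$, $j=0,\dots,6$, with $\psi_3=[f]$, $\psi_0$ holomorphic, where away from isolated points (across which the $\psi_j$ extend) $f_{j+1}$ is the component of $\partial f_j/\partial z$ orthogonal to $f_j$ for the standard Hermitian product. The holomorphic curve $\psi_0$ is the directrix curve of $f$. Ramification indices: writing locally $\psi_0=[h]$ with $h$ holomorphic and nowhere zero, the $j$-th osculating curve is $\sigma_j=[h\wedge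 h'\wedge\dots\wedge h^{(j)}]$, $j=0,\dots,5$ (extended holomorphically across zeros). $r_{j+1}(p)$ is the order of $p$ as a zero of the derivative of $\sigma_j$, and $R_{j+1}=\sum_{p\in S^2}r_{j+1}(p)$ (a finite sum) is the ramification index of $\sigma_j$. *)

(* Defs.v *)
From HB Require Import structures.
From mathcomp Require Import all_boot all_order all_algebra.
From mathcomp Require Import complex.
From mathcomp Require Import all_classical all_reals all_analysis.

Set Implicit Arguments.
Unset Strict Implicit.
Unset Printing Implicit Defensive.

Import Order.TTheory GRing.Theory Num.Theory.
Import numFieldNormedType.Exports.

Local Open Scope classical_set_scope.
Local Open Scope ring_scope.
Local Open Scope complex_scope.

Section Calculus.
Variable R : realType.
Local Notation C := R[i].
(* The pair (x, y) stands for the complex number x + iy. *)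
Local Notation plane := (R * R)%type.
Implicit Types (U : set plane) (z : plane).

Definition axis (b : bool) : plane := if b then (0, 1) else (1, 0).

(* d/dx for b = false, d/dy for b = true *)
Definition partial (b : bool) (F : plane -> R) : plane -> R :=
  fun z => 'D_(axis b) F z.

(* C^oo on an open set: all iterated partial derivatives exist and are
   continuous. *)
Definition smooth_on U (F : plane -> R) : Prop :=
  forall (l : seq bool) z, U z ->
    {for z, continuous (foldr partial F l)} /\
    forall b, derivable (foldr partial F l) z (axis b).

Definition partialC (b : bool) (F : plane -> C) : plane -> C :=
  fun z => partial b (fun w => complex.Re (F w)) z
        +i* partial b (fun w => complex.Im (F w)) z.

Definition smooth_mx m n U (F : plane -> 'M[C]_(m, n)) : Prop :=
  forall i j, smooth_on U (fun z => complex.Re (F z i j)) /\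
              smooth_on U (fun z => complex.Im (F z i j)).

(* The Wirtinger operators d/dz = (d/dx - i d/dy) / 2 and
   d/dzbar = (d/dx + i d/dy) / 2, entrywise. *)
Definition dz m n (F : plane -> 'M[C]_(m, n)) : plane -> 'M[C]_(m, n) :=
  fun z => \matrix_(i, j)
    ((partialC false (fun w => F w i j) z
      - 'i * partialC true (fun w => F w i j) z) / 2).

Definition dzbar m n (F : plane -> 'M[C]_(m, n)) : plane -> 'M[C]_(m, n) :=
  fun z => \matrix_(i, j)
    ((partialC false (fun w => F w i j) z
      + 'i * partialC true (fun w => F w i j) z) / 2).

Definition holomorphic_mx m n U (F : plane -> 'M[C]_(m, n)) : Prop :=
  smooth_mx U F /\ forall z, U z -> dzbar F z = 0.

End Calculus.

Section RiemannSphere.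
Variable R : realType.
Local Notation C := R[i].
Local Notation plane := (R * R)%type.

(* S^2 as the Riemann sphere: the complex plane plus the point None at
   infinity, with the holomorphic charts z and 1/z.  The functions below are
   the inverses of these charts. *)
Definition sphere : topologicalType := one_point_compactification plane.

Definition chart (b : bool) (z : plane) : sphere :=
  if b then
    if z == 0 then None : option plane
    else let d := z.1 ^+ 2 + z.2 ^+ 2 in Some (z.1 / d, - z.2 / d)
  else Some z.

(* phi is the inverse of a local complex coordinate with image the open set U:
   an injective map which is holomorphic with respect to the charts above. *)
Definition coordinate (U : set plane) (phi : plane -> sphere) : Prop :=
  [/\ open U,
      {in U &, injective phi} &
      forall z, U z -> exists (b : bool) (V : set plane) (g : plane -> plane),
        [/\ open V, V z,
            holomorphic_mx V
              (fun w => ((g w).1 +i* (g w).2)%:M : 'M[C]_1) &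
            forall w, V w -> phi w = chart b (g w)]].

(* Each point is the image under chart (centre_chart p) of centre p. *)
Definition centre_chart (p : sphere) : bool := ~~ isSome p.
Definition centre (p : sphere) : plane := odflt 0 p.

End RiemannSphere.

Section ProjectiveMaps.
Variables (R : realType) (n : nat).
Local Notation C := R[i].
Local Notation plane := (R * R)%type.
(* CP^(n-1) is the set of lines <[v]>, v != 0, of C^n; maps into it are valued
   in the type of all subspaces, the dimension being 1 because of the existence
   of local lifts. *)
Local Notation subspace := {vspace 'rV[C]_n}.
Implicit Types (psi : sphere R -> subspace) (phi : plane -> sphere R)
  (V : set plane) (s h : plane -> 'rV[C]_n).

Definition local_lift psi phi V s : Prop :=
  open V /\ forall z, V z -> s z != 0 /\ psi (phi z) = <[s z]>%VS.

Definition smooth_lift psi phi V s : Prop :=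
  local_lift psi phi V s /\ smooth_mx V s.

Definition holomorphic_lift psi phi V s : Prop :=
  local_lift psi phi V s /\ holomorphic_mx V s.

Definition smooth_map psi : Prop :=
  forall U phi, coordinate U phi -> forall z, U z ->
    exists V s, [/\ V z, V `<=` U & smooth_lift psi phi V s].

Definition holomorphic_map psi : Prop :=
  forall U phi, coordinate U phi -> forall z, U z ->
    exists V h, [/\ V z, V `<=` U & holomorphic_lift psi phi V h].

Definition herm (u v : 'rV[C]_n) : C := \sum_a u 0 a * Num.conj (v 0 a).

(* Orthogonal projection (acting on row vectors on the right) onto the line of
   s; this is the standard isometric embedding of CP^(n-1) into the Euclidean
   space of Hermitian matrices. *)
Definition line_proj (s : 'rV[C]_n) : 'M[C]_n :=
  (herm s s)^-1 *: ((map_mx Num.conj s)^T *m s).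

(* The tension field is the tangential part of the Laplacian 4 d/dz d/dzbar of
   the projector P, and the normal space at P to the set of projectors of
   rank 1 consists of the Hermitian matrices that commute with P. *)
Definition harmonic_map psi : Prop :=
  smooth_map psi /\
  forall U phi, coordinate U phi -> forall V s, V `<=` U ->
    smooth_lift psi phi V s -> forall z, V z ->
      let P := fun w => line_proj (s w) in
      P z *m dz (dzbar P) z = dz (dzbar P) z *m P z.

(* The component of ds/dz orthogonal to s. *)
Definition dz_perp s : plane -> 'rV[C]_n :=
  fun z => dz s z - (herm (dz s z) (s z) / herm (s z) (s z)) *: s z.

(* psi' is the successor of psi: away from isolated points it is the line of
   the component of d psi / dz orthogonal to psi. *)
Definition harmonic_next psi psi' : Prop :=
  forall U phi, coordinate U phi -> forall V s, V `<=` U ->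
    smooth_lift psi phi V s -> forall z, V z ->
      \forall w \near z^', dz_perp s w != 0 /\
                           psi' (phi w) = <[dz_perp s w]>%VS.

(* The order of p as a zero of the derivative of the holomorphic map sigma is
   computed in an affine chart of the target (one homogeneous coordinate of the
   lift h is identically 1) and in a standard chart of the sphere. *)
Definition ramification_order sigma (p : sphere R) (m : nat) : Prop :=
  exists V h (a : 'I_n),
    [/\ V (centre p),
        holomorphic_lift sigma (chart (centre_chart p)) V h,
        forall z, V z -> h z 0 a = 1,
        forall k, (k < m)%N -> iter k (@dz R 1 n) (dz h) (centre p) = 0 &
        iter m (@dz R 1 n) (dz h) (centre p) != 0].

(* The order is unique when it exists; it exists unless sigma is constant. *)
Definition ramification sigma (p : sphere R) : nat :=
  xget 0%N [set m | ramification_order sigma p m].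

(* The sum over a set is 0 by convention if the support is infinite, which does
   not occur for a nonconstant sigma. *)
Definition ramification_index sigma : nat :=
  (\sum_(p \in [set: sphere R]) ramification sigma p)%N.

End ProjectiveMaps.

Section Osculating.
Variables (R : realType) (n : nat).
Local Notation C := R[i].
Local Notation plane := (R * R)%type.

(* Index set of the basis e_(a_1) /\ ... /\ e_(a_k), a_1 < ... < a_k, of the
   k-th exterior power of C^n. *)
Definition incr (k : nat) : {set k.-tuple 'I_n} :=
  [set t : k.-tuple 'I_n | sorted ltn (map val t)].

(* Coordinates of v_0 /\ ... /\ v_(k-1) in this basis. *)
Definition wedge k (v : 'I_k -> 'rV[C]_n) : 'rV[C]_#|incr k| :=
  \row_a \det (\matrix_(i < k, l < k) v i 0 (tnth (enum_val a) l)).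

(* h /\ h' /\ ... /\ h^(j) *)
Definition osculating_vector (h : plane -> 'rV[C]_n) (j : nat) (z : plane) :
    'rV[C]_#|incr j.+1| :=
  wedge (fun i : 'I_j.+1 => iter i (@dz R 1 n) h z).

Definition osculating_curve (psi : sphere R -> {vspace 'rV[C]_n}) (j : nat)
    (sigma : sphere R -> {vspace 'rV[C]_#|incr j.+1|}) : Prop :=
  holomorphic_map sigma /\
  forall U phi, coordinate U phi -> forall V h, V `<=` U ->
    holomorphic_lift psi phi V h -> forall z, V z ->
      osculating_vector h j z != 0 ->
      sigma (phi z) = <[osculating_vector h j z]>%VS.

End Osculating.

Section AlmostComplexCurves.
Variable R : realType.
Local Notation C := R[i].
Local Notation plane := (R * R)%type.

Definition cross_triples : seq (nat * nat * nat) :=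
  [:: (1, 2, 3); (1, 4, 5); (2, 4, 6); (3, 4, 7); (1, 7, 6); (2, 5, 7);
      (3, 6, 5)]%N.

Definition is_cross_triple (a b c : nat) : bool :=
  [|| (a, b, c) \in cross_triples, (b, c, a) \in cross_triples
    | (c, a, b) \in cross_triples].

(* The coefficient of e_c in e_a x e_b (the index 'I_7 starts at 0). *)
Definition cross_coef (a b c : 'I_7) : R :=
  (is_cross_triple a.+1 b.+1 c.+1)%:R - (is_cross_triple b.+1 a.+1 c.+1)%:R.

Definition cross (u v : 'rV[R]_7) : 'rV[R]_7 :=
  \row_c \sum_a \sum_b cross_coef a b c * u 0 a * v 0 b.

Definition partial_row (b : bool) (F : plane -> 'rV[R]_7) (z : plane) :
    'rV[R]_7 :=
  \row_a partial b (fun w => F w 0 a) z.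

Definition almost_complex_curve (f : sphere R -> 'rV[R]_7) : Prop :=
  (forall p, \sum_a f p 0 a ^+ 2 = 1) /\
  forall U phi, coordinate U phi ->
    (forall a, smooth_on U (fun z => f (phi z) 0 a)) /\
    forall z, U z -> partial_row true (fun w => f (phi w)) z =
                     cross (f (phi z)) (partial_row false (fun w => f (phi w)) z).

(* [f] : S^2 -> CP^6 *)
Definition proj_class (f : sphere R -> 'rV[R]_7) (p : sphere R) :
    {vspace 'rV[C]_7} :=
  <[map_mx (real_complex R) (f p)]>%VS.

Definition linearly_full (f : sphere R -> 'rV[R]_7) : Prop :=
  forall W : {vspace 'rV[C]_7},
    (forall p, (proj_class f p <= W)%VS) -> W = fullv.

Definition harmonic_sequence (f : sphere R -> 'rV[R]_7)
    (psi : 'I_7 -> sphere R -> {vspace 'rV[C]_7}) : Prop :=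
  [/\ forall j, harmonic_map (psi j),
      psi (inord 3) = proj_class f,
      holomorphic_map (psi ord0) &
      forall i j : 'I_7, j = i.+1 :> nat -> harmonic_next (psi i) (psi j)].

End AlmostComplexCurves.

(* Main.v *)
(* Fix a point p of the sphere, and let w_i be the Taylor expansion at p of the
   i-th derivative of a holomorphic lift h of the directrix curve: a row vector
   over O = C[[z]]. Since O is a discrete valuation ring, the Wronskian matrix
   factors as a triangular times an invertible matrix over O. The rows v_i of the
   latter satisfy v_i' = al_i v_(i+1) + (a combination of v_0, ..., v_i), and
   r_(j+1)(p) is the order of al_j. In a punctured neighbourhood of p the harmonic
   sequence and the almost complex equation give (h^(i), h^(j)) = 0 for i, j <= 2,
   (h^(3), h^(3)) <> 0 and h x h' = 0 for the complex bilinear dot and cross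
   products. It follows that (v_i, v_j) = 0 for i + j <= 5 and that (v_i, v_(6-i))
   is a unit; differentiating (v_i, v_(5-i)) = 0 gives ord al_i = ord al_(5-i).
   Likewise v_0 x v_2 = 0 has the derivative al_0 v_1 x v_2 + al_2 v_0 x v_3 = 0,
   where both products are nonzero modulo z, hence ord al_0 = ord al_2. *)

Require Import Defs.
From HB Require Import structures.
From mathcomp Require Import all_boot all_order all_algebra.
From mathcomp Require Import perm complex.
From mathcomp Require Import all_classical all_reals all_analysis.
From mathcomp Require Import ring lra zify.

Set Implicit Arguments.
Unset Strict Implicit.
Unset Printing Implicit Defensive.

Import Order.TTheory GRing.Theory Num.Theory.
Import numFieldNormedType.Exports.

Local Open Scope classical_set_scope.
Local Open Scope complex_scope.
Local Open Scope ring_scope.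

(** * Wirtinger calculus *)

Section PartialDerivatives.
Variable R : realType.
Local Notation C := R[i].
Local Notation plane := (R * R)%type.
Implicit Types (F G : plane -> C) (z w : plane) (b : bool) (c d : C).

(** At [p] itself the derivatives of [h] may become dependent. The pointwise geometry is therefore
    done off [p], and only polynomial relations in the derivatives of [h] pass to Taylor expansions:
    equations by continuity, the inequality for [h^(3)] because a holomorphic function with zero
    expansion vanishes near [p]. That fact is obtained from a maximum principle.

    The relation h x h' = 0 comes from the operator x -> f x x, whose eigenvalues on the complement
    of f are i and -i. The almost complex equation puts the zbar-derivative of f, a multiple of f_2,
    into the eigenvalue -i, and one more zbar-derivative gives the same for f_1. The descent stops
    there: f_2 x f_1 does not vanish, and f_0 has the eigenvalue i, which needs a separate argument.
    Vectors of opposite eigenvalues with zero bilinear product have zero cross product.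

    Modulo z the delicate product is v_1 x v_2. Its pairing with v_5 x v_4 is controlled only after
    several components of the 3-form (x x y, z) in the frame are known to vanish; these are found by
    differentiating components already known to be zero. *)

Definition is_pd b F z c : Prop :=
  is_derive z (axis R b) (fun w => complex.Re (F w)) (complex.Re c) /\
  is_derive z (axis R b) (fun w => complex.Im (F w)) (complex.Im c).

Definition pderivable F z : Prop := forall b,
  derivable (fun w => complex.Re (F w)) z (axis R b) /\
  derivable (fun w => complex.Im (F w)) z (axis R b).

Lemma pderivableP F z b : pderivable F z -> is_pd b F z (partialC b F z).
Proof. by move=> /(_ b)[h1 h2]; split; apply: derivableP. Qed.

Lemma is_pd_val b F z c : is_pd b F z c -> partialC b F z = c.
Proof.
by case: c => x y [h1 h2]; rewrite /partialC /partial !derive_val.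
Qed.

Lemma is_pd_pderivable F z c d :
  is_pd false F z c -> is_pd true F z d -> pderivable F z.
Proof.
by move=> [h1 h2] [h3 h4] []; split; apply: ex_derive.
Qed.

Lemma is_pd_cst b z c0 : is_pd b (fun=> c0) z 0.
Proof. by split; apply: is_derive_cst. Qed.

Lemma ReD (c d : C) : complex.Re (c + d) = complex.Re c + complex.Re d.
Proof. by case: c => ? ?; case: d. Qed.

Lemma ImD (c d : C) : complex.Im (c + d) = complex.Im c + complex.Im d.
Proof. by case: c => ? ?; case: d. Qed.

Lemma ReM (c d : C) : complex.Re (c * d) =
  complex.Re c * complex.Re d - complex.Im c * complex.Im d.
Proof. by case: c => ? ?; case: d. Qed.

Lemma ImM (c d : C) : complex.Im (c * d) =
  complex.Re c * complex.Im d + complex.Im c * complex.Re d.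
Proof. by case: c => ? ?; case: d. Qed.

Lemma ReJ (c : C) : complex.Re c^* = complex.Re c.
Proof. by case: c. Qed.

Lemma ImJ (c : C) : complex.Im c^* = - complex.Im c.
Proof. by case: c. Qed.

Lemma complex_eqP (c d : C) :
  complex.Re c = complex.Re d -> complex.Im c = complex.Im d -> c = d.
Proof. by case: c d => ? ? [? ?] /= -> ->. Qed.

Lemma is_pdD b F G z c d :
  is_pd b F z c -> is_pd b G z d -> is_pd b (fun w => F w + G w) z (c + d).
Proof.
move=> [h1 h2] [h3 h4]; split.
  have -> : (fun w => complex.Re (F w + G w)) =
     (fun w => complex.Re (F w)) + (fun w => complex.Re (G w)).
    by apply/funext => w; rewrite ReD.
  by rewrite ReD; apply: is_deriveD.
have -> : (fun w => complex.Im (F w + G w)) =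
   (fun w => complex.Im (F w)) + (fun w => complex.Im (G w)).
  by apply/funext => w; rewrite ImD.
by rewrite ImD; apply: is_deriveD.
Qed.

Lemma is_pdM b F G z c d :
  is_pd b F z c -> is_pd b G z d ->
  is_pd b (fun w => F w * G w) z (c * G z + F z * d).
Proof.
move=> [h1 h2] [h3 h4]; split.
  have -> : (fun w => complex.Re (F w * G w)) =
     (fun w => complex.Re (F w)) * (fun w => complex.Re (G w)) -
     (fun w => complex.Im (F w)) * (fun w => complex.Im (G w)).
    by apply/funext => w; rewrite ReM.
  apply: is_derive_eq; rewrite ReD !ReM /GRing.scale /=; ring.
have -> : (fun w => complex.Im (F w * G w)) =
   (fun w => complex.Re (F w)) * (fun w => complex.Im (G w)) +
   (fun w => complex.Im (F w)) * (fun w => complex.Re (G w)).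
  by apply/funext => w; rewrite ImM.
apply: is_derive_eq; rewrite ImD !ImM /GRing.scale /=; ring.
Qed.

Lemma is_pdJ b F z c : is_pd b F z c -> is_pd b (fun w => (F w)^*) z c^*.
Proof.
move=> [h1 h2]; split.
  rewrite ReJ; have -> // : (fun w => complex.Re (F w)^*) =
      (fun w => complex.Re (F w)).
  by apply/funext => w; rewrite ReJ.
have -> : (fun w => complex.Im (F w)^*) = - (fun w => complex.Im (F w)).
  by apply/funext => w; rewrite ImJ.
by rewrite ImJ; exact: is_deriveN.
Qed.

Lemma eq_pd b F G z c : F =1 G -> is_pd b F z c -> is_pd b G z c.
Proof. by move=> /funext ->. Qed.

Lemma is_derive_inv (f : plane -> R) z v (df : R) : f z != 0 ->
  is_derive z v f df -> is_derive z v (fun w => (f w)^-1) (- (f z) ^- 2 * df).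
Proof.
move=> f0 [fd <-]; apply: DeriveDef; first exact: derivableV.
by rewrite deriveV.
Qed.

(** Writing 1/F as conj F / |F|^2 leaves only the inverse of a real function to differentiate. *)
Lemma is_pdV b F z c : F z != 0 -> is_pd b F z c ->
  is_pd b (fun w => (F w)^-1) z (- c / F z ^+ 2).
Proof.
move=> F0 hF.
pose N := fun w => complex.Re (F w) ^+ 2 + complex.Im (F w) ^+ 2.
have N0 : N z != 0.
  rewrite /N; apply: contra F0; rewrite paddr_eq0 ?sqr_ge0// !sqrf_eq0.
  by case/andP; case: (F z) => x y /= /eqP -> /eqP ->.
have FV w : (F w)^-1 = (N w)^-1%:C * (F w)^*.
  by rewrite /N; case: (F w) => x y; apply: complex_eqP;
    rewrite ?(ReM, ImM, ReJ, ImJ) /=; ring.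
case: (hF) => h1 h2.
have hN : is_pd b (fun w => (N w)%:C) z (c * (F z)^* + F z * c^*).
  apply: eq_pd (is_pdM hF (is_pdJ hF)) => w.
  by rewrite /N; case: (F w) => x y; apply: complex_eqP;
    rewrite ?(ReM, ImM, ReJ, ImJ) /=; ring.
have hI : is_pd b (fun w => (N w)^-1%:C) z
    (- ((N z) ^- 2)%:C * (c * (F z)^* + F z * c^*)).
  case: hN => hN _.
  have := is_derive_inv N0 hN; set d := complex.Re _ => hI.
  have -> : c * (F z)^* + F z * c^* = d%:C.
    by rewrite /d; case: (c) (F z) => x y [x' y']; apply: complex_eqP;
      rewrite ?(ReD, ImD, ReM, ImM, ReJ, ImJ) /=; ring.
  rewrite -[- _%:C]rmorphN -rmorphM.
  by split; [exact: hI|exact: is_derive_cst].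
have := is_pdM hI (is_pdJ hF).
have Fb0 : (F z)^* != 0 by rewrite conjC_eq0.
have NE : (N z)%:C = F z * (F z)^*.
  by rewrite /N; case: (F z) => x y; apply: complex_eqP;
    rewrite ?(ReM, ImM, ReJ, ImJ) /=; ring.
have -> : - ((N z) ^- 2)%:C * (c * (F z)^* + F z * c^*) * (F z)^* +
    (N z)^-1%:C * c^* = - c / F z ^+ 2.
  rewrite !fmorphV !rmorphXn /= NE; field; exact/andP.
by apply: eq_pd => w; rewrite FV.
Qed.
End PartialDerivatives.

(** * Symmetry of second derivatives and the algebra of C^k functions *)

Section Smoothness.
Variable R : realType.
Local Notation plane := (R * R)%type.
Implicit Types (F G : plane -> R) (z w v : plane) (b : bool) (U : set plane).

(** Squares serve as neighbourhoods because a path from the centre made of one horizontal and one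
    vertical segment stays inside. *)
Definition box z (e : R) : set plane :=
  [set w | `|w.1 - z.1| < e /\ `|w.2 - z.2| < e].

Lemma nbhs_box z U : nbhs z U <-> exists2 e, 0 < e & box z e `<=` U.
Proof.
split=> [/nbhs_ballP[e /= e0 h]|[e e0 h]].
  exists e => // w [h1 h2]; apply: h; split; rewrite /ball /= distrC//.
apply/nbhs_ballP; exists e => //= w [h1 h2]; apply: h.
by split; rewrite distrC.
Qed.

Lemma open_box z U : open U -> U z -> exists2 e, 0 < e & box z e `<=` U.
Proof. by move=> oU Uz; apply/nbhs_box; exact: open_nbhs_nbhs. Qed.

(** Reduces directional derivatives to functions of one real variable, where the mean value theorem
    applies. *)
Lemma is_derive_line F z v t d :
  is_derive (z + t *: v) v F d <-> is_derive t 1 (fun s => F (z + s *: v)) d.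
Proof.
have e : (fun h => h^-1 *: ((F \o shift (z + t *: v)) (h *: v) -
    F (z + t *: v))) = (fun h : R => h^-1 *: (((fun s => F (z + s *: v)) \o
    shift t) (h *: 1) - F (z + t *: v))).
  apply/funext => h; rewrite /= /shift /=; congr (_ *: (F _ - _)).
  by rewrite addrC -addrA -scalerDl; congr (_ + _ *: _);
    rewrite /GRing.scale /= mulr1 addrC.
by split=> -[h1 h2]; apply: DeriveDef;
  move: h1 h2; rewrite /derivable /derive e.
Qed.

Lemma mvt_line F z v t : 0 < t ->
  (forall s, 0 <= s <= t -> derivable F (z + s *: v) v) ->
  exists2 s, 0 < s < t & F (z + t *: v) - F z = t * 'D_v F (z + s *: v).
Proof.
move=> t0 h.
have hd s : 0 <= s <= t ->
    is_derive s 1 (fun s => F (z + s *: v)) ('D_v F (z + s *: v)).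
  by move=> /h /derivableP /is_derive_line.
have [|||s] := @MVT R (fun s => F (z + s *: v)) (fun s => 'D_v F (z + s *: v))
  0 t.
- exact: t0.
- move=> s; rewrite in_itv /= => /andP[s0 st].
  by apply: hd; rewrite (ltW s0) (ltW st).
- apply: derivable_within_continuous => s; rewrite in_itv /= => hs.
  by case: (hd s hs).
rewrite in_itv /= scale0r addr0 subr0 => hs ->; exists s => //.
by rewrite mulrC.
Qed.

Lemma partial_eq U F G b z : open U -> U z -> {in U, F =1 G} ->
  partial b F z = partial b G z.
Proof.
move=> oU Uz FG; apply: near_eq_derive.
by apply: filterS (open_nbhs_nbhs (conj oU Uz)) => w Uw; apply/FG/mem_set.
Qed.

(** Two applications of the mean value theorem: along the axis [b] to the difference [G] of two
    translates of [F], and along the other axis to [partial b F]. *)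
Lemma second_difference F z b e : 0 < e ->
  (forall w, box z e w -> derivable F w (axis R b) /\
     derivable (partial b F) w (axis R (~~ b))) ->
  forall t, 0 < t < e -> exists2 w, box z e w &
    F (z + t *: axis R b + t *: axis R (~~ b)) - F (z + t *: axis R (~~ b)) -
    (F (z + t *: axis R b) - F z) = t * (t * partial (~~ b) (partial b F) w).
Proof.
move=> e0 h t /andP[t0 te].
have inbox s u : 0 <= s <= t -> 0 <= u <= t ->
    box z e (z + s *: axis R b + u *: axis R (~~ b)).
  move=> /andP[s0 st] /andP[u0 ut]; rewrite /box /axis /GRing.scale /=.
  have se := le_lt_trans st te; have ue := le_lt_trans ut te.
  by case: b {h} => /=; split;
    rewrite /GRing.scale/= ?mulr0 ?mulr1 ?addr0 (addrC z.1, addrC z.2) addrK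
      ger0_norm.
pose G := fun w => F (w + t *: axis R (~~ b)) - F w.
have dG s : 0 <= s <= t -> is_derive (z + s *: axis R b) (axis R b) G
    (partial b F (z + s *: axis R b + t *: axis R (~~ b)) -
     partial b F (z + s *: axis R b)).
  move=> hs; apply: is_deriveB.
    apply/is_derive_line.
    have [] := h (z + s *: axis R b + t *: axis R (~~ b)).
      by apply: inbox => //; rewrite lexx ltW.
    rewrite -addrA [s *: _ + _]addrC addrA => hd _.
    have /derivableP/is_derive_line := hd.
    rewrite /partial; congr is_derive; apply/funext => u.
    by congr F; rewrite -!addrA [t *: _ + _]addrC.
  apply: derivableP; have [] := h (z + s *: axis R b + 0 *: axis R (~~ b)).
    by apply: inbox => //; rewrite lexx ltW.
  by rewrite scale0r addr0.
have [s /andP[s0 st]] : exists2 s, 0 < s < t &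
    G (z + t *: axis R b) - G z = t * 'D_(axis R b) G (z + s *: axis R b).
  by apply: mvt_line => // s /dG [].
have hs : 0 <= s <= t by rewrite !ltW.
rewrite (@derive_val _ _ _ _ _ _ _ (dG s hs)).
have [u /andP[u0 ut]] := @mvt_line (partial b F) (z + s *: axis R b)
  (axis R (~~ b)) t t0 (fun u hu => (h _ (inbox s u hs hu)).2).
move=> e1 e2; exists (z + s *: axis R b + u *: axis R (~~ b)).
  by apply: inbox => //; rewrite !ltW.
by rewrite /partial -e1 -e2 /G; ring.
Qed.

Lemma half_itv (d : R) : 0 < d -> 0 < d / 2 < d.
Proof. by move=> d0; rewrite divr_gt0//= ltr_pdivrMr// ltr_pMr// ltr1n. Qed.

Lemma half_dist (a c x e : R) : `|a - x| < e / 2 -> `|c - x| < e / 2 ->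
  `|c - a| < e.
Proof.
move=> h1 h2; have -> : c - a = (c - x) - (a - x) by rewrite opprB addrA subrK.
by rewrite (le_lt_trans (ler_normB _ _))// [e]splitr ltrD.
Qed.

Lemma eq_second_difference (d A B B' D x y : R) : 0 < d ->
  A - B - (B' - D) = d * (d * x) -> A - B' - (B - D) = d * (d * y) -> x = y.
Proof.
move=> d0 ex ey; have d1 : d != 0 by rewrite gt_eqF.
by apply: (mulfI d1); apply: (mulfI d1); rewrite -ex -ey; ring.
Qed.

(** The second difference over a small square is symmetric in the two axes, so the two mixed
    derivatives agree at some two points of the square; continuity at [z] makes both close to their
    values there. *)
Lemma partial_comm U F z : open U -> U z ->
  (forall w, U w -> forall b, derivable F w (axis R b) /\
     derivable (partial b F) w (axis R (~~ b))) ->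
  (forall b, {for z, continuous (partial (~~ b) (partial b F))}) ->
  partial true (partial false F) z = partial false (partial true F) z.
Proof.
move=> oU Uz dF cF.
apply/eqP; rewrite -subr_eq0 -normr_le0; apply/ler_addgt0Pl => e e0.
rewrite addr0.
have e20 : 0 < e / 2 by rewrite divr_gt0.
have near_b b : \forall w \near z, `|partial (~~ b) (partial b F) z -
    partial (~~ b) (partial b F) w| < e / 2.
  by have /cvgrPdist_lt /(_ _ e20) := cF b.
have [d d0 hd] : exists2 d, 0 < d & box z d `<=` (U `&`
    [set w | forall b, `|partial (~~ b) (partial b F) z -
    partial (~~ b) (partial b F) w| < e / 2]).
  apply/nbhs_box; apply: filterI; first exact: open_nbhs_nbhs.
  by apply: filterS2 (near_b true) (near_b false) => w h1 h2 [].
have hb b := @second_difference F z b d d0 (fun w hw => dF w (hd w hw).1 b).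
have [w1 w1b e1] := hb false _ (half_itv d0).
have [w2 w2b e2] := hb true _ (half_itv d0).
have {e1 e2} e12 : partial true (partial false F) w1 =
    partial false (partial true F) w2.
  move: e1 e2; rewrite /= [z + _ + _]addrAC.
  by apply: eq_second_difference; rewrite divr_gt0.
apply/ltW/half_dist; first exact: (hd _ w2b).2 true.
by rewrite /= -e12; exact: (hd _ w1b).2 false.
Qed.

(** [smooth_on] speaks of words of partial derivatives, but the derivative of a product is not such
    a word applied to a factor. Recursion on the order makes closure under sums, products and
    inverses an induction. *)
Fixpoint Ck k U F : Prop :=
  if k is k'.+1 then
    (forall z, U z -> {for z, continuous F} /\
       forall b, derivable F z (axis R b)) /\
    forall b, Ck k' U (partial b F)
  else forall z, U z -> {for z, continuous F}.

Lemma CkS k U F : Ck k.+1 U F -> Ck k U F.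
Proof.
elim: k F => [|k IH] F; first by move=> [h _] z /h [].
by move=> [h1 h2]; split=> // b; apply: IH.
Qed.

Lemma smooth_onP U F : smooth_on U F <-> forall k, Ck k U F.
Proof.
split=> [h k|h l].
  elim: k F h => [|k IH] F h; first by move=> z /(h [::])[].
  split=> [z /(h [::])//|b]; apply: IH => l z Uz.
  by have := h (rcons l b) z Uz; rewrite foldr_rcons.
elim/last_ind: l F h => [|l b IH] F h.
  by move=> z Uz; have [/(_ z Uz)] := h 1%N.
rewrite foldr_rcons; apply: IH => k.
exact: (h k.+1).2.
Qed.

Lemma near_eq_continuous F G z : {near z, F =1 G} ->
  {for z, continuous F} -> {for z, continuous G}.
Proof.
move=> FG cF.
have : F @ z --> G z by rewrite -(nbhs_singleton FG); exact: cF.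
move=> {}cF; apply: cvg_trans cF.
by apply: near_eq_cvg; apply: filterS FG => w ->.
Qed.

Lemma open_near_eq (T : Type) U (F G : plane -> T) z : open U -> U z -> {in U, F =1 G} ->
  {near z, F =1 G}.
Proof.
move=> oU Uz FG.
by apply: filterS (open_nbhs_nbhs (conj oU Uz)) => w Uw; apply/FG/mem_set.
Qed.

Lemma Ck_eq k U F G : open U -> {in U, F =1 G} -> Ck k U F -> Ck k U G.
Proof.
move=> oU; elim: k F G => [|k IH] F G FG.
  by move=> h z Uz; apply: near_eq_continuous (h z Uz); exact: open_near_eq FG.
move=> [h1 h2]; split=> [z Uz|b]; last first.
  apply: IH (h2 b) => z /set_mem Uz; exact: partial_eq FG.
have [cF dF] := h1 z Uz.
have FGz := open_near_eq oU Uz FG.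
by split=> [|b]; [exact: near_eq_continuous cF|exact: near_eq_derivable (dF b)].
Qed.

Lemma Ck_cst k U (c : R) : Ck k U (fun=> c).
Proof.
elim: k c => [|k IH] c; first by move=> z _; apply: cvg_cst.
split=> [z _|b]; first by split=> [|b]; [apply: cvg_cst|exact: derivable_cst].
have -> : partial b (fun=> c) = fun=> 0 by apply/funext => z; exact: derive_cst.
exact: IH.
Qed.

Lemma CkD k U F G : open U -> Ck k U F -> Ck k U G ->
  Ck k U (fun z => F z + G z).
Proof.
move=> oU; elim: k F G => [|k IH] F G.
  by move=> hF hG z Uz; apply: cvgD; [exact: hF|exact: hG].
move=> [hF hF'] [hG hG']; split=> [z Uz|b].
  have [cF dF] := hF z Uz; have [cG dG] := hG z Uz.
  by split=> [|b]; [exact: cvgD|exact: derivableD].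
apply: Ck_eq (IH _ _ (hF' b) (hG' b)) => // z /set_mem Uz.
have [_ dF] := hF z Uz; have [_ dG] := hG z Uz.
by rewrite /partial -deriveD.
Qed.

Lemma CkM k U F G : open U -> Ck k U F -> Ck k U G ->
  Ck k U (fun z => F z * G z).
Proof.
move=> oU; elim: k F G => [|k IH] F G.
  by move=> hF hG z Uz; apply: cvgM; [exact: hF|exact: hG].
move=> hF hG; have [hF1 hF'] := hF; have [hG1 hG'] := hG.
split=> [z Uz|b].
  have [cF dF] := hF1 z Uz; have [cG dG] := hG1 z Uz.
  by split=> [|b]; [exact: cvgM|exact: derivableM].
apply: (@Ck_eq _ _ (fun z => F z * partial b G z + G z * partial b F z)) => //.
  move=> z /set_mem Uz.
  have [_ dF] := hF1 z Uz; have [_ dG] := hG1 z Uz.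
  by rewrite /partial (deriveM (dF b) (dG b)).
exact: (CkD oU (IH _ _ (CkS hF) (hG' b)) (IH _ _ (CkS hG) (hF' b))).
Qed.

Lemma CkV k U F : open U -> (forall z, U z -> F z != 0) -> Ck k U F ->
  Ck k U (fun z => (F z)^-1).
Proof.
move=> oU F0; elim: k => [|k IH] hF.
  by move=> z Uz; apply: cvgV; [exact: F0|exact: hF].
have [hF1 hF'] := hF; split=> [z Uz|b].
  have [cF dF] := hF1 z Uz.
  by split=> [|b]; [apply: cvgV => //; exact: F0|apply: derivableV => //; exact: F0].
pose I z := (F z)^-1.
apply: (@Ck_eq _ _ (fun z => -1 * (I z * I z) * partial b F z)) => //.
  move=> z /set_mem Uz; have [_ dF] := hF1 z Uz.
  rewrite /partial (deriveV (F0 z Uz) (dF b)) /I /GRing.scale /=.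
  by rewrite -exprVn expr2 mulN1r.
have cI : Ck k U I := IH (CkS hF).
exact: (CkM oU (CkM oU (Ck_cst _ _ _) (CkM oU cI cI)) (hF' b)).
Qed.

End Smoothness.

(** * Scalar Wirtinger operators and holomorphic functions *)

Section Wirtinger.
Variable R : realType.
Local Notation C := R[i].
Local Notation plane := (R * R)%type.
Implicit Types (F G : plane -> C) (z w : plane) (b : bool) (U : set plane).

Definition wz F : plane -> C :=
  fun z => (partialC false F z - 'i * partialC true F z) / 2.
Definition wzb F : plane -> C :=
  fun z => (partialC false F z + 'i * partialC true F z) / 2.

Lemma partialC_wz F z : partialC false F z = wz F z + wzb F z.
Proof. by rewrite /wz /wzb; field. Qed.

Lemma partialC_wzb F z : partialC true F z = 'i * (wz F z - wzb F z).
Proof.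
have i2 : 'i * 'i = -1 :> C by rewrite -expr2 sqrCi.
have -> : 'i * (wz F z - wzb F z) = - ('i * 'i) * partialC true F z.
  by rewrite /wz /wzb; field.
by rewrite i2 opprK mul1r.
Qed.

Lemma conjCM (c d : C) : (c * d)^* = c^* * d^*. Proof. exact: rmorphM. Qed.
Lemma conjCD (c d : C) : (c + d)^* = c^* + d^*. Proof. exact: rmorphD. Qed.
Lemma conjCN (c : C) : (- c)^* = - c^*. Proof. exact: rmorphN. Qed.

Lemma pderivable_cst (c : C) z : pderivable (fun=> c) z.
Proof. by move=> b; split; exact: derivable_cst. Qed.

Lemma pderivableD F G z : pderivable F z -> pderivable G z ->
  pderivable (fun w => F w + G w) z.
Proof.
move=> hF hG; apply: is_pd_pderivable; apply: is_pdD; exact: pderivableP.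
Qed.

Lemma pderivableM F G z : pderivable F z -> pderivable G z ->
  pderivable (fun w => F w * G w) z.
Proof.
move=> hF hG; apply: is_pd_pderivable; apply: is_pdM; exact: pderivableP.
Qed.

Lemma pderivableJ F z : pderivable F z -> pderivable (fun w => (F w)^*) z.
Proof.
move=> hF; apply: is_pd_pderivable; apply: is_pdJ; exact: pderivableP.
Qed.

Lemma pderivableV F z : F z != 0 -> pderivable F z ->
  pderivable (fun w => (F w)^-1) z.
Proof.
move=> F0 hF; apply: is_pd_pderivable; apply: is_pdV => //; exact: pderivableP.
Qed.

Lemma near_partialC b F G z : {near z, F =1 G} ->
  partialC b F z = partialC b G z.
Proof.
move=> FG; rewrite /partialC /partial.
by congr (_ +i* _); apply: near_eq_derive; apply: filterS FG => w ->.
Qed.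

Lemma near_wz F G z : {near z, F =1 G} -> wz F z = wz G z.
Proof. by move=> FG; rewrite /wz !(near_partialC _ FG). Qed.

Lemma near_wzb F G z : {near z, F =1 G} -> wzb F z = wzb G z.
Proof. by move=> FG; rewrite /wzb !(near_partialC _ FG). Qed.

Lemma wz_cst (c : C) z : wz (fun=> c) z = 0.
Proof. by rewrite /wz !(is_pd_val (is_pd_cst _ _ _)) mulr0 subr0 mul0r. Qed.

Lemma wzb_cst (c : C) z : wzb (fun=> c) z = 0.
Proof. by rewrite /wzb !(is_pd_val (is_pd_cst _ _ _)) mulr0 addr0 mul0r. Qed.

Section Rules.
Variables (F G : plane -> C) (z : plane).
Hypotheses (hF : pderivable F z) (hG : pderivable G z).

Lemma wzD : wz (fun w => F w + G w) z = wz F z + wz G z.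
Proof.
rewrite /wz !(is_pd_val (is_pdD (pderivableP _ hF) (pderivableP _ hG))).
by rewrite -mulrDl mulrDr opprD addrACA.
Qed.

Lemma wzbD : wzb (fun w => F w + G w) z = wzb F z + wzb G z.
Proof.
rewrite /wzb !(is_pd_val (is_pdD (pderivableP _ hF) (pderivableP _ hG))).
by rewrite -mulrDl mulrDr addrACA.
Qed.

Lemma wzM : wz (fun w => F w * G w) z = wz F z * G z + F z * wz G z.
Proof.
rewrite /wz !(is_pd_val (is_pdM (pderivableP _ hF) (pderivableP _ hG))).
by field.
Qed.

Lemma wzbM : wzb (fun w => F w * G w) z = wzb F z * G z + F z * wzb G z.
Proof.
rewrite /wzb !(is_pd_val (is_pdM (pderivableP _ hF) (pderivableP _ hG))).
by field.
Qed.

Lemma wzJ : wz (fun w => (F w)^*) z = (wzb F z)^*.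
Proof.
rewrite /wz /wzb !(is_pd_val (is_pdJ (pderivableP _ hF))).
by rewrite conjCM conjCD conjCM fmorphV rmorph_nat conjCi mulNr.
Qed.

Lemma wzbJ : wzb (fun w => (F w)^*) z = (wz F z)^*.
Proof.
rewrite /wz /wzb !(is_pd_val (is_pdJ (pderivableP _ hF))).
by rewrite conjCM conjCD conjCN conjCM fmorphV rmorph_nat conjCi mulNr opprK.
Qed.

Hypothesis F0 : F z != 0.

Lemma wzbV : wzb (fun w => (F w)^-1) z = - wzb F z / F z ^+ 2.
Proof.
rewrite /wzb !(is_pd_val (is_pdV F0 (pderivableP _ hF))).
by field; exact: F0.
Qed.

End Rules.

Lemma smooth_onD U (f g : plane -> R) : open U -> smooth_on U f ->
  smooth_on U g -> smooth_on U (fun w => f w + g w).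
Proof.
move=> oU /smooth_onP hf /smooth_onP hg; apply/smooth_onP => k; exact: CkD.
Qed.

Lemma smooth_onM U (f g : plane -> R) : open U -> smooth_on U f ->
  smooth_on U g -> smooth_on U (fun w => f w * g w).
Proof.
move=> oU /smooth_onP hf /smooth_onP hg; apply/smooth_onP => k; exact: CkM.
Qed.

Lemma smooth_onV U (f : plane -> R) : open U -> (forall z, U z -> f z != 0) ->
  smooth_on U f -> smooth_on U (fun w => (f w)^-1).
Proof.
move=> oU f0 /smooth_onP hf; apply/smooth_onP => k; exact: CkV.
Qed.

Lemma smooth_on_cst U (c : R) : smooth_on U (fun=> c).
Proof. by apply/smooth_onP => k; exact: Ck_cst. Qed.

Lemma smooth_on_eq U (f g : plane -> R) : open U -> {in U, f =1 g} ->
  smooth_on U f -> smooth_on U g.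
Proof.
by move=> oU fg /smooth_onP hf; apply/smooth_onP => k; exact: Ck_eq (hf k).
Qed.

Lemma smooth_on_partial U (f : plane -> R) b : smooth_on U f ->
  smooth_on U (partial b f).
Proof.
by move=> /smooth_onP hf; apply/smooth_onP => k; exact: (hf k.+1).2.
Qed.

Lemma smooth_onN U (f : plane -> R) : open U -> smooth_on U f ->
  smooth_on U (fun w => - f w).
Proof.
move=> oU hf.
have := smooth_onM oU (@smooth_on_cst U (-1)) hf.
by apply: smooth_on_eq oU _ => w _; rewrite mulN1r.
Qed.

Definition smoothC U F : Prop :=
  smooth_on U (fun w => complex.Re (F w)) /\
  smooth_on U (fun w => complex.Im (F w)).

Lemma smoothC_pderivable U F z : smoothC U F -> U z -> pderivable F z.
Proof.
by move=> [h1 h2] Uz b; split; [apply: (h1 [::] z Uz).2|apply: (h2 [::] z Uz).2].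
Qed.

Lemma smoothC_eq U F G : open U -> {in U, F =1 G} -> smoothC U F -> smoothC U G.
Proof.
move=> oU FG [h1 h2]; split; [apply: smooth_on_eq h1|apply: smooth_on_eq h2] => //;
by move=> w Uw /=; rewrite FG.
Qed.

Lemma smoothC_cst U (c : C) : smoothC U (fun=> c).
Proof. by split; exact: smooth_on_cst. Qed.

Lemma smoothCD U F G : open U -> smoothC U F -> smoothC U G ->
  smoothC U (fun w => F w + G w).
Proof.
move=> oU [f1 f2] [g1 g2]; split.
  apply: smooth_on_eq (smooth_onD oU f1 g1) => // w _; by rewrite ReD.
apply: smooth_on_eq (smooth_onD oU f2 g2) => // w _; by rewrite ImD.
Qed.

Lemma smoothCM U F G : open U -> smoothC U F -> smoothC U G ->
  smoothC U (fun w => F w * G w).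
Proof.
move=> oU [f1 f2] [g1 g2]; split.
  apply: smooth_on_eq (smooth_onD oU (smooth_onM oU f1 g1)
    (smooth_onN oU (smooth_onM oU f2 g2))) => // w _; by rewrite ReM.
apply: smooth_on_eq (smooth_onD oU (smooth_onM oU f1 g2)
  (smooth_onM oU f2 g1)) => // w _; by rewrite ImM.
Qed.

Lemma smoothCJ U F : open U -> smoothC U F -> smoothC U (fun w => (F w)^*).
Proof.
move=> oU [f1 f2]; split.
  by apply: smooth_on_eq f1 => // w _; rewrite ReJ.
by apply: smooth_on_eq (smooth_onN oU f2) => // w _; rewrite ImJ.
Qed.

Lemma smoothCV U F : open U -> (forall z, U z -> F z != 0) -> smoothC U F ->
  smoothC U (fun w => (F w)^-1).
Proof.
move=> oU F0 hF.
pose N w := complex.Re (F w * (F w)^*).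
have FN w : F w * (F w)^* = (N w)%:C.
  by apply: complex_eqP => //; rewrite ImM ReJ ImJ /=; ring.
have hN : smoothC U (fun w => (N w)^-1%:C).
  split; last exact: smooth_on_cst.
  apply: (smooth_onV oU); last exact: (smoothCM oU hF (smoothCJ oU hF)).1.
  move=> z /F0 Fz0; have : F z * (F z)^* != 0 by rewrite mulf_neq0// conjC_eq0.
  by rewrite FN; apply: contra => /eqP ->.
apply: smoothC_eq (smoothCM oU hN (smoothCJ oU hF)) => // w /set_mem /F0 Fw0.
have Fb0 : (F w)^* != 0 by rewrite conjC_eq0.
by rewrite fmorphV /= -FN; field; apply/andP.
Qed.

Lemma smoothC_partialC U F b : smoothC U F -> smoothC U (partialC b F).
Proof. by move=> [h1 h2]; split; apply: smooth_on_partial. Qed.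

Lemma smoothC_wz U F : open U -> smoothC U F -> smoothC U (wz F).
Proof.
move=> oU hF.
have h1 := smoothC_partialC false hF.
have h2 := smoothCM oU (@smoothC_cst U (- 'i)) (smoothC_partialC true hF).
have := smoothCM oU (smoothCD oU h1 h2) (@smoothC_cst U 2^-1).
by apply: smoothC_eq oU _ => w _; rewrite mulNr.
Qed.

Lemma smooth_partial_comm U (f : plane -> R) z : open U -> smooth_on U f ->
  U z -> partial true (partial false f) z = partial false (partial true f) z.
Proof.
move=> oU /smooth_onP h Uz; apply: (@partial_comm R U _ _ oU Uz).
  move=> w Uw b; split; first exact: ((h 1%N).1 w Uw).2.
  exact: (((h 2%N).2 b).1 w Uw).2.
move=> b; exact: ((h 2%N).2 b).2 (~~ b) z Uz.
Qed.

Lemma partialC_comm U F z : open U -> smoothC U F -> U z ->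
  partialC true (partialC false F) z = partialC false (partialC true F) z.
Proof.
move=> oU [h1 h2] Uz; rewrite /partialC /=.
by rewrite (smooth_partial_comm oU h1 Uz) (smooth_partial_comm oU h2 Uz).
Qed.

Definition hol U F : Prop := smoothC U F /\ forall z, U z -> wzb F z = 0.

Lemma hol_pderivable U F z : hol U F -> U z -> pderivable F z.
Proof. by move=> [h _]; exact: smoothC_pderivable. Qed.

Lemma hol_eq U F G : open U -> {in U, F =1 G} -> hol U F -> hol U G.
Proof.
move=> oU FG [h1 h2]; split=> [|z Uz]; first exact: smoothC_eq h1.
by rewrite -(h2 z Uz); apply/esym/near_wzb; exact: open_near_eq oU Uz FG.
Qed.

Lemma holS U V F : U `<=` V -> hol V F -> hol U F.
Proof.
move=> UV [[h1 h2] h3]; split=> [|z /UV]; last exact: h3.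
by split=> l z /UV; [exact: h1|exact: h2].
Qed.

Lemma hol_cst U (c : C) : hol U (fun=> c).
Proof. by split=> [|z _]; [exact: smoothC_cst|exact: wzb_cst]. Qed.

Lemma holD U F G : open U -> hol U F -> hol U G -> hol U (fun w => F w + G w).
Proof.
move=> oU hF hG; split=> [|z Uz]; first exact: smoothCD hF.1 hG.1.
by rewrite wzbD ?hF.2 ?hG.2 ?addr0//; apply: hol_pderivable Uz.
Qed.

Lemma holM U F G : open U -> hol U F -> hol U G -> hol U (fun w => F w * G w).
Proof.
move=> oU hF hG; split=> [|z Uz]; first exact: smoothCM hF.1 hG.1.
by rewrite wzbM ?hF.2 ?hG.2 ?mulr0 ?mul0r ?addr0//; apply: hol_pderivable Uz.
Qed.

Lemma holV U F : open U -> (forall z, U z -> F z != 0) -> hol U F ->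
  hol U (fun w => (F w)^-1).
Proof.
move=> oU F0 hF; split=> [|z Uz]; first exact: smoothCV hF.1.
by rewrite wzbV ?hF.2 ?oppr0 ?mul0r//; [exact: hol_pderivable Uz|exact: F0].
Qed.

Lemma hol_sum U (I : Type) (r : seq I) (P : pred I) (F : I -> plane -> C) :
  open U -> (forall i, P i -> hol U (F i)) ->
  hol U (fun w => \sum_(i <- r | P i) F i w).
Proof.
move=> oU hF.
have -> : (fun w => \sum_(i <- r | P i) F i w) = \sum_(i <- r | P i) F i.
  by apply/funext => w; rewrite fct_sumE.
elim/big_ind: _; [exact: hol_cst|move=> f g; exact: holD|exact: hF].
Qed.

Lemma hol_prod U (I : Type) (r : seq I) (P : pred I) (F : I -> plane -> C) :
  open U -> (forall i, P i -> hol U (F i)) ->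
  hol U (fun w => \prod_(i <- r | P i) F i w).
Proof.
move=> oU hF; elim: r => [|i r IH].
  under [fun w => _]funext do rewrite big_nil; exact: hol_cst.
under [fun w => _]funext do rewrite big_cons.
case Pi : (P i); [exact: holM oU (hF i Pi) IH|exact: IH].
Qed.

Lemma hol_partial U F z : hol U F -> U z ->
  partialC false F z = wz F z /\ partialC true F z = 'i * wz F z.
Proof.
by move=> hF Uz; rewrite partialC_wz partialC_wzb hF.2// addr0 subr0.
Qed.

(** For holomorphic [F] the partial derivatives are F' and i F'. Since they commute, the
    y-derivative of F' is i times its x-derivative, which is the Cauchy-Riemann equation for F'. *)
Lemma hol_wz U F : open U -> hol U F -> hol U (wz F).
Proof.
move=> oU hF; split=> [|z Uz]; first exact: smoothC_wz hF.1.
have h1 : {near z, partialC false F =1 wz F}.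
  by apply: open_near_eq oU Uz _ => w /set_mem Uw; exact: (hol_partial hF Uw).1.
have h2 : {near z, partialC true F =1 fun w => 'i * wz F w}.
  by apply: open_near_eq oU Uz _ => w /set_mem Uw; exact: (hol_partial hF Uw).2.
have d : pderivable (wz F) z.
  exact: smoothC_pderivable (smoothC_wz oU hF.1) Uz.
have := partialC_comm oU hF.1 Uz.
rewrite (near_partialC _ h1) (near_partialC _ h2).
rewrite (is_pd_val (is_pdM (is_pd_cst _ _ _) (pderivableP _ d))) mul0r add0r.
rewrite /wzb => ->; rewrite mulrA -expr2 sqrCi mulN1r subrr mul0r //.
Qed.

Lemma iter_wz_eq U F G n z : open U -> {in U, F =1 G} -> U z ->
  iter n wz F z = iter n wz G z.
Proof.
move=> oU FG; elim: n z => [|n IH] z Uz /=; first by apply: FG; exact: mem_set.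
by apply/near_wz; apply: open_near_eq oU Uz _ => w /set_mem; exact: IH.
Qed.

Lemma dzE m n (F : plane -> 'M[C]_(m, n)) z i j :
  dz F z i j = wz (fun w => F w i j) z.
Proof. by rewrite mxE. Qed.

Lemma dzbarE m n (F : plane -> 'M[C]_(m, n)) z i j :
  dzbar F z i j = wzb (fun w => F w i j) z.
Proof. by rewrite mxE. Qed.

Lemma iter_dzE m n (F : plane -> 'M[C]_(m, n)) k z i j :
  iter k (@dz R m n) F z i j = iter k wz (fun w => F w i j) z.
Proof.
elim: k z => [//|k IH] z /=; rewrite dzE.
by congr (wz _ z); apply/funext => w; rewrite IH.
Qed.

Lemma holomorphic_mxP m n U (F : plane -> 'M[C]_(m, n)) :
  holomorphic_mx U F <-> forall i j, hol U (fun w => F w i j).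
Proof.
split=> [[h1 h2] i j|h].
  by split=> [|z Uz]; [exact: h1|rewrite -dzbarE h2// mxE].
split=> [i j|z Uz]; first exact: (h i j).1.
by apply/matrixP => i j; rewrite dzbarE (h i j).2// mxE.
Qed.

End Wirtinger.

(** * A flat holomorphic function vanishes locally *)

Section Flatness.
Variable R : realType.
Local Notation C := R[i].
Local Notation plane := (R * R)%type.
Implicit Types (F G : plane -> C) (f : plane -> R) (z w v : plane) (b : bool)
  (U : set plane).

Lemma is_derive_affine z v (a : plane -> R) (l : R) :
  (forall t, a (z + t *: v) = a z + t * l) -> is_derive z v a l.
Proof.
move=> h; have : is_derive (0 : R) 1 (fun s => a (z + s *: v)) l.
  have -> : (fun s => a (z + s *: v)) = cst (a z) + (fun s : R => s * l).
    by apply/funext => s; rewrite h.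
  have hl : is_derive (0 : R) 1 (fun s : R => s * l) l.
    have -> : (fun s : R => s * l) = l *: id.
      by apply/funext => s; rewrite mulrC.
    by have := is_deriveZ l (is_derive_id (0 : R) 1); rewrite /GRing.scale /= mulr1.
  by have := is_deriveD (is_derive_cst (a z) (0 : R) 1) hl; rewrite add0r.
by move=> /is_derive_line; rewrite scale0r addr0.
Qed.

Definition zeta (z w : plane) : C := (w.1 - z.1) +i* (w.2 - z.2).

Lemma smooth_on_affine U (a : plane -> R) (l : bool -> R) :
  (forall z b t, a (z + t *: axis R b) = a z + t * l b) ->
  continuous a -> smooth_on U a.
Proof.
move=> h ca; apply/smooth_onP => -[|k]; first by move=> z _; exact: ca.
split=> [z _|b].
  by split=> [|b]; [exact: ca|case: (is_derive_affine (h z b))].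
have -> : partial b a = fun=> l b.
  by apply/funext => z; rewrite /partial (@derive_val _ _ _ _ _ _ _ (is_derive_affine (h z b))).
exact: Ck_cst.
Qed.

Lemma zeta_hol U z : hol U (zeta z) /\ forall w, wz (zeta z) w = 1.
Proof.
have h1 (w : plane) b t : (w + t *: axis R b).1 - z.1 = w.1 - z.1 + t * (axis R b).1.
  by rewrite /= addrAC.
have h2 (w : plane) b t : (w + t *: axis R b).2 - z.2 = w.2 - z.2 + t * (axis R b).2.
  by rewrite /= addrAC.
have pd w b : is_pd b (zeta z) w ((axis R b).1 +i* (axis R b).2).
  by split; [exact: is_derive_affine (h1 w b)|exact: is_derive_affine (h2 w b)].
have i2 : 'i * 'i = -1 :> C by rewrite -expr2 sqrCi.
have e0 : (0 +i* 1 : C) = 'i by [].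
have e1 : (1 +i* 0 : C) = 1 by [].
split=> [|w].
  split=> [|w _].
    split; [apply: smooth_on_affine (fun w b => h1 w b) _|
            apply: smooth_on_affine (fun w b => h2 w b) _] => w.
      by apply: cvgB; [exact: cvg_fst|exact: cvg_cst].
    by apply: cvgB; [exact: cvg_snd|exact: cvg_cst].
  by rewrite /wzb !(is_pd_val (pd _ _)) /= e0 e1 i2 subrr mul0r.
by rewrite /wz !(is_pd_val (pd _ _)) /= e0 e1 i2 opprK mulfV// pnatr_eq0.
Qed.

Definition sqn (c : C) : R := complex.Re c ^+ 2 + complex.Im c ^+ 2.

Lemma sqnE c : sqn c = complex.Re (c * c^*).
Proof. by rewrite /sqn ReM ReJ ImJ mulrN opprK -!expr2. Qed.

Lemma sqn_ge0 c : 0 <= sqn c.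
Proof. by rewrite addr_ge0// sqr_ge0. Qed.

Lemma sqnM c d : sqn (c * d) = sqn c * sqn d.
Proof. by rewrite /sqn ReM ImM; ring. Qed.

Lemma sqn0 c : (sqn c == 0) = (c == 0).
Proof.
rewrite /sqn paddr_eq0 ?sqr_ge0// !sqrf_eq0; case: c => x y /=.
by rewrite eq_complex.
Qed.

Lemma sqnV c : sqn c^-1 = (sqn c)^-1.
Proof.
have [->|c0] := eqVneq c 0; first by rewrite invr0 /sqn expr0n /= addr0 invr0.
have s0 : sqn c != 0 by rewrite sqn0.
apply: (mulfI s0); rewrite mulfV// -sqnM mulfV// /sqn /=.
by rewrite expr1n expr0n addr0.
Qed.

Lemma sqnX c n : sqn (c ^+ n) = sqn c ^+ n.
Proof.
elim: n => [|n IH]; first by rewrite !expr0 /sqn /= expr1n expr0n addr0.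
by rewrite !exprS sqnM IH.
Qed.

Definition lap f : plane -> R :=
  fun z => partial false (partial false f) z + partial true (partial true f) z.

Lemma smooth_sqn U F : open U -> smoothC U F -> smooth_on U (fun w => sqn (F w)).
Proof.
move=> oU hF; apply: smooth_on_eq oU _ (smoothCM oU hF (smoothCJ oU hF)).1.
by move=> w _; rewrite sqnE.
Qed.

Lemma partial_sqn b F z : pderivable F z ->
  partial b (fun w => sqn (F w)) z =
  complex.Re (partialC b F z * (F z)^*) *+ 2.
Proof.
move=> hF.
have [h _] := is_pdM (pderivableP b hF) (is_pdJ (pderivableP b hF)).
have -> : (fun w => sqn (F w)) = (fun w => complex.Re (F w * (F w)^*)).
  by apply/funext => w; rewrite sqnE.
rewrite /partial (@derive_val _ _ _ _ _ _ _ h) ReD !ReM !ReJ !ImJ; ring.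
Qed.

(** The terms with second derivatives, F'' and -F'', cancel between the two axes; each axis leaves 2
    |F'|^2. Hence |F|^2 is subharmonic. *)
Lemma lap_sqn U F z : open U -> hol U F -> U z ->
  lap (fun w => sqn (F w)) z = sqn (wz F z) *+ 4.
Proof.
move=> oU hF Uz; rewrite /lap.
have hF' : hol U (wz F) := hol_wz oU hF.
have step b : partial b (partial b (fun w => sqn (F w))) z =
    complex.Re (partialC b (partialC b F) z * (F z)^* +
                partialC b F z * (partialC b F z)^*) *+ 2.
  pose g w := complex.Re (partialC b F w * (F w)^*).
  have e : {near z, (g + g) =1 partial b (fun w => sqn (F w))}.
    apply: open_near_eq oU Uz _ => w /set_mem Uw.
    by rewrite (partial_sqn _ (hol_pderivable hF Uw)) mulr2n.
  rewrite /partial -(near_eq_derive _ e).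
  have h1 := pderivableP b (smoothC_pderivable (smoothC_partialC b hF.1) Uz).
  have h2 := is_pdJ (pderivableP b (hol_pderivable hF Uz)).
  have [h _] := is_pdM h1 h2.
  by rewrite (@derive_val _ _ _ _ _ _ _ (is_deriveD h h)) mulr2n.
rewrite !step -!mulrnDl.
have [dx dy] := hol_partial hF Uz.
have [dxx _] := hol_partial hF' Uz; have [_ dyy] := hol_partial hF' Uz.
have ex : partialC false (partialC false F) z = wz (wz F) z.
  rewrite -dxx; apply: near_partialC; apply: open_near_eq oU Uz _ => w /set_mem Uw.
  exact: (hol_partial hF Uw).1.
have ey : partialC true (partialC true F) z = - wz (wz F) z.
  have e : {near z, partialC true F =1 (fun w => 'i * wz F w)}.
    apply: open_near_eq oU Uz _ => w /set_mem Uw; exact: (hol_partial hF Uw).2.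
  rewrite (near_partialC _ e).
  rewrite (is_pd_val (is_pdM (is_pd_cst _ _ _) (pderivableP _ (hol_pderivable hF' Uz)))).
  by rewrite mul0r add0r dyy mulrA -expr2 sqrCi mulN1r.
rewrite ex ey dx dy !ReD mulNr.
have -> : complex.Re (- (wz (wz F) z * (F z)^*)) = - complex.Re (wz (wz F) z * (F z)^*).
  by case: (_ * _).
have -> : 'i * wz F z * ('i * wz F z)^* = wz F z * (wz F z)^*.
  by rewrite conjCM conjCi mulrACA mulrN -expr2 sqrCi opprK mul1r.
rewrite -!sqnE addrACA subrr add0r -mulr2n -mulrnA //.
Qed.

(** If the second derivative were positive, the first derivative, zero at the maximum, would be
    positive just after it, and the mean value theorem would give a larger value of [f]. *)
Lemma second_derivative_test f w v : 
  (\forall t \near (0 : R), derivable f (w + t *: v) v) ->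
  derivable ('D_v f) w v ->
  (\forall t \near (0 : R), f (w + t *: v) <= f w) ->
  'D_v ('D_v f) w <= 0.
Proof.
move=> df ddf mf; rewrite leNgt; apply/negP => pos.
have [e /= e0 he] : exists2 e : R, 0 < e &
    forall t, `|t| < e -> derivable f (w + t *: v) v /\ f (w + t *: v) <= f w.
  have [e /= e0 he] := (nbhs_ballP _ _).1 (filterI df mf).
  by exists e => [|t te]; [exact: e0|apply: he; rewrite /ball /= sub0r normrN].
have D0 : 'D_v f w = 0.
  have hd (t : R) : `|t| < e -> is_derive t 1 (fun s : R => f (w + s *: v)) ('D_v f (w + t *: v)).
    by move=> /he[+ _] => /derivableP/is_derive_line.
  have h0 : `|0 : R| < e by rewrite normr0.
  have itv t : t \in `](- e), e[%R -> `|t| < e by rewrite in_itv /= -ltr_norml.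
  have [] := @derive1_at_max R (fun s : R => f (w + s *: v)) (- e) e 0.
  - by rewrite ltW// gtrN.
  - by move=> t /itv/hd[].
  - by rewrite in_itv /= oppr_lt0 e0.
  - by move=> t /itv; rewrite scale0r addr0 => /he[].
  move=> _; rewrite (@derive_val _ _ _ _ _ _ _ (hd 0 h0)) scale0r addr0 => ->//.
set g := 'D_v f in ddf pos D0 *.
have cg : (fun h : R => h^-1 *: (g (w + h *: v) - g w)) @ 0^' --> 'D_v g w.
  have -> : (fun h : R => h^-1 *: (g (w + h *: v) - g w)) =
    (fun h : R => h^-1 *: ((g \o shift w) (h *: v) - g w)).
    by apply/funext => h; rewrite /= /shift /= [w + _]addrC.
  exact: ddf.
have /cvgr_gt /(_ _ pos) := cg.
rewrite near_withinE => /(nbhs_ballP _ _).1 [d /= d0 hd].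
pose t := Num.min d e / 2.
have t0 : 0 < t by rewrite divr_gt0// lt_min d0.
have te : t < d /\ t < e.
  have : t < Num.min d e by rewrite ltr_pdivrMr// ltr_pMr ?ltr1n// lt_min d0.
  by rewrite lt_min => /andP[].
have [|s /andP[s0 st] es] := @mvt_line R f w v t t0.
  move=> s /andP[s0 st]; apply: (he _ _).1.
  by rewrite ger0_norm// (le_lt_trans st te.2).
have := (he t _).2; rewrite gtr0_norm// => /(_ te.2); rewrite -subr_le0 es.
rewrite pmulr_rle0// leNgt => /negP; apply.
have := hd s; rewrite /ball /= sub0r normrN gtr0_norm// => /(_ (lt_trans st te.1)).
have gw : g w = 0 := D0.
rewrite (gt_eqF s0) => /(_ isT); rewrite gw subr0 /GRing.scale /= pmulr_rgt0//.
by rewrite invr_gt0.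
Qed.

Lemma lap_max U f w : open U -> smooth_on U f -> U w ->
  (\forall u \near w, f u <= f w) -> lap f w <= 0.
Proof.
move=> oU sf Uw mf.
have line b (P : set plane) : (\forall u \near w, P u) ->
    \forall t \near (0 : R), P (w + t *: axis R b).
  move=> wP; have : (fun t : R => w + t *: axis R b) @ 0 --> w.
    rewrite -[X in _ --> X]addr0 -(scale0r (axis R b)).
    by apply: cvgD; [exact: cvg_cst|apply: cvgZr_tmp; exact: cvg_id].
  by apply.
have D b : 'D_(axis R b) ('D_(axis R b) f) w <= 0.
  apply: second_derivative_test.
  - apply: (line b (fun u => derivable f u (axis R b))).
    by apply: filterS (open_nbhs_nbhs (conj oU Uw)) => u Uu; apply: (sf [::] u Uu).2.
  - exact: (sf [:: b] w Uw).2.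
  - exact: (line b (fun u => f u <= f w)).
by rewrite /lap /partial -[0]addr0 lerD.
Qed.

(** The sup distance: [box z e] is its open ball, and square annuli are cut out by one continuous
    function. *)
Definition nbox (z w : plane) : R := Num.max `|w.1 - z.1| `|w.2 - z.2|.

Lemma nbox_ge0 z w : 0 <= nbox z w.
Proof. by rewrite le_max normr_ge0. Qed.

Lemma boxE z e w : box z e w <-> nbox z w < e.
Proof. by rewrite /nbox gt_max; split=> [[-> ->]//|/andP[]]. Qed.

Lemma nbox_continuous z : continuous (nbox z).
Proof.
move=> w.
apply: (@continuous_max R _ (fun u : plane => `|u.1 - z.1|)
  (fun u : plane => `|u.2 - z.2|)).
  by apply: cvg_norm; apply: cvgB; [exact: cvg_fst|exact: cvg_cst].
by apply: cvg_norm; apply: cvgB; [exact: cvg_snd|exact: cvg_cst].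
Qed.

Lemma max_sqr_bounds (a b : R) : 0 <= a -> 0 <= b ->
  Num.max a b ^+ 2 <= a ^+ 2 + b ^+ 2 <= 2 * Num.max a b ^+ 2.
Proof.
move=> a0 b0.
have sq (x y : R) : 0 <= x -> x <= y -> x ^+ 2 <= y ^+ 2.
  by move=> x0 xy; rewrite lerXn2r// nnegrE// (le_trans x0).
rewrite mulr_natl mulr2n; case: (leP a b) => [ab|/ltW ba].
  by rewrite lerDr sqr_ge0 lerD// sq.
by rewrite lerDl sqr_ge0 lerD// sq.
Qed.

Lemma nbox_sqn z w :
  nbox z w ^+ 2 <= sqn (zeta z w) <= 2 * nbox z w ^+ 2.
Proof.
rewrite /sqn /= -[(w.1 - z.1) ^+ 2]real_normK ?num_real//.
rewrite -[(w.2 - z.2) ^+ 2]real_normK ?num_real//.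
by apply: max_sqr_bounds.
Qed.

Lemma mvt_line_bound f z v (t K : R) :
  (forall s, `|s| <= `|t| -> derivable f (z + s *: v) v /\
      `|'D_v f (z + s *: v)| <= K) ->
  `|f (z + t *: v) - f z| <= `|t| * K.
Proof.
move=> h; have [t0|t0|->] := ltgtP t 0; last by rewrite scale0r addr0 subrr normr0 mul0r.
  have h' s : 0 <= s <= - t -> `|t + s| <= `|t|.
    by move=> /andP[s0 st]; rewrite [`|t|]ltr0_norm// ler_norml opprK; lra.
  have [||s /andP[s0 st]] := @mvt_line R f (z + t *: v) v (- t).
  - by rewrite oppr_gt0.
  - by move=> s hs; rewrite -addrA -scalerDl; apply: (h _ _).1; exact: h'.
  rewrite scaleNr addrK distrC => ->; rewrite normrM normrN ler_wpM2l//.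
  by rewrite -addrA -scalerDl; apply: (h _ _).2; apply: h'; rewrite !ltW.
have [|s /andP[s0 st] ->] := @mvt_line R f z v t t0.
  by move=> s /andP[s0 st]; apply: (h _ _).1; rewrite !ger0_norm// (le_trans s0).
rewrite normrM ler_wpM2l//; apply: (h _ _).2.
by rewrite !gtr0_norm// ltW.
Qed.

(** The factor 2 counts the two legs, horizontal and vertical, of the path from [z] to [w]. *)
Lemma mvt_box_bound f z w (K : R) :
  (forall u, nbox z u <= nbox z w -> forall b,
     derivable f u (axis R b) /\ `|partial b f u| <= K) ->
  `|f w - f z| <= 2 * (nbox z w * K).
Proof.
move=> h; pose a := w.1 - z.1; pose c := w.2 - z.2.
have wE : w = z + a *: axis R false + c *: axis R true.
  rewrite /a /c; case: (w) (z) => w1 w2 [z1 z2]; congr (_, _);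
  by rewrite /= /GRing.scale /= mulr0 mulr1 addr0 addrC subrK.
have K0 : 0 <= K by have := (h w (lexx _) true).2; apply: le_trans.
have ha : `|a| <= nbox z w by rewrite le_max lexx.
have hc : `|c| <= nbox z w by rewrite le_max lexx orbT.
have hu s t : `|s| <= `|a| -> `|t| <= `|c| ->
    nbox z (z + s *: axis R false + t *: axis R true) <= nbox z w.
  move=> sa tc; rewrite /nbox /axis /= /GRing.scale /= !mulr0 !mulr1 !addr0.
  rewrite ![_ + _ - _]addrAC !subrr !add0r ge_max.
  by rewrite le_max sa/= le_max tc orbT.
have h1 : `|f (z + a *: axis R false) - f z| <= nbox z w * K.
  apply: (@le_trans _ _ (`|a| * K)); last by rewrite ler_wpM2r.
  apply: mvt_line_bound => s sa; rewrite -[_ + _]addr0 -(scale0r (axis R true)).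
  by apply: (h _ _ false); apply: hu => //; rewrite normr0.
have h2 : `|f w - f (z + a *: axis R false)| <= nbox z w * K.
  apply: (@le_trans _ _ (`|c| * K)); last by rewrite ler_wpM2r.
  rewrite [in f w]wE; apply: mvt_line_bound => t tc.
  by apply: (h _ _ true); exact: hu.
rewrite -(subrK (f (z + a *: axis R false)) (f w)) -addrA.
by rewrite (le_trans (ler_normD _ _))// mulr2n mulrDl mul1r lerD.
Qed.

(** This norm suits the mean value bounds, which treat real and imaginary parts separately, and is
    invariant under multiplication by i. *)
Definition nrm1 (c : C) : R := `|complex.Re c| + `|complex.Im c|.

Lemma sqn_le_nrm1 c : sqn c <= nrm1 c ^+ 2.
Proof.
rewrite /sqn /nrm1 -[X in X + _ <= _]real_normK ?num_real//.
rewrite -[X in _ + X <= _]real_normK ?num_real// sqrrD -addrA addrCA addrC.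
by rewrite lerDl mulrn_wge0// mulr_ge0.
Qed.

Lemma nrm1_i c : nrm1 ('i * c) = nrm1 c.
Proof.
rewrite /nrm1; case: c => a b; rewrite ReM ImM /=.
by rewrite !mul0r !mul1r !add0r normrN addrC.
Qed.

Lemma split4 (K N : R) n : 4 * K * N ^+ n.+1 =
  2 * (N * (K * N ^+ n)) + 2 * (N * (K * N ^+ n)).
Proof. by rewrite exprS; ring. Qed.

(** The derivative of a flat function is flat, so the induction hypothesis bounds it by the n-th
    power of the distance, and the mean value inequality gains one more power. The constant grows by
    4: two legs, for the real and for the imaginary part. *)
Lemma flat_bound U F z n : open U -> U z -> hol U F ->
  (forall k, iter k (@wz R) F z = 0) ->
  exists K e : R, [/\ 0 < e, 0 <= K &
    forall w, nbox z w < e -> nrm1 (F w) <= K * nbox z w ^+ n].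
Proof.
move=> oU Uz; elim: n F => [|n IH] F hF flat.
  have [e e0 he] : exists2 e, 0 < e & box z e `<=` [set w | nrm1 (F w) < 1].
    apply/nbhs_box.
    have cF : (fun w => nrm1 (F w)) @ z --> nrm1 (F z).
      by apply: cvgD; apply: cvg_norm; [exact: (hF.1.1 [::] z Uz).1|
        exact: (hF.1.2 [::] z Uz).1].
    have Fz : F z = 0 := flat 0%N.
    have F0 : nrm1 (F z) = 0 by rewrite Fz /nrm1 /= normr0 addr0.
    by have /cvgr_lt := cF; rewrite F0 => /(_ _ ltr01).
  exists 1, e; split=> // w /boxE /he /ltW /=; by rewrite expr0 mulr1.
have [||K [e [e0 K0 he]]] := IH (wz F).
- exact: hol_wz.
- by move=> k; rewrite -iterSr; exact: flat.
have [d d0 hd] := open_box oU Uz.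
exists (4 * K), (Num.min d e); split.
- by rewrite lt_min d0.
- by rewrite mulr_ge0.
move=> w; rewrite lt_min => /andP[wd we].
have F0 : F z = 0 := flat 0%N.
have bd u : nbox z u <= nbox z w -> forall b,
    [/\ pderivable F u, `|partial b (fun w => complex.Re (F w)) u| <= K * nbox z w ^+ n &
     `|partial b (fun w => complex.Im (F w)) u| <= K * nbox z w ^+ n].
  move=> uw b; have Uu : U u by apply/hd/boxE/(le_lt_trans uw).
  have := he u (le_lt_trans uw we).
  have {}uw : K * nbox z u ^+ n <= K * nbox z w ^+ n.
    by rewrite ler_wpM2l// lerXn2r// nnegrE nbox_ge0.
  move=> /le_trans /(_ uw) hn; have [hx hy] := hol_partial hF Uu.
  have : nrm1 (partialC b F u) <= K * nbox z w ^+ n.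
    by case: b; rewrite ?hx ?hy ?nrm1_i.
  rewrite {1}/nrm1 /= => h; split; first exact: hol_pderivable hF Uu.
    by rewrite (le_trans _ h)// lerDl.
  by rewrite (le_trans _ h)// lerDr.
rewrite split4 /nrm1 lerD//.
  have := @mvt_box_bound (fun w => complex.Re (F w)) z w (K * nbox z w ^+ n).
  rewrite F0 /= subr0; apply => u /bd + b => /(_ b)[h1 h2 _]; split; last exact: h2.
  exact: (h1 b).1.
have := @mvt_box_bound (fun w => complex.Im (F w)) z w (K * nbox z w ^+ n).
rewrite F0 /= subr0; apply => u /bd + b => /(_ b)[h1 _ h2]; split; last exact: h2.
exact: (h1 b).2.
Qed.

Lemma lapDM U f g (c : R) z : open U -> smooth_on U f -> smooth_on U g -> U z ->
  lap (fun w => f w + c * g w) z = lap f z + c * lap g z.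
Proof.
move=> oU sf sg Uz.
have P b (a h : plane -> R) w : smooth_on U a -> smooth_on U h -> U w ->
    partial b (fun w => a w + c * h w) w = partial b a w + c * partial b h w.
  move=> sa sh Uw; have da := derivableP ((sa [::] w Uw).2 b).
  have dh := derivableP ((sh [::] w Uw).2 b).
  exact: (@derive_val _ _ _ _ _ _ _ (is_deriveD da (is_deriveZ c dh))).
have PP b : partial b (partial b (fun w => f w + c * g w)) z =
    partial b (partial b f) z + c * partial b (partial b g) z.
  rewrite -(P b _ _ z (smooth_on_partial b sf) (smooth_on_partial b sg) Uz).
  by apply: partial_eq oU Uz _ => w /set_mem Uw; rewrite (P b _ _ w sf sg Uw).
by rewrite /lap !PP mulrDr addrACA.
Qed.

Lemma annulus_compact z (d r : R) :
  compact [set w | d <= nbox z w /\ nbox z w <= r].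
Proof.
have cK : compact (`[z.1 - r, z.1 + r] `*` `[z.2 - r, z.2 + r] : set plane).
  by apply: compact_setX; exact: segment_compact.
apply: (subclosed_compact _ cK).
  have cl (D : set R) : closed D -> closed (nbox z @^-1` D).
    by apply: closed_comp => w _; exact: nbox_continuous.
  exact: (closedI (cl _ (@closed_ge _ d)) (cl _ (@closed_le _ r))).
move=> w [_]; rewrite ge_max => /andP[h1 h2].
by split; rewrite /= in_itv /= -ler_distl.
Qed.

Lemma open_nbox_gt0 z : open [set w | 0 < nbox z w].
Proof.
have -> : [set w | 0 < nbox z w] = nbox z @^-1` [set x | 0 < x] by [].
by apply: open_comp => [w _|]; [exact: nbox_continuous|exact: open_gt].
Qed.

Lemma sqn_zeta_gt0 z w : 0 < nbox z w -> 0 < sqn (zeta z w).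
Proof.
by move=> w0; have /andP[+ _] := nbox_sqn z w; apply: lt_le_trans; rewrite exprn_gt0.
Qed.

(** The maximum over the compact annulus exists; at an interior point it would force a nonpositive
    Laplacian. *)
Lemma annulus_max U f z (d r M : R) : open U -> smooth_on U f ->
  (forall w, d <= nbox z w -> nbox z w <= r -> U w) ->
  (forall w, d < nbox z w -> nbox z w < r -> 0 < lap f w) ->
  (forall w, nbox z w = d \/ nbox z w = r -> f w <= M) ->
  forall w, d <= nbox z w -> nbox z w <= r -> f w <= M.
Proof.
move=> oU sf AU lf bf w dw wr.
pose A := [set w | d <= nbox z w /\ nbox z w <= r].
have [||u /set_mem[du ur] mu] := @compact_EVT_max _ R f A _ (@annulus_compact z d r).
- by exists w.
- apply: continuous_in_subspaceT => u /set_mem[du ur].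
  exact: (sf [::] u (AU u du ur)).1.
apply: (@le_trans _ _ (f u)); first by apply: mu; apply/mem_set.
have [ud|nd] := eqVneq (nbox z u) d; first by apply: bf; left.
have [ur0|nr] := eqVneq (nbox z u) r; first by apply: bf; right.
have du' : d < nbox z u by rewrite lt_neqAle eq_sym nd.
have ur' : nbox z u < r by rewrite lt_neqAle nr.
suff : lap f u <= 0 by rewrite leNgt lf.
apply: (lap_max oU sf (AU u du ur)).
have near_lt (P : set R) : open P -> P (nbox z u) -> \forall v \near u, P (nbox z v).
  by move=> oP Pu; apply: nbox_continuous; exact: open_nbhs_nbhs.
have h1 := near_lt _ (@open_gt R d) du'.
have h2 := near_lt _ (@open_lt R r) ur'.
apply: filterS2 h1 h2 => v /= dv vr; apply: mu.
by apply/mem_set; split; exact: ltW.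
Qed.

Lemma ler_pdiv_exp (x c s m : R) n : 0 <= c -> 0 < m -> m <= s ->
  x <= c * m ^+ n -> x / s ^+ n <= c.
Proof.
move=> c0 m0 ms xc; have s0 : 0 < s := lt_le_trans m0 ms.
rewrite ler_pdivrMr ?exprn_gt0// (le_trans xc)// ler_wpM2l// lerXn2r//.
  by rewrite nnegrE ltW.
by rewrite nnegrE ltW.
Qed.

Lemma small_radius (K a b c : R) : 0 < a -> 0 < b -> 0 < c ->
  exists d, [/\ 0 < d, d < a, d < b & K ^+ 2 * d ^+ 2 <= c].
Proof.
move=> a0 b0 c0; have K1 : 0 < K ^+ 2 + 1 by rewrite ltr_wpDl// sqr_ge0.
(* The summand 1 keeps the denominator positive, and d < 1 gives d^2 <= d. *)
pose m := Num.min (Num.min a b) (Num.min 1 (c / (K ^+ 2 + 1))).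
have m0 : 0 < m by rewrite !lt_min a0 b0 ltr01 divr_gt0.
have /andP[d0 dm] := half_itv m0; exists (m / 2).
move: dm; rewrite !lt_min => /andP[/andP[da db] /andP[d1 dc]]; split=> //.
move: dc; rewrite ltr_pdivlMr// => /ltW; apply: le_trans.
rewrite mulrDr mulr1 mulrC -[leLHS]addr0 lerD ?(ltW d0)//.
by rewrite ler_wpM2r ?sqr_ge0// expr2 ler_piMr// ltW.
Qed.

Lemma limit_geometric_half (x : R) : (forall n, x <= 2^-1 ^+ n) -> x <= 0.
Proof.
move=> h; have lim0 : (fun n => 2^-1 ^+ n : R) @ \oo --> 0.
  by apply: cvg_expr; rewrite ger0_norm// invf_lt1// ltr1n.
have : x <= lim ((fun n => 2^-1 ^+ n : R) @ \oo).
  by apply: limr_ge; [exact: cvgP lim0|exact: nearW].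
by rewrite (cvg_lim _ lim0).
Qed.

(* On a square annulus around z, the function |F / (w - z)^n|^2 + eps |w - z|^2
   is strictly subharmonic, hence bounded by its boundary values; flatness makes
   them small on the inner boundary, and then n tends to infinity. *)
Lemma hol_flat_eq0 U F z : open U -> U z -> hol U F ->
  (forall n, iter n (@wz R) F z = 0) ->
  exists2 e, 0 < e & forall w, nbox z w < e -> F w = 0.
Proof.
move=> oU Uz hF flat.
have Fz : F z = 0 := flat 0%N.
have sF : smooth_on U (fun w => sqn (F w)) := smooth_sqn oU hF.1.
have [d0 d00 hd0] : exists2 d, 0 < d &
    box z d `<=` U `&` [set w | sqn (F w) < 1].
  apply/nbhs_box/filterI; first exact: open_nbhs_nbhs.
  have /cvgr_lt := (sF [::] z Uz).1; apply.
  by rewrite /= Fz /sqn /= expr0n /= addr0.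
pose r := d0 / 2; have r0 : 0 < r by rewrite divr_gt0.
have rd u : nbox z u <= r -> U u /\ sqn (F u) < 1.
  move=> ur; apply/hd0/boxE/(le_lt_trans ur).
  by have /andP[] := half_itv d00.
(* On this square |w - z|^2 <= 2 (r/2)^2 = r^2 / 2. Against the outer boundary value r^(-2n) this
   produces the factor 2^(-n). *)
exists (r / 2) => [|w wr]; first by rewrite divr_gt0.
have wr' : nbox z w < r.
  by apply: lt_trans wr _; have /andP[] := half_itv r0.
have := nbox_ge0 z w; rewrite le_eqVlt => /predU1P[w0|w0].
  have -> // : w = z.
  have : nbox z w <= 0 by rewrite -w0.
  rewrite ge_max !normr_le0 !subr_eq0 => /andP[/eqP h1 /eqP h2].
  by move: h1 h2; case: (w) (z) => [? ?] [? ?] /= -> ->.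
apply/eqP; rewrite -sqn0 eq_le sqn_ge0 andbT; apply: limit_geometric_half => n.
have s0 := sqn_zeta_gt0 w0.
apply/ler_addgt0Pl => eta eta0; rewrite addrC.
set s := sqn (zeta z w) in s0.
have sn0 : 0 < s ^+ n by rewrite exprn_gt0.
(* The final estimate is multiplied by [s ^+ n], which turns [eta'] back into [eta]. *)
pose eta' := eta / s ^+ n; have eta'0 : 0 < eta' by rewrite divr_gt0.
(* One power more than the denominator: on the inner boundary the quotient is then at most K^2 d^2,
   which is small with d. *)
have [K [e1 [e10 K0 he1]]] := flat_bound n.+1 oU Uz hF flat.
have [d [dgt0 dw de1 dK]] : exists d, [/\ 0 < d, d < nbox z w, d < e1 &
    K ^+ 2 * d ^+ 2 <= eta' / 2].
  by apply: small_radius; rewrite // divr_gt0.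
(* Since |w - z|^2 <= 2 r^2 on the annulus, the strictly subharmonic term contributes at most
   [eta' / 2]. *)
pose eps := eta' / 2 / (2 * r ^+ 2).
have eps0 : 0 < eps by rewrite !divr_gt0// mulr_gt0// exprn_gt0.
pose G u := F u * (zeta z u)^-1 ^+ n.
pose V := U `&` [set u | 0 < nbox z u].
have oV : open V by apply: openI => //; exact: open_nbox_gt0.
have [hz dz1] := zeta_hol V z.
have z0 u : V u -> zeta z u != 0 by move=> [_ /sqn_zeta_gt0/lt0r_neq0]; rewrite sqn0.
have hG : hol V G.
  apply: (holM oV); first by apply: holS hF => u [].
  have := @hol_prod R V _ (index_enum 'I_n) xpredT (fun _ u => (zeta z u)^-1) oV
     (fun _ _ => holV oV z0 hz).
  by apply: hol_eq oV _ => u _; rewrite prodr_const card_ord.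
have GE u : sqn (G u) = sqn (F u) / sqn (zeta z u) ^+ n.
  by rewrite /G sqnM sqnX sqnV exprVn.
pose v u := sqn (G u) + eps * sqn (zeta z u).
have sv : smooth_on V v.
  exact: smooth_onD oV (smooth_sqn oV hG.1)
    (smooth_onM oV (@smooth_on_cst _ V eps) (smooth_sqn oV hz.1)).
have AV u : d <= nbox z u -> nbox z u <= r -> V u.
  by move=> du /rd[Uu _]; split=> //; exact: lt_le_trans du.
have epsE : eps * (2 * r ^+ 2) = eta' / 2.
  by rewrite /eps divfK// gt_eqF// mulr_gt0// exprn_gt0.
have r2 : 0 < r ^+ 2 by rewrite exprn_gt0.
have epsz u : nbox z u <= r -> eps * sqn (zeta z u) <= eta' / 2.
  move=> ur; rewrite -epsE ler_pM2l//; have /andP[_ /le_trans] := nbox_sqn z u.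
  by apply; rewrite ler_pM2l// lerXn2r// nnegrE ?nbox_ge0// ltW.
have bound : v w <= r^-1 ^+ 2 ^+ n + eta'.
  have rn0 : 0 <= r^-1 ^+ 2 ^+ n by rewrite exprn_ge0// sqr_ge0.
  apply: (@annulus_max V v z d r _ oV sv AV _ _ w (ltW dw) (ltW wr')).
    move=> u du ur; have Vu := AV u (ltW du) (ltW ur).
    rewrite /v (lapDM eps oV (smooth_sqn oV hG.1) (smooth_sqn oV hz.1) Vu).
    rewrite (lap_sqn oV hG Vu) (lap_sqn oV hz Vu) dz1.
    have -> : sqn 1 = 1 by rewrite /sqn /= expr1n expr0n addr0.
    by rewrite ltr_wpDl// ?mulrn_wge0 ?sqn_ge0// mulr_gt0// ltr0n.
  move=> u uE; rewrite /v GE [eta'](@splitr R) addrA.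
  have ur : nbox z u <= r by case: uE => -> //; rewrite ltW// (lt_trans dw).
  have /andP[zu _] := nbox_sqn z u.
  rewrite lerD ?epsz//; case: uE => uE; rewrite uE in zu.
    rewrite -[leLHS]add0r lerD//; apply: le_trans dK.
    apply: (ler_pdiv_exp _ _ zu); rewrite ?exprn_gt0// ?mulr_ge0 ?sqr_ge0 ?(ltW dgt0)//.
    have := he1 u; rewrite uE => /(_ de1) hu.
    apply: (le_trans (sqn_le_nrm1 _)); rewrite -mulrA -exprS -exprM mulnC exprM -exprMn.
    by rewrite lerXn2r// nnegrE ?addr_ge0// mulr_ge0// exprn_ge0// ltW.
  rewrite -[leLHS]addr0 lerD//; last exact: (divr_ge0 (ltW eta'0) (ler0n R 2)).
  apply: (ler_pdiv_exp _ _ zu); rewrite // -exprMn -exprMn mulVf ?gt_eqF// !expr1n.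
  by rewrite ltW// (rd u _).2// uE.
have : sqn (F w) / s ^+ n <= r^-1 ^+ 2 ^+ n + eta'.
  by apply: le_trans bound; rewrite /v GE lerDl mulr_ge0 ?sqn_ge0// ltW.
rewrite ler_pdivrMr// mulrDl divfK ?gt_eqF// => /le_trans; apply.
rewrite lerD2r -exprMn lerXn2r ?nnegrE ?mulr_ge0 ?sqr_ge0 ?invr_ge0 ?(ltW s0) ?(ltW r0)//.
rewrite exprVn ler_pdivrMl// mulrC.
have /andP[_ /le_trans] := nbox_sqn z w; apply.
have : nbox z w ^+ 2 <= (r / 2) ^+ 2.
  by rewrite lerXn2r ?nnegrE ?nbox_ge0 ?divr_ge0 ?ltW.
rewrite -(ler_pM2l (ltr0n R 2)) => /le_trans; apply.
have -> : 2%N%:R * (r / 2) ^+ 2 = 2^-1 * r ^+ 2 by rewrite exprMn; field.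
exact: lexx.
Qed.
End Flatness.

(** * Formal power series *)

Section PowerSeries.
Variable K : numFieldType.

Record fps := Fps { fcoef : nat -> K }.

HB.instance Definition _ := gen_eqMixin fps.
HB.instance Definition _ := gen_choiceMixin fps.

Implicit Types f g h : fps.

Lemma fpsP f g : fcoef f =1 fcoef g <-> f = g.
Proof. by split=> [|-> //]; case: f g => f [g] /= /funext ->. Qed.

Definition addf f g := Fps (fun n => fcoef f n + fcoef g n).
Definition oppf f := Fps (fun n => - fcoef f n).
Definition zerof := Fps (fun=> 0).

Lemma addfA : associative addf.
Proof. by move=> f g h; apply/fpsP => n; exact: addrA. Qed.
Lemma addfC : commutative addf.
Proof. by move=> f g; apply/fpsP => n; exact: addrC. Qed.
Lemma add0f : left_id zerof addf.
Proof. by move=> f; apply/fpsP => n; exact: add0r. Qed.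
Lemma addNf : left_inverse zerof oppf addf.
Proof. by move=> f; apply/fpsP => n; exact: addNr. Qed.

HB.instance Definition _ := GRing.isZmodule.Build fps addfA addfC add0f addNf.

Definition mulf f g :=
  Fps (fun n => \sum_(i < n.+1) fcoef f i * fcoef g (n - i)).
Definition onef := Fps (fun n => (n == 0%N)%:R).

(** A coefficient of a product depends only on truncations, so the ring laws and the Leibniz rule
    are inherited from polynomials. *)
Definition trunc n f : {poly K} := \poly_(i < n.+1) fcoef f i.

Lemma coef_trunc n f k : (k <= n)%N -> (trunc n f)`_k = fcoef f k.
Proof. by move=> kn; rewrite coef_poly ltnS kn. Qed.

Lemma coef_mulf n f g k : (k <= n)%N ->
  fcoef (mulf f g) k = (trunc n f * trunc n g)`_k.
Proof.
move=> kn; rewrite coefM; apply: eq_bigr => i _.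
have ik : (i <= k)%N by rewrite -ltnS.
by rewrite !coef_trunc// ?(leq_trans ik)// (leq_trans (leq_subr _ _)).
Qed.

Lemma mulfC_fps : commutative mulf.
Proof. by move=> f g; apply/fpsP => n; rewrite !(@coef_mulf n)// mulrC. Qed.

Lemma mulfA_fps : associative mulf.
Proof.
move=> f g h; apply/fpsP => n.
transitivity ((trunc n f * (trunc n g * trunc n h))`_n).
  rewrite coefM; apply: eq_bigr => i _.
  have ik : (i <= n)%N by rewrite -ltnS.
  by rewrite coef_trunc// (@coef_mulf n)// leq_subr.
rewrite mulrA coefM; apply: eq_bigr => i _.
have ik : (i <= n)%N by rewrite -ltnS.
by rewrite (@coef_mulf n)// coef_trunc ?leq_subr.
Qed.

Lemma mul1f : left_id onef mulf.
Proof.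
move=> f; apply/fpsP => n /=; rewrite big_ord_recl /= mul1r subn0 big1 ?addr0//.
by move=> i _; rewrite mul0r.
Qed.

Lemma mulfDl_fps : left_distributive mulf addf.
Proof.
move=> f g h; apply/fpsP => n /=; rewrite -big_split /=.
by apply: eq_bigr => i _; rewrite mulrDl.
Qed.

Lemma onef_neq0 : onef != 0.
Proof.
apply/eqP => /fpsP/(_ 0%N) /= /eqP; by rewrite oner_eq0.
Qed.

HB.instance Definition _ := GRing.Zmodule_isComNzRing.Build fps
  mulfA_fps mulfC_fps mul1f mulfDl_fps onef_neq0.

Definition unitf : pred fps := fun f => `[<exists g, g * f = 1>].
(** The default [f] is the value that the ring structure demands on non-units. *)
Definition invf f : fps := xget f [set g | g * f = 1].

Lemma mulVf_fps : {in unitf, left_inverse 1 invf *%R}.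
Proof.
move=> f /asboolP[g gf]; rewrite /invf; case: xgetP => [h _ //|/(_ g)] //.
Qed.

Lemma unitfPl f g : g * f = 1 -> unitf f.
Proof. by move=> gf; apply/asboolP; exists g. Qed.

Lemma invf_out : {in [predC unitf], invf =1 id}.
Proof.
move=> f; rewrite inE /= => nf; rewrite /invf; case: xgetP => // h _ hf.
by case/negP: nf; exact: unitfPl hf.
Qed.

HB.instance Definition _ := GRing.ComNzRing_hasMulInverse.Build fps
  mulVf_fps unitfPl invf_out.

Lemma fcoefD f g n : fcoef (f + g) n = fcoef f n + fcoef g n.
Proof. by []. Qed.
Lemma fcoefM f g n : fcoef (f * g) n = \sum_(i < n.+1) fcoef f i * fcoef g (n - i).
Proof. by []. Qed.

(** The valuation as a relation, so that the zero series has no order. *)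
Definition has_ord m f := (forall k, (k < m)%N -> fcoef f k = 0) /\ fcoef f m != 0.

Lemma has_ordM m n f g : has_ord m f -> has_ord n g -> has_ord (m + n) (f * g).
Proof.
move=> [f0 fm] [g0 gn]; split=> [k kmn|].
  rewrite fcoefM big1// => i _; have [im|mi] := ltnP i m; first by rewrite f0 ?mul0r.
  have ik : (i <= k)%N by rewrite -ltnS.
  by rewrite g0 ?mulr0// ltn_subLR// (leq_trans kmn)// leq_add2r.
rewrite fcoefM (bigD1 (inord m)) //= big1 ?addr0.
  by rewrite inordK ?ltnS ?leq_addr// addKn mulf_neq0.
move=> i; rewrite -val_eqE /= inordK ?ltnS ?leq_addr// => im.
have [lim|mi] := ltnP i m; first by rewrite f0 ?mul0r.
have {im}mi : (m < i)%N by rewrite ltn_neqAle eq_sym im.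
have ik : (i <= m + n)%N by rewrite -ltnS.
by rewrite g0 ?mulr0// ltn_subLR// ltn_add2r.
Qed.

Lemma has_ord_ex f : f != 0 -> exists m, has_ord m f.
Proof.
move=> f0; have [n fn] : exists n, fcoef f n != 0.
  apply: contrapT => h; case/eqP: f0; apply/fpsP => n.
  by apply/eqP; apply: contrapT => /negP fn; apply: h; exists n.
have := ex_intro (fun n => fcoef f n != 0) n fn.
move=> /ex_minnP[m fm mmin]; exists m; split=> // k km.
by apply/eqP; apply: contraLR km => /mmin; rewrite -leqNgt.
Qed.

Lemma has_ord_neq0 m f : has_ord m f -> f != 0.
Proof. by move=> [_]; apply: contra => /eqP ->. Qed.

Lemma fps_integral f g : f * g = 0 -> (f == 0) || (g == 0).
Proof.
move=> fg; apply/orP; apply: contrapT => /not_orP[/negP f0 /negP g0].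
have [m fm] := has_ord_ex f0; have [n gn] := has_ord_ex g0.
by have := has_ord_neq0 (has_ordM fm gn); rewrite fg eqxx.
Qed.

HB.instance Definition _ := GRing.ComUnitRing_isIntegral.Build fps fps_integral.

(** Solves f * g = 1 for the coefficients of g. Each depends on all the earlier ones, hence the
    recursion carries the whole list. *)
Fixpoint inv_coefs f n : seq K :=
  if n is n'.+1 then
    let s := inv_coefs f n' in
    rcons s (- (fcoef f 0)^-1 * \sum_(i < n) fcoef f i.+1 * s`_(n' - i))
  else [:: (fcoef f 0)^-1].

Lemma size_inv_coefs f n : size (inv_coefs f n) = n.+1.
Proof. by elim: n => [//|n IH] /=; rewrite size_rcons IH. Qed.

Lemma nth_inv_coefs f n k : (k <= n)%N -> (inv_coefs f n)`_k = (inv_coefs f k)`_k.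
Proof.
elim: n => [|n IH]; first by rewrite leqn0 => /eqP ->.
rewrite leq_eqVlt => /predU1P[-> //|]; rewrite ltnS => kn /=.
by rewrite nth_rcons size_inv_coefs ltnS kn IH.
Qed.

Lemma unit_fcoef0 f : (f \is a GRing.unit) = (fcoef f 0 != 0).
Proof.
apply/idP/idP => [uf|f0].
  have := mulrV uf => /fpsP/(_ 0%N); rewrite fcoefM big_ord1 /= => h.
  by apply/eqP => f0; move/eqP: h; rewrite f0 mul0r eq_sym oner_eq0.
apply/unitrP; suff [g fg] : exists g, f * g = 1 by exists g; rewrite mulrC.
exists (Fps (fun n => (inv_coefs f n)`_n)); apply/fpsP => -[|n].
  by rewrite fcoefM big_ord1 /= mulfV.
rewrite fcoefM big_ord_recl /= nth_rcons size_inv_coefs ltnn eqxx.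
rewrite mulrA mulrN mulfV// mulN1r; apply/eqP.
rewrite addrC subr_eq0; apply/eqP; apply: eq_bigr => i _.
by rewrite /bump /= add1n subSS (nth_inv_coefs f (leq_subr i n)).
Qed.

Lemma has_ord0 f : has_ord 0 f <-> f \is a GRing.unit.
Proof. by rewrite unit_fcoef0; split=> [[]|]. Qed.

Definition shiftf m f := Fps (fun n => fcoef f (n + m)).
(** The monomial z^m; a series of order m is [monf m] times a unit. *)
Definition monf m : fps := Fps (fun n => (n == m)%:R).

Lemma monf_shiftf m f : (forall k, (k < m)%N -> fcoef f k = 0) ->
  f = monf m * shiftf m f.
Proof.
move=> f0; apply/fpsP => n; rewrite fcoefM /=.
have [nm|mn] := ltnP n m.
  rewrite f0// big1// => i _; rewrite [_ == _]ltn_eqF ?mul0r//.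
  by rewrite (leq_trans _ nm).
have mn' : (m < n.+1)%N by rewrite ltnS.
rewrite (bigD1 (Ordinal mn')) //= eqxx mul1r subnK// big1 ?addr0// => i.
by rewrite -val_eqE /= => /negbTE ->; rewrite mul0r.
Qed.

Lemma has_ord_unit m f : has_ord m f ->
  exists2 u, u \is a GRing.unit & f = monf m * u.
Proof.
move=> [f0 fm]; exists (shiftf m f); last exact: monf_shiftf.
by rewrite unit_fcoef0 /= add0n.
Qed.

Lemma has_ord_Munit m u f : u \is a GRing.unit -> has_ord m f -> has_ord m (u * f).
Proof. by move=> /has_ord0 hu; exact: has_ordM hu. Qed.

Lemma has_ord_dvd m n f g : has_ord m f -> has_ord n g -> (m <= n)%N ->
  exists q, g = q * f.
Proof.
move=> /has_ord_unit[u uu ->] [g0 _] mn.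
exists (shiftf m g * u^-1).
rewrite [monf m * u]mulrC mulrA divrK// mulrC; apply: monf_shiftf => k km.
by apply: g0; exact: leq_trans km mn.
Qed.

Definition derivf f := Fps (fun n => fcoef f n.+1 *+ n.+1).

Lemma derivfD f g : derivf (f + g) = derivf f + derivf g.
Proof. by apply/fpsP => n /=; rewrite -mulrnDl. Qed.

Lemma derivf0 : derivf 0 = 0.
Proof. by apply/fpsP => n /=; rewrite mul0rn. Qed.

Lemma derivfN f : derivf (- f) = - derivf f.
Proof. by apply/fpsP => n /=; rewrite mulNrn. Qed.

Lemma derivfM f g : derivf (f * g) = derivf f * g + f * derivf g.
Proof.
have trd h n k : (k <= n)%N -> (trunc n.+1 h)^`()`_k = fcoef (derivf h) k.
  by move=> kn; rewrite coef_deriv coef_trunc.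
apply/fpsP => n.
transitivity ((trunc n.+1 f * trunc n.+1 g)^`()`_n).
  by rewrite coef_deriv -coef_mulf.
rewrite derivM coefD fcoefD !coefM !fcoefM.
congr (_ + _); apply: eq_bigr => i _; have ik : (i <= n)%N by rewrite -ltnS.
  by rewrite trd// coef_trunc// (leq_trans (leq_subr _ _)).
by rewrite trd ?leq_subr// coef_trunc// (leq_trans ik).
Qed.
End PowerSeries.

(** * Column reduction over the discrete valuation ring of power series *)

Section TriangularDecomposition.
Variable K : numFieldType.
Local Notation O := (fps K).

(** An entry of least order divides all the others; it is the pivot of the column reduction. *)
Lemma fps_principal (I : finType) (x : I -> O) : (exists i, x i != 0) ->
  exists2 i0, x i0 != 0 & forall i, exists q, x i = q * x i0.
Proof.
move=> [i xi]; have [m hm] := has_ord_ex xi.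
have := ex_intro (fun m => `[<exists i, has_ord m (x i)>]) m
  (asboolT (ex_intro _ i hm)).
move=> /ex_minnP[{i xi hm} m0 /asboolP[i0 h0] mmin]; exists i0.
  exact: has_ord_neq0 h0.
move=> i; have [->|xi] := eqVneq (x i) 0; first by exists 0; rewrite mul0r.
have [n hn] := has_ord_ex xi; apply: (has_ord_dvd h0 hn).
by apply: mmin; apply/asboolP; exists i.
Qed.

(** Column reduction: an entry of least order in the top row is moved to the first column, [P], and
    used to clear the rest of the row, [Q]; the lower right block is treated by induction. The
    nonzero determinant guarantees a pivot at each stage. *)
Lemma triangular_decomposition n (W : 'M[O]_n) : \det W != 0 ->
  exists T V : 'M[O]_n, [/\ W = T *m V, is_trig_mx T & V \in unitmx].
Proof.
elim: n W => [|n IH] W dW.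
  by exists W, 1%:M; rewrite mulmx1 unitmx1; split=> //; apply/is_trig_mxP => -[].
have [j0 t0 tq] : exists2 j0, W ord0 j0 != 0 &
    forall j, exists q, W ord0 j = q * W ord0 j0.
  apply: (@fps_principal _ (W ord0)); apply: contrapT => h; case/eqP: dW.
  rewrite (expand_det_row W ord0) big1// => j _.
  have [->|wj] := eqVneq (W ord0 j) 0; first by rewrite mul0r.
  by case: h; exists j.
pose P : 'M[O]_(1 + n) := tperm_mx ord0 j0.
have uP : P \in unitmx by exact: unitmx_perm.
pose W1 : 'M[O]_(1 + n) := xcol ord0 j0 W.
have W1E : W1 = W *m P by exact: xcolE.
have W1q (j : 'I_n) : exists q, W1 ord0 (rshift 1 j) = q * W1 ord0 ord0.
  by rewrite !mxE tpermL; exact: tq.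
have [q qE] := choice W1q.
pose Q : 'M[O]_(1 + n) := block_mx 1%:M (- \row_j q j) 0 1%:M.
have uQ : Q \in unitmx by rewrite unitmxE det_ublock !det1 mulr1 unitr1.
pose A : 'M[O]_(1 + n) := W1 *m Q.
have uPQ : P *m Q \in unitmx by rewrite unitmx_mul uP.
have AE : A = W *m (P *m Q) by rewrite /A W1E mulmxA.
have A0 : ursubmx A = 0.
  apply/matrixP => i j; rewrite !mxE (ord1 i).
  rewrite big_split_ord /= big_ord1 (bigD1 j) //= big1 => [|k kj].
    rewrite !block_mxEur !block_mxEdr !mxE eqxx mulr1 addr0.
    have -> : lshift n (0 : 'I_1) = ord0 by apply: val_inj.
    by have := qE j; rewrite !mxE => ->; rewrite mulrN mulrC addNr.
  have -> : Q (rshift 1 k) (rshift 1 j) = (1%:M : 'M[O]_n) k j.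
    exact: block_mxEdr.
  by rewrite [X in _ * X]mxE (negbTE kj) mulr0.
have dA : \det A != 0.
  by rewrite AE det_mulmx mulf_neq0//; move: uPQ; rewrite unitmxE; apply: contraTneq => ->; rewrite unitr0.
have AB : A = block_mx (ulsubmx A) 0 (dlsubmx A) (drsubmx A).
  by rewrite -A0 submxK.
have [|T' [V' [dE trT uV]]] := IH (drsubmx A).
  apply: contraNneq dA => d0.
  by rewrite AB det_lblock d0 mulr0.
pose T : 'M[O]_(1 + n) := block_mx (ulsubmx A) 0 (dlsubmx A) T'.
pose V0 : 'M[O]_(1 + n) := block_mx 1%:M 0 0 V'.
have TV : T *m V0 = A.
  rewrite /T /V0 mulmx_block !mulmx1 !mulmx0 !mul0mx !addr0 !add0r -dE.
  exact: esym.
exists T, (V0 *m invmx (P *m Q)); split.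
- by rewrite (mulmxA T) TV AE -mulmxA mulmxV// mulmx1.
- have : @is_trig_mx O (1 + n) (1 + n) T.
    by rewrite is_trig_block_mx// eqxx mx11_is_trig.
  by [].
- have uV0 : V0 \in unitmx by rewrite unitmxE /V0 det_ublock det1 mul1r -unitmxE.
  by rewrite unitmx_mul unitmx_inv uPQ uV0.
Qed.
End TriangularDecomposition.

(** * The cross product *)

Section CrossProduct.
Variable A : comNzRingType.
Implicit Types u v w x y : 'rV[A]_7.

Definition dotp n (u v : 'rV[A]_n) : A := \sum_a u 0 a * v 0 a.

(** The constants of [cross_coef] over any commutative ring: the product is needed over the complex
    numbers and over power series. *)
Definition xcoef (a b c : 'I_7) : A :=
  (is_cross_triple a.+1 b.+1 c.+1)%:R - (is_cross_triple b.+1 a.+1 c.+1)%:R.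

Definition xprod u v : 'rV[A]_7 :=
  \row_c \sum_a \sum_b xcoef a b c * u 0 a * v 0 b.

(** Explicit coordinates turn the identities of the cross product into polynomial identities decided
    by [ring]. *)
Definition vec7 (a1 a2 a3 a4 a5 a6 a7 : A) : 'rV[A]_7 :=
  \row_i [:: a1; a2; a3; a4; a5; a6; a7]`_i.

Lemma vec7_ex u : exists a1 a2 a3 a4 a5 a6 a7, u = vec7 a1 a2 a3 a4 a5 a6 a7.
Proof.
exists (u 0 (inord 0)), (u 0 (inord 1)), (u 0 (inord 2)), (u 0 (inord 3)),
  (u 0 (inord 4)), (u 0 (inord 5)), (u 0 (inord 6)).
apply/rowP => -[i i7]; rewrite mxE /=.
by do 7 (case: i i7 => [|i] i7 /=; first by congr (u 0 _); apply: val_inj; rewrite /= inordK).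
Qed.

Lemma dotp_vec7 a1 a2 a3 a4 a5 a6 a7 b1 b2 b3 b4 b5 b6 b7 :
  dotp (vec7 a1 a2 a3 a4 a5 a6 a7) (vec7 b1 b2 b3 b4 b5 b6 b7) =
  a1 * b1 + a2 * b2 + a3 * b3 + a4 * b4 + a5 * b5 + a6 * b6 + a7 * b7.
Proof. by rewrite /dotp !big_ord_recl big_ord0 !mxE /= addr0 !addrA. Qed.

Lemma xprod_vec7 a1 a2 a3 a4 a5 a6 a7 b1 b2 b3 b4 b5 b6 b7 :
  xprod (vec7 a1 a2 a3 a4 a5 a6 a7) (vec7 b1 b2 b3 b4 b5 b6 b7) =
  vec7 (a2 * b3 - a3 * b2 + (a4 * b5 - a5 * b4) + (a7 * b6 - a6 * b7))
       (a3 * b1 - a1 * b3 + (a4 * b6 - a6 * b4) + (a5 * b7 - a7 * b5))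
       (a1 * b2 - a2 * b1 + (a4 * b7 - a7 * b4) + (a6 * b5 - a5 * b6))
       (a5 * b1 - a1 * b5 + (a6 * b2 - a2 * b6) + (a7 * b3 - a3 * b7))
       (a1 * b4 - a4 * b1 + (a7 * b2 - a2 * b7) + (a3 * b6 - a6 * b3))
       (a2 * b4 - a4 * b2 + (a1 * b7 - a7 * b1) + (a5 * b3 - a3 * b5))
       (a3 * b4 - a4 * b3 + (a6 * b1 - a1 * b6) + (a2 * b5 - a5 * b2)).
Proof.
apply/rowP => -[i i7]; rewrite !mxE.
do 7 (case: i i7 => [|i] i7; [rewrite !big_ord_recl !big_ord0 /xcoef;
 repeat match goal with |- context [is_cross_triple ?a ?b ?c] =>
   let v := eval vm_compute in (is_cross_triple a b c) in
   change (is_cross_triple a b c) with v end;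
 rewrite !mxE /= ?(subr0, sub0r, subrr, mul0r, mul1r, mulN1r, mulNr, addr0, add0r);
 ring|]).
by [].
Qed.

Lemma dotpC n (u v : 'rV[A]_n) : dotp u v = dotp v u.
Proof. by apply: eq_bigr => a _; rewrite mulrC. Qed.

Lemma dotpDl n (u v w : 'rV[A]_n) : dotp (u + v) w = dotp u w + dotp v w.
Proof. by rewrite -big_split; apply: eq_bigr => a _; rewrite mxE mulrDl. Qed.

Lemma dotpZl n c (u w : 'rV[A]_n) : dotp (c *: u) w = c * dotp u w.
Proof. by rewrite mulr_sumr; apply: eq_bigr => a _; rewrite mxE mulrA. Qed.

Lemma dotpDr n (u v w : 'rV[A]_n) : dotp u (v + w) = dotp u v + dotp u w.
Proof. by rewrite dotpC dotpDl ![dotp _ u]dotpC. Qed.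

Lemma dotpZr n c (u w : 'rV[A]_n) : dotp u (c *: w) = c * dotp u w.
Proof. by rewrite dotpC dotpZl dotpC. Qed.

Lemma dotp0l n (u : 'rV[A]_n) : dotp 0 u = 0.
Proof. by have := dotpZl 0 0 u; rewrite scale0r mul0r. Qed.

Lemma dotp_suml n (I : Type) (r : seq I) (P : pred I) (F : I -> 'rV[A]_n)
  (u : 'rV[A]_n) :
  dotp (\sum_(i <- r | P i) F i) u = \sum_(i <- r | P i) dotp (F i) u.
Proof.
by elim/big_rec2: _ => [|i x y _ <-]; rewrite ?dotp0l ?dotpDl.
Qed.

Lemma xprodC u v : xprod u v = - xprod v u.
Proof.
have [a1 [a2 [a3 [a4 [a5 [a6 [a7 ->]]]]]]] := vec7_ex u.
have [b1 [b2 [b3 [b4 [b5 [b6 [b7 ->]]]]]]] := vec7_ex v.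
rewrite !xprod_vec7; apply/rowP => -[i i7]; rewrite !mxE /=.
by do 7 (case: i i7 => [|i] i7; [rewrite /=; ring|]).
Qed.

Lemma xprodDl u v w : xprod (u + v) w = xprod u w + xprod v w.
Proof.
apply/rowP => c; rewrite !mxE -big_split; apply: eq_bigr => a _ /=.
by rewrite -big_split; apply: eq_bigr => b _ /=; rewrite !mxE mulrDr mulrDl.
Qed.

Lemma xprodZl k u v : xprod (k *: u) v = k *: xprod u v.
Proof.
apply/rowP => c; rewrite !mxE mulr_sumr; apply: eq_bigr => a _.
by rewrite mulr_sumr; apply: eq_bigr => b _; rewrite mxE; ring.
Qed.

Lemma xprodDr u v w : xprod u (v + w) = xprod u v + xprod u w.
Proof. by rewrite xprodC xprodDl opprD -!xprodC. Qed.

Lemma xprodZr k u v : xprod u (k *: v) = k *: xprod u v.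
Proof. by rewrite xprodC xprodZl -scalerN -xprodC. Qed.

Lemma xprod0l u : xprod 0 u = 0.
Proof. by have := xprodZl 0 0 u; rewrite !scale0r. Qed.

Lemma xprod0r u : xprod u 0 = 0.
Proof. by rewrite xprodC xprod0l oppr0. Qed.

Lemma xprod_suml (I : Type) (r : seq I) (P : pred I) (F : I -> 'rV[A]_7) u :
  xprod (\sum_(i <- r | P i) F i) u = \sum_(i <- r | P i) xprod (F i) u.
Proof.
by elim/big_rec2: _ => [|i x y _ <-]; rewrite ?xprod0l ?xprodDl.
Qed.

(** Verified in coordinates, because skew-symmetry over a general ring only gives that twice the
    product is zero. *)
Lemma xprodvv u : xprod u u = 0.
Proof.
have [a1 [a2 [a3 [a4 [a5 [a6 [a7 ->]]]]]]] := vec7_ex u.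
rewrite !xprod_vec7; apply/rowP => -[i i7]; rewrite !mxE /=.
by do 7 (case: i i7 => [|i] i7; [rewrite /=; ring|]).
Qed.

Lemma xprod_cycle u v w : dotp (xprod u v) w = dotp (xprod v w) u.
Proof.
have [a1 [a2 [a3 [a4 [a5 [a6 [a7 ->]]]]]]] := vec7_ex u.
have [b1 [b2 [b3 [b4 [b5 [b6 [b7 ->]]]]]]] := vec7_ex v.
have [c1 [c2 [c3 [c4 [c5 [c6 [c7 ->]]]]]]] := vec7_ex w.
by rewrite !xprod_vec7 !dotp_vec7; ring.
Qed.

Lemma xprod_xprod u v :
  xprod u (xprod u v) = dotp u v *: u - dotp u u *: v.
Proof.
have [a1 [a2 [a3 [a4 [a5 [a6 [a7 ->]]]]]]] := vec7_ex u.
have [b1 [b2 [b3 [b4 [b5 [b6 [b7 ->]]]]]]] := vec7_ex v.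
rewrite !xprod_vec7 !dotp_vec7; apply/rowP => -[i i7]; rewrite !mxE /=.
by do 7 (case: i i7 => [|i] i7; [rewrite /=; ring|]).
Qed.

(** Polarisation of [xprod_xprod] in its repeated argument. *)
Lemma xprod_polar u v w :
  xprod u (xprod v w) + xprod v (xprod u w) =
  dotp u w *: v + dotp v w *: u - (dotp u v *+ 2) *: w.
Proof.
have := xprod_xprod (u + v) w.
rewrite !(xprodDl, xprodDr) !xprod_xprod !dotpDl !dotpDr [dotp v u]dotpC.
move=> e.
have {}e : xprod u (xprod v w) + xprod v (xprod u w) =
    (dotp u w + dotp v w) *: (u + v) -
    (dotp u u + dotp u v + (dotp u v + dotp v v)) *: w -
    (dotp u w *: u - dotp u u *: w) - (dotp v w *: v - dotp v v *: w).
  by rewrite -e; apply/rowP => i; rewrite !mxE; ring.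
by rewrite e; apply/rowP => i; rewrite !mxE; ring.
Qed.

(** [xprod_polar] paired with a vector; multiplication by a fixed vector is skew-adjoint, which
    moves the outer factor across the pairing. *)
Lemma xprod_dotp u v w x :
  dotp (xprod v w) (xprod u x) + dotp (xprod u w) (xprod v x) =
  dotp u v * dotp w x *+ 2 - dotp u w * dotp v x - dotp v w * dotp u x.
Proof.
have sw a b : dotp a (xprod b x) = - dotp (xprod b a) x.
  rewrite [LHS]dotpC (xprod_cycle b x a) (xprod_cycle x a b) [xprod a b]xprodC.
  by rewrite -scaleN1r dotpZl mulN1r.
rewrite !sw -opprD -dotpDl xprod_polar.
by rewrite -scaleNr !(dotpDl, dotpZl); ring.
Qed.

End CrossProduct.

(** * Frenet frames over power series *)

Section FrenetFrame.
Variable K : numFieldType.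
Local Notation O := (fps K).

Definition derivfm m n (M : 'M[O]_(m, n)) : 'M[O]_(m, n) := map_mx (@derivf K) M.

Lemma derivf_sum (I : Type) (r : seq I) (P : pred I) (F : I -> O) :
  derivf (\sum_(i <- r | P i) F i) = \sum_(i <- r | P i) derivf (F i).
Proof. by elim/big_rec2: _ => [|i x y _ <-]; rewrite ?derivf0 ?derivfD. Qed.

Lemma derivfm_mul m n p (M : 'M[O]_(m, n)) (N : 'M[O]_(n, p)) :
  derivfm (M *m N) = derivfm M *m N + M *m derivfm N.
Proof.
apply/matrixP => i j; rewrite !mxE derivf_sum -big_split /=.
by apply: eq_bigr => k _; rewrite derivfM !mxE.
Qed.

Lemma derivfm_row m n i (M : 'M[O]_(m, n)) :
  derivfm (row i M) = row i (derivfm M).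
Proof. by apply/rowP => j; rewrite !mxE. Qed.

Lemma sum_ord_split n (F : 'I_n -> O) (i : 'I_n) :
  (forall k : 'I_n, (i < k)%N -> F k = 0) ->
  (forall k : 'I_n, (k < i)%N -> F k = 0) -> \sum_k F k = F i.
Proof.
move=> h1 h2; rewrite (bigD1 i) //= big1 ?addr0// => k; rewrite neq_ltn.
by case/orP; [exact: h2|exact: h1].
Qed.

(** With V' = A V, differentiating W = T V and cancelling [V] shows that row i + 1 of [T] is row i
    of T' + T A. As [T] is lower triangular with nonzero diagonal, induction on i kills the entries
    of [A] beyond the first superdiagonal, and the entry on it is the quotient of consecutive
    diagonal entries of [T]. *)
Lemma frenet_matrix n (W T V : 'M[O]_n) : W = T *m V -> is_trig_mx T ->
  V \in unitmx -> \det W != 0 ->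
  (forall i j : 'I_n, j = i.+1 :> nat -> row j W = derivfm (row i W)) ->
  exists A : 'M[O]_n, [/\ derivfm V = A *m V, forall i, T i i != 0,
    forall i j : 'I_n, (i.+1 < j)%N -> A i j = 0 &
    forall i j : 'I_n, j = i.+1 :> nat -> T i i * A i j = T j j].
Proof.
move=> WTV /is_trig_mxP trT uV dW dW1.
have T0 i : T i i != 0.
  have trT' : is_trig_mx T by apply/is_trig_mxP.
  move: dW; rewrite WTV det_mulmx det_trig// mulf_eq0 => /norP[+ _].
  by apply: contraNneq => ti; rewrite (bigD1 i) //= ti mul0r.
pose A := derivfm V *m invmx V.
have AV : derivfm V = A *m V by rewrite /A -mulmxA mulVmx// mulmx1.
have key (i j k : 'I_n) : j = i.+1 :> nat ->
    derivf (T i k) + \sum_l T i l * A l k = T j k.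
  move=> ji.
  have : row j (T *m V) = row i ((derivfm T + T *m A) *m V).
    rewrite -WTV (dW1 i j ji) WTV derivfm_row derivfm_mul AV.
    by rewrite mulmxA -mulmxDl.
  rewrite !row_mul => /(congr1 (mulmxr (invmx V))) /=.
  rewrite -!mulmxA mulmxV// !mulmx1 => /rowP/(_ k); rewrite !mxE => ->.
  by congr (_ + _).
have A0 (i j : 'I_n) : (i.+1 < j)%N -> A i j = 0.
  have [m] := ubnP (i : nat); elim: m i j => // m IH i j; rewrite ltnS => im ij.
  have i1n : (i.+1 < n)%N by rewrite (ltn_trans ij).
  have := key i (Ordinal i1n) j erefl.
  rewrite trT ?(ltn_trans _ ij)// derivf0 add0r trT// => h.
  have : T i i * A i j = 0.
    rewrite -h; apply/esym; apply: (@sum_ord_split _ (fun l => T i l * A l j)) => k ki.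
      by rewrite trT ?mul0r.
    by rewrite IH ?mulr0// ?(leq_trans ki)// (leq_ltn_trans _ ij)// ltnW.
  by move/eqP; rewrite mulf_eq0 (negbTE (T0 i)) => /eqP.
exists A; split=> // i j ji.
rewrite -(key i j j ji) (trT i j) ?ji// derivf0 add0r; apply/esym.
apply: (@sum_ord_split _ (fun l => T i l * A l j)) => k ki.
  by rewrite trT ?mul0r.
by rewrite A0 ?mulr0// ji ltnS.
Qed.

(** The same in vector form, indexed by natural numbers so that indices such as 5 - i and 6 - i need
    no casts. *)
Lemma frenet_frame m (w : nat -> 'rV[O]_m.+1) :
  (forall i, w i.+1 = derivfm (w i)) ->
  \det (\matrix_(i < m.+1) w i) != 0 ->
  exists (v : nat -> 'rV[O]_m.+1) (T A : nat -> nat -> O) (al : nat -> O),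
  [/\ \matrix_(i < m.+1) v i \in unitmx,
      forall i, (i <= m)%N -> w i = \sum_(k < i.+1) T i k *: v k,
      forall i, (i <= m)%N -> T i i != 0,
      forall i, (i < m)%N ->
        derivfm (v i) = al i *: v i.+1 + \sum_(k < i.+1) A i k *: v k &
      forall i, (i < m)%N -> al i != 0].
Proof.
move=> dw dW; set W := \matrix_i w i in dW.
have [T [V [WTV trT uV]]] := triangular_decomposition dW.
have [|A [AV T0 A0 TA]] := frenet_matrix WTV trT uV dW.
  by move=> i j ji; rewrite !rowK ji.
have /is_trig_mxP trT' := trT.
pose v i : 'rV[O]_m.+1 := row (inord i) V.
have vE : \matrix_(i < m.+1) v i = V.
  by apply/row_matrixP => i; rewrite rowK /v inord_val.
have sumE (F : 'I_m.+1 -> O) i : (i <= m)%N ->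
    (forall k : 'I_m.+1, (i < k)%N -> F k = 0) ->
    \sum_k F k *: row k V = \sum_(k < i.+1) F (inord k) *: v k.
  move=> im F0.
  rewrite (big_ord_widen m.+1 (fun k => F (inord k) *: v k)) ?ltnS//.
  rewrite [LHS](bigID (fun k : 'I_m.+1 => (k < i.+1)%N)) /= [X in _ + X]big1 ?addr0.
    by apply: eq_bigr => k _; rewrite /v inord_val.
  by move=> k; rewrite -leqNgt => ik; rewrite F0 ?scale0r.
have rowM (B : 'M[O]_m.+1) i : row i (B *m V) = \sum_k B i k *: row k V.
  by rewrite row_mul mulmx_sum_row; apply: eq_bigr => k _; rewrite mxE.
exists v, (fun i j => T (inord i) (inord j)), (fun i j => A (inord i) (inord j)),
  (fun i => A (inord i) (inord i.+1)); split.
- by rewrite vE.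
- move=> i im; have -> : w i = row (inord i) W by rewrite rowK inordK.
  by rewrite WTV rowM (sumE _ i)// => k ik; apply: trT'; rewrite inordK.
- by move=> i im; exact: T0.
- move=> i im; rewrite /v derivfm_row AV rowM.
  rewrite (sumE _ i.+1)//; last by move=> k ik; apply: A0; rewrite inordK// ltnS ltnW.
  by rewrite big_ord_recr /= addrC.
- move=> i im; have := T0 (inord i.+1); apply: contraNneq => a0.
  by rewrite -(TA (inord i)) ?a0 ?mulr0// !inordK// ltnS// ltnW.
Qed.
End FrenetFrame.

(** * Isotropic frames and the associative 3-form *)

Section G2Frame.
Variable K : numFieldType.
Local Notation O := (fps K).

Lemma derivf_dotp n (u v : 'rV[O]_n) :
  derivf (dotp u v) = dotp (derivfm u) v + dotp u (derivfm v).
Proof.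
rewrite /dotp derivf_sum -big_split; apply: eq_bigr => a _.
by rewrite derivfM !mxE.
Qed.

Lemma derivf_xcoef a b c : derivf (xcoef O a b c) = 0.
Proof.
have d1 : derivf (1 : O) = 0 by apply/fpsP => n; rewrite /= mul0rn.
by rewrite /xcoef derivfD derivfN; do 2 case: is_cross_triple;
  rewrite ?d1 ?derivf0 ?oppr0 ?addr0.
Qed.

Lemma derivfm_xprod (u v : 'rV[O]_7) :
  derivfm (xprod u v) = xprod (derivfm u) v + xprod u (derivfm v).
Proof.
apply/rowP => c; rewrite !mxE derivf_sum -big_split; apply: eq_bigr => a _ /=.
rewrite derivf_sum -big_split; apply: eq_bigr => b _ /=.
by rewrite !derivfM derivf_xcoef !mxE mul0r add0r.
Qed.

(** The matrix of products of x_i with x_(6-j) is triangular: i < j gives i + (6 - j) <= 5. *)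
Lemma gram_rev (x : nat -> 'rV[O]_7) :
  (forall i j, (i + j <= 5)%N -> dotp (x i) (x j) = 0) ->
  \det (\matrix_(i < 7) x i) * \det (\matrix_(i < 7) x (6 - i)%N) =
  \prod_(i < 7) dotp (x i) (x (6 - i)%N).
Proof.
move=> h; rewrite -[\det (\matrix_(i < 7) x (6 - i)%N)]det_tr -det_mulmx det_trig.
  by apply: eq_bigr => i _; rewrite mxE; apply: eq_bigr => k _; rewrite !mxE.
apply/is_trig_mxP => i j ij; rewrite mxE -[RHS](h i (6 - j)%N).
  by apply: eq_bigr => k _; rewrite !mxE.
by have := ltn_ord j; lia.
Qed.

Lemma gram_rev_unit (x : nat -> 'rV[O]_7) :
  \matrix_(i < 7) x i \in unitmx -> \matrix_(i < 7) x (6 - i)%N \in unitmx.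
Proof.
move=> ux; have -> : \matrix_(i < 7) x (6 - i)%N =
    row_perm (perm (@rev_ord_inj 7)) (\matrix_(i < 7) x i).
  by apply/matrixP => i j; rewrite !mxE permE /= subSS.
by rewrite row_permE unitmx_mul unitmx_perm.
Qed.

(** Differentiating (w_i, w_(5-i)) = 0 shows that the antidiagonal products (w_i, w_(6-i)) agree up
    to sign. The middle one is (w_3, w_3), so none vanishes, and [gram_rev] makes their product a
    multiple of the Wronskian. *)
Lemma wronskian_neq0 (w : nat -> 'rV[O]_7) : (forall i, w i.+1 = derivfm (w i)) ->
  (forall i j, (i + j <= 5)%N -> dotp (w i) (w j) = 0) ->
  dotp (w 3%N) (w 3%N) != 0 -> \det (\matrix_(i < 7) w i) != 0.
Proof.
move=> dw iso g0.
have step i : (i <= 5)%N ->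
    dotp (w i.+1) (w (6 - i.+1)%N) = - dotp (w i) (w (6 - i)%N).
  move=> i5; have : derivf (dotp (w i) (w (5 - i)%N)) = 0.
    by rewrite iso ?derivf0//; lia.
  rewrite derivf_dotp -!dw (_ : (5 - i).+1 = (6 - i)%N); last by lia.
  by rewrite subSS => /eqP; rewrite addr_eq0 => /eqP.
have all0 i : (i <= 6)%N -> dotp (w i) (w (6 - i)%N) = (-1) ^+ i * dotp (w 0%N) (w 6%N).
  elim: i => [|i IH] i6; first by rewrite expr0 mul1r.
  by rewrite step// IH ?(ltnW i6)// exprS mulN1r mulNr.
have g00 : dotp (w 0%N) (w 6%N) != 0.
  by apply: contraNneq g0 => h; have := all0 3%N isT; rewrite h mulr0 => ->.
have := gram_rev iso; apply: contra_eq_neq => ->; rewrite mul0r eq_sym.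
apply/prodf_neq0 => i _; have i6 : (i <= 6)%N by rewrite -ltnS.
by rewrite all0// mulf_neq0// signr_eq0.
Qed.

Section Frame.
Variables (w v : nat -> 'rV[O]_7) (T A : nat -> nat -> O) (al : nat -> O).
Hypothesis uV : \matrix_(i < 7) v i \in unitmx.
Hypothesis wT : forall i, (i <= 6)%N -> w i = \sum_(k < i.+1) T i k *: v k.
Hypothesis T0 : forall i, (i <= 6)%N -> T i i != 0.
Hypothesis dv : forall i, (i < 6)%N ->
  derivfm (v i) = al i *: v i.+1 + \sum_(k < i.+1) A i k *: v k.
Hypothesis al0 : forall i, (i < 6)%N -> al i != 0.
Hypothesis iso_w : forall i j, (i + j <= 5)%N -> dotp (w i) (w j) = 0.
Hypothesis null_w : xprod (w 0%N) (w 1%N) = 0.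

(** Solves the triangular system [wT] from the top; the diagonal of [T] is nonzero and power series
    form a domain. *)
Lemma frame_dotp0 x i : (i <= 6)%N ->
  (forall k, (k <= i)%N -> dotp (w k) x = 0) -> dotp (v i) x = 0.
Proof.
have [m] := ubnP i; elim: m i => // m IH i; rewrite ltnS => im i6 h.
have := h i (leqnn i); rewrite wT// big_ord_recr /= dotpDl dotpZl dotp_suml.
rewrite big1 ?add0r => [/eqP|k _]; last first.
  rewrite dotpZl IH ?mulr0// ?(leq_trans _ im)//.
    by rewrite (leq_trans (ltnW (ltn_ord k))).
  by move=> j jk; apply: h; rewrite (leq_trans jk)// ltnW.
by rewrite mulf_eq0 (negbTE (T0 i6)) => /eqP.
Qed.

Lemma iso_v i j : (i + j <= 5)%N -> dotp (v i) (v j) = 0.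
Proof.
move=> ij; apply: frame_dotp0 => [|k ki]; first by lia.
rewrite dotpC; apply: frame_dotp0 => [|l lj]; first by lia.
by apply: iso_w; lia.
Qed.

(** The product of all these pairings is a product of two unit determinants, so each factor is a
    unit. *)
Lemma gram_unit i : (i <= 6)%N -> dotp (v i) (v (6 - i)%N) \is a GRing.unit.
Proof.
move=> i6; have := gram_rev iso_v.
have := uV; have := gram_rev_unit uV; rewrite !unitmxE => u1 u2 e.
have : \prod_(i < 7) dotp (v i) (v (6 - i)%N) \is a GRing.unit.
  by rewrite -e unitrM u2.
have i7 : (i < 7)%N by [].
by rewrite (bigD1 (Ordinal i7)) //= unitrM => /andP[].
Qed.

Lemma lead_dotp x i : (i < 6)%N -> (forall k, (k <= i)%N -> dotp (v k) x = 0) ->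
  dotp (derivfm (v i)) x = al i * dotp (v i.+1) x.
Proof.
move=> i6 h; rewrite dv// dotpDl dotpZl dotp_suml big1 ?addr0// => k _.
by rewrite dotpZl h ?mulr0// -ltnS.
Qed.

Lemma lead_xprod x i : (i < 6)%N -> (forall k, (k <= i)%N -> xprod (v k) x = 0) ->
  xprod (derivfm (v i)) x = al i *: xprod (v i.+1) x.
Proof.
move=> i6 h; rewrite dv// xprodDl xprodZl xprod_suml big1 ?addr0// => k _.
by rewrite xprodZl h ?scaler0// -ltnS.
Qed.

Lemma order_symmetry i : (i <= 5)%N ->
  al i * dotp (v i.+1) (v (5 - i)%N) = - (al (5 - i)%N * dotp (v i) (v (6 - i)%N)).
Proof.
move=> i5; have : derivf (dotp (v i) (v (5 - i)%N)) = 0.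
  by rewrite iso_v ?derivf0//; lia.
rewrite derivf_dotp lead_dotp; [|by lia|by move=> k ki; apply: iso_v; lia].
rewrite [X in _ + X]dotpC lead_dotp; first last.
- by move=> k ki; rewrite iso_v//; lia.
- by lia.
have -> : (5 - i).+1 = (6 - i)%N by lia.
by rewrite [dotp (v (6 - i)%N) _]dotpC => /eqP; rewrite addr_eq0 => /eqP.
Qed.

Lemma scale_rV_eq0 n c (x : 'rV[O]_n) : c != 0 -> c *: x = 0 -> x = 0.
Proof.
move=> c0 /rowP h; apply/rowP => i; have := h i; rewrite !mxE => /eqP.
by rewrite mulf_eq0 (negbTE c0) => /eqP.
Qed.

(* The associative 3-form. *)
Let t i j k := dotp (xprod (v i) (v j)) (v k).

Lemma t_cyc i j k : t i j k = t j k i. Proof. exact: xprod_cycle. Qed.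
Lemma t_swap i j k : t i j k = - t j i k.
Proof. by rewrite /t xprodC -scaleN1r dotpZl mulN1r. Qed.
Lemma t_iik i k : t i i k = 0. Proof. by rewrite /t xprodvv dotp0l. Qed.
Lemma t_iji i j : t i j i = 0. Proof. by rewrite -t_cyc t_iik. Qed.
Lemma t_ijj i j : t i j j = 0. Proof. by rewrite t_cyc t_iik. Qed.

Lemma lead_t1 y z i : (i < 6)%N ->
  (forall k, (k <= i)%N -> dotp (xprod (v k) y) z = 0) ->
  dotp (xprod (derivfm (v i)) y) z = al i * dotp (xprod (v i.+1) y) z.
Proof.
move=> i6 h; rewrite xprod_cycle dotpC lead_dotp// => [|k ki].
  by rewrite dotpC -xprod_cycle.
by rewrite dotpC -xprod_cycle h.
Qed.

(** The derivative of t i j k = 0; the hypotheses remove every term of the Frenet equations except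
    the leading ones. *)
Lemma lead_t i j k : (i < 6)%N -> (j < 6)%N -> (k < 6)%N ->
  (forall l, (l <= i)%N -> t l j k = 0) -> (forall l, (l <= j)%N -> t i l k = 0) ->
  (forall l, (l <= k)%N -> t i j l = 0) ->
  al i * t i.+1 j k + al j * t i j.+1 k + al k * t i j k.+1 = 0.
Proof.
move=> i6 j6 k6 hi hj hk.
have : derivf (t i j k) = 0 by rewrite hi ?derivf0.
rewrite derivf_dotp derivfm_xprod dotpDl lead_t1//.
rewrite (xprod_cycle (v i) (derivfm (v j)) (v k)) lead_t1//; last first.
  by move=> l lj; rewrite -xprod_cycle; exact: hj.
rewrite -(xprod_cycle (derivfm (v k)) (v i) (v j)) lead_t1//; last first.
  by move=> l lk; rewrite xprod_cycle; exact: hk.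
by rewrite /t (xprod_cycle (v i) (v j.+1)) -(xprod_cycle (v k.+1) (v i)).
Qed.

Lemma x01 : xprod (v 0%N) (v 1%N) = 0.
Proof.
have w0 : w 0%N = T 0%N 0%N *: v 0%N by rewrite wT// big_ord1.
have w1 : w 1%N = T 1%N 0%N *: v 0%N + T 1%N 1%N *: v 1%N.
  by rewrite wT// big_ord_recl big_ord1.
have := null_w; rewrite w0 w1 xprodZl xprodDr !xprodZr xprodvv scaler0 add0r.
by rewrite scalerA; apply: scale_rV_eq0; rewrite mulf_neq0// T0.
Qed.

Lemma lead_x i j : (i < 6)%N -> (j < 6)%N ->
  (forall l, (l <= i)%N -> xprod (v l) (v j) = 0) ->
  (forall l, (l <= j)%N -> xprod (v i) (v l) = 0) ->
  al i *: xprod (v i.+1) (v j) + al j *: xprod (v i) (v j.+1) = 0.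
Proof.
move=> i6 j6 hi hj.
have : derivfm (xprod (v i) (v j)) = 0.
  by rewrite hi//; apply/rowP => a; rewrite !mxE derivf0.
rewrite derivfm_xprod lead_xprod// [xprod _ (derivfm _)]xprodC lead_xprod//.
  by rewrite -scalerN -xprodC.
by move=> l lj; rewrite xprodC hj ?oppr0.
Qed.

(** In the derivative of v_0 x v_1 = 0 the term v_1 x v_1 drops out. *)
Lemma x02 : xprod (v 0%N) (v 2%N) = 0.
Proof.
have := @lead_x 0 1 isT isT; rewrite xprodvv scaler0 add0r => h.
apply: scale_rV_eq0 (al0 _) (h _ _) => //.
  by case=> //; rewrite x01.
by case=> [|[|]] //; rewrite ?xprodvv ?x01.
Qed.

Lemma x12_x03 :
  al 0%N *: xprod (v 1%N) (v 2%N) + al 2%N *: xprod (v 0%N) (v 3%N) = 0.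
Proof.
apply: lead_x => //; first by case=> //; rewrite x02.
by case=> [|[|[|]]] //; rewrite ?xprodvv ?x01 ?x02.
Qed.

Lemma t01 k : t 0 1 k = 0. Proof. by rewrite /t x01 dotp0l. Qed.
Lemma t02 k : t 0 2 k = 0. Proof. by rewrite /t x02 dotp0l. Qed.
Lemma t10 k : t 1 0 k = 0. Proof. by rewrite t_swap t01 oppr0. Qed.
Lemma t20 k : t 2 0 k = 0. Proof. by rewrite t_swap t02 oppr0. Qed.

Lemma t12_t03 k : al 0%N * t 1 2 k + al 2%N * t 0 3 k = 0.
Proof. by rewrite /t -!dotpZl -dotpDl x12_x03 dotp0l. Qed.

Lemma al_eq0 i x : (i < 6)%N -> al i * x = 0 -> x = 0.
Proof. by move=> /al0 ai /eqP; rewrite mulf_eq0 (negbTE ai) => /eqP. Qed.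

Let tz := (t_iik, t_iji, t_ijj, t01, t02, t10, t20).

(** From here vanishing climbs with the index sum, from 6 to 8: each component known to be zero is
    differentiated, and repeated indices remove most of the terms. *)
Lemma t123 : t 1 2 3 = 0.
Proof. by have := t12_t03 3; rewrite tz mulr0 addr0; exact: al_eq0. Qed.

Lemma t12k k : (k <= 3)%N -> t 1 2 k = 0.
Proof.
case: k => [|[|[|[|]]]] // _; rewrite ?t123 ?tz//.
by rewrite t_cyc t_cyc t01.
Qed.

Lemma t124 : t 1 2 4 = 0.
Proof.
have := @lead_t 1 2 3 isT isT isT; rewrite !tz !mulr0 !add0r => h.
apply: (@al_eq0 3) => //; apply: h.
- by case=> [|[|]] // _; rewrite ?t123 ?tz.
- by case=> [|[|[|]]] // _; rewrite ?t123 ?tz.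
- exact: t12k.
Qed.

Lemma t034 : t 0 3 4 = 0.
Proof. by have := t12_t03 4; rewrite t124 mulr0 add0r; exact: al_eq0. Qed.

Lemma t12_le4 k : (k <= 4)%N -> t 1 2 k = 0.
Proof.
by rewrite leq_eqVlt => /predU1P[->|]; [exact: t124|exact: t12k].
Qed.

Lemma t134_t125 : al 2%N * t 1 3 4 + al 4%N * t 1 2 5 = 0.
Proof.
have := @lead_t 1 2 4 isT isT isT; rewrite tz mulr0 add0r; apply.
- by case=> [|[|]] // _; rewrite ?t124 ?tz.
- by case=> [|[|[|]]] // _; rewrite ?t124 ?tz.
- exact: t12_le4.
Qed.

Lemma t134_t035 : al 0%N * t 1 3 4 + al 4%N * t 0 3 5 = 0.
Proof.
have := @lead_t 0 3 4 isT isT isT; rewrite tz mulr0 addr0; apply.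
- by case=> // _; exact: t034.
- by case=> [|[|[|[|]]]] // _; rewrite ?t034 ?tz.
- case=> [|[|[|[|[|]]]]] // _; rewrite ?t034 ?tz//.
    by rewrite t_cyc t_cyc t10.
  by rewrite t_cyc t_cyc t20.
Qed.

Lemma two_neq0 : (2 : O) != 0.
Proof.
apply/eqP => /fpsP/(_ 0%N); rewrite mulr2n fcoefD /= => /eqP.
by rewrite -mulr2n pnatr_eq0.
Qed.

(* t12_t03, t134_t125 and t134_t035 form a linear system in t 1 3 4, t 1 2 5 and
   t 0 3 5 whose determinant is 2 al_0 al_2 al_4 up to sign. *)
Lemma t134 : t 1 3 4 = 0.
Proof.
have := t12_t03 5; have := t134_t125; have := t134_t035.
set p := t 1 3 4; set q := t 1 2 5; set s := t 0 3 5 => e1 e2 e3.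
have : 2 * (al 0%N * (al 2%N * p)) = 0.
  have -> : 2 * (al 0%N * (al 2%N * p)) = al 0%N * (al 2%N * p + al 4%N * q) +
    al 2%N * (al 0%N * p + al 4%N * s) - al 4%N * (al 0%N * q + al 2%N * s).
    by ring.
  by rewrite e1 e2 e3 !mulr0 addr0 subr0.
move/eqP; rewrite mulf_eq0 (negbTE two_neq0) => /eqP.
by move=> /(@al_eq0 0 _ isT)/(@al_eq0 2 _ isT).
Qed.

Lemma t125 : t 1 2 5 = 0.
Proof. by have := t134_t125; rewrite t134 mulr0 add0r; exact: al_eq0. Qed.

Lemma frame_span x : exists c : 'I_7 -> O, x = \sum_k c k *: v k.
Proof.
exists (fun k => (x *m invmx (\matrix_(i < 7) v i)) 0 k).
rewrite -[LHS](mulmxKV uV) mulmx_sum_row; apply: eq_bigr => k _.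
by rewrite rowK.
Qed.

(** Descending induction from k = 6. Pairing with v_(6-k) kills the lower terms by isotropy and the
    higher ones by induction, and multiplies c_k by a unit. *)
Lemma frame_coef0 (c : 'I_7 -> O) m :
  (forall j, (j <= m)%N -> dotp (\sum_k c k *: v k) (v j) = 0) ->
  forall k : 'I_7, (6 - m <= k)%N -> c k = 0.
Proof.
move=> h k; have [n] := ubnP (6 - k)%N; elim: n k => // n IH k; rewrite ltnS => kn mk.
have k6 : (k <= 6)%N by rewrite -ltnS.
have km : (6 - k <= m)%N by lia.
have := h _ km; rewrite dotp_suml (@sum_ord_split K 7 _ k) => [|l kl|l lk].
- rewrite dotpZl => /eqP; rewrite mulf_eq0 => /orP[/eqP //|/eqP g0].
  by have := gram_unit k6; rewrite g0 unitr0.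
- by rewrite dotpZl IH ?mul0r//; have := ltn_ord l; lia.
- by rewrite dotpZl iso_v ?mulr0//; have := ltn_ord l; lia.
Qed.

(** v_1 x v_4 is orthogonal to v_0, ..., v_4, hence a combination of v_0 and v_1; the pairings of
    v_5 x v_2 with these are [t 5 2 0] and [t 5 2 1], both zero. *)
Lemma x25_x14 : dotp (xprod (v 5%N) (v 2%N)) (xprod (v 1%N) (v 4%N)) = 0.
Proof.
have [c xc] := frame_span (xprod (v 1%N) (v 4%N)).
have c0 : forall k : 'I_7, (2 <= k)%N -> c k = 0.
  apply: (@frame_coef0 c 4) => j; rewrite -xc -/(t 1 4 j).
  case: j => [|[|[|[|[|]]]]] // _; rewrite ?tz//.
  - by rewrite t_cyc t_cyc t01.
  - by rewrite t_swap t_cyc t124 oppr0.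
  - by rewrite t_swap t_cyc t134 oppr0.
rewrite xc dotpC dotp_suml big1// => k _; rewrite dotpZl.
have [k2|/c0 ->] := ltnP k 2; last by rewrite mul0r.
rewrite dotpC -/(t 5 2 k).
have -> : t 5 2 k = 0; last by rewrite mulr0.
case: (nat_of_ord k) k2 => [|[|]] // _; first by rewrite t_cyc t20.
by rewrite t_cyc t_swap t125 oppr0.
Qed.

(* The polarisation of |u x v|^2 = |u|^2 |v|^2 - (u, v)^2. *)
Lemma x12_unit : exists y, dotp (xprod (v 1%N) (v 2%N)) y \is a GRing.unit.
Proof.
(* v_5 and v_4 are the partners of v_1 and v_2 in the Gram pairing; the value is 2 (v_5, v_1) (v_2,
   v_4). *)
exists (xprod (v 5%N) (v 4%N)).
have := xprod_dotp (v 5%N) (v 1%N) (v 2%N) (v 4%N); rewrite x25_x14 addr0 => ->.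
rewrite [dotp (v 1%N) (v 4%N)]iso_v// [dotp (v 1%N) (v 2%N)]iso_v// mulr0 mul0r !subr0.
rewrite -mulr_natl !unitrM [dotp (v 5%N) _]dotpC (gram_unit (i := 1))// (gram_unit (i := 2))//.
by rewrite unit_fcoef0 mulr2n fcoefD /= -mulr2n pnatr_eq0.
Qed.

(** By isotropy v_3 x (v_3 x v_0) = - (v_3, v_3) v_0; pairing with v_6 gives a product of two
    units. *)
Lemma x03_unit : exists y, dotp (xprod (v 0%N) (v 3%N)) y \is a GRing.unit.
Proof.
exists (xprod (v 6%N) (v 3%N)).
have := xprod_xprod (v 3%N) (v 0%N); rewrite [dotp (v 3%N) (v 0%N)]iso_v// scale0r sub0r.
move=> /(congr1 (fun x => dotp x (v 6%N))); rewrite -scaleNr dotpZl.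
have -> : dotp (xprod (v 3%N) (xprod (v 3%N) (v 0%N))) (v 6%N) =
    - dotp (xprod (v 0%N) (v 3%N)) (xprod (v 6%N) (v 3%N)).
  rewrite -xprod_cycle [xprod (v 3%N) (v 0%N)]xprodC.
  by rewrite -scaleN1r dotpC dotpZl mulN1r dotpC.
move=> /eqP; rewrite mulNr eqr_opp => /eqP ->.
by rewrite unitrM (gram_unit (i := 3))// (gram_unit (i := 0)).
Qed.

(** The vector relation [x12_x03] is tested against one vector for each divisibility, chosen so that
    the coefficient of the divided element is a unit. *)
Lemma al0_al2 : (exists u c, u \is a GRing.unit /\ u * al 0%N = c * al 2%N) /\
  (exists u c, u \is a GRing.unit /\ u * al 2%N = c * al 0%N).
Proof.
have h y : al 0%N * dotp (xprod (v 1%N) (v 2%N)) y +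
    al 2%N * dotp (xprod (v 0%N) (v 3%N)) y = 0.
  by rewrite -!dotpZl -dotpDl x12_x03 dotp0l.
split.
  have [y uy] := x12_unit; have /eqP := h y; rewrite addr_eq0 => /eqP e.
  exists (dotp (xprod (v 1%N) (v 2%N)) y), (- dotp (xprod (v 0%N) (v 3%N)) y).
  by split=> //; rewrite mulrC e mulNr mulrC.
have [y uy] := x03_unit; have := h y; rewrite addrC => /eqP; rewrite addr_eq0 => /eqP e.
exists (dotp (xprod (v 0%N) (v 3%N)) y), (- dotp (xprod (v 1%N) (v 2%N)) y).
by split=> //; rewrite mulrC e mulNr mulrC.
Qed.

End Frame.
End G2Frame.

(** * Osculating curves in terms of the frame *)

Section Minors.
Variable A : comNzRingType.

Definition minor n k (x : 'I_k -> 'rV[A]_n) (s : 'I_k -> 'I_n) : A :=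
  \det (\matrix_(i, l) x i 0 (s l)).

Definition upd n k (x : 'I_k -> 'rV[A]_n) i y : 'I_k -> 'rV[A]_n :=
  fun r => if r == i then y else x r.

Lemma minor_updD n k (x : 'I_k -> 'rV[A]_n) s i (c d : A) y z :
  minor (upd x i (c *: y + d *: z)) s =
  c * minor (upd x i y) s + d * minor (upd x i z) s.
Proof.
apply: (@determinant_multilinear _ _ _ _ _ i).
- by apply/rowP => l; rewrite !mxE /upd eqxx !mxE.
- by apply/matrixP => r l; rewrite !mxE /upd eq_sym (negbTE (neq_lift i r)).
- by apply/matrixP => r l; rewrite !mxE /upd eq_sym (negbTE (neq_lift i r)).
Qed.

Lemma minor_upd_sum n k (x : 'I_k -> 'rV[A]_n) s i m (c : 'I_m -> A) y :
  minor (upd x i (\sum_k c k *: y k)) s = \sum_k c k * minor (upd x i (y k)) s.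
Proof.
have upd0 : minor (upd x i 0) s = 0.
  have := minor_updD x s i 0 0 0 0; rewrite !scale0r addr0 !mul0r addr0 //.
elim/big_rec2: _ => [//|j a b _ <-].
by rewrite -[b in LHS]scale1r minor_updD mul1r.
Qed.

Lemma minor_upd_id n k (x : 'I_k -> 'rV[A]_n) s i : minor (upd x i (x i)) s = minor x s.
Proof.
congr (\det _); apply/matrixP => r l; rewrite !mxE /upd.
by case: eqP => [->|].
Qed.

Lemma minor_upd_dup n k (x : 'I_k -> 'rV[A]_n) s i j : i != j ->
  minor (upd x i (x j)) s = 0.
Proof.
move=> ij; apply: (determinant_alternate ij) => l.
by rewrite !mxE /upd eqxx eq_sym (negbTE ij).
Qed.

(** The coordinates of [wedge] over any commutative ring, for use with power series. *)
Definition gwedge n k (x : 'I_k -> 'rV[A]_n) : 'rV[A]_#|incr n k| :=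
  \row_a minor x (tnth (enum_val a)).
End Minors.

Section IncreasingMinors.
Variable F : fieldType.

(** Some k columns are independent. Listed increasingly they give the required minor: the original
    minor is its product with the determinant of a re-indexing matrix, so no sign has to be
    computed. *)
Lemma increasing_minor n k (M : 'M[F]_(k, n)) : row_free M ->
  exists a : 'I_#|incr n k|, minor (fun i => row i M) (tnth (enum_val a)) != 0.
Proof.
move=> fM.
have fMT : row_full M^T by rewrite /row_full mxrank_tr.
pose f := fullrankfun fMT.
pose X := [set f l | l : 'I_k].
have szX : size (enum X) == k.
  by rewrite -cardE card_imset ?card_ord//; exact: fullrankfun_inj.
pose t := Tuple szX.
have tI : t \in incr n k.
  have : sorted ltn (map val (enum X)).
    apply: (@subseq_sorted _ ltn ltn_trans _ (map val (enum 'I_n))).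
      by rewrite map_subseq// {1}/enum_mem -enumT filter_subseq.
    by rewrite val_enum_ord iota_ltn_sorted.
  by rewrite inE.
exists (enum_rank_in tI t); rewrite enum_rankK_in//.
have ft (l : 'I_k) : exists r, f l = tnth t r.
  by apply/tnthP; rewrite mem_enum; apply/imsetP; exists l.
have [sg sgE] := choice ft.
have uf : \det (rowsub f M^T) != 0.
  by rewrite -unitfE -unitmxE fullrowsub_unit.
apply: contraNneq uf => m0.
have -> : rowsub f M^T = (\matrix_(i, l) M i (tnth t l) *m
    \matrix_(r, l) (r == sg l)%:R)^T.
  apply/matrixP => l i; rewrite !mxE (bigD1 (sg l)) //= big1 => [|r rl].
    by rewrite !mxE eqxx mulr1 addr0 sgE.
  by rewrite !mxE (negbTE rl) mulr0.
rewrite det_tr det_mulmx; move: m0; rewrite /minor.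
have -> : \matrix_(i, l) row i M 0 (tnth t l) = \matrix_(i, l) M i (tnth t l).
  by apply/matrixP => i l; rewrite !mxE.
by move=> ->; rewrite mul0r.
Qed.
End IncreasingMinors.

(** * Vanishing orders of the derivatives of osculating curves *)

Section OsculatingOrder.
Variable K : numFieldType.
Local Notation O := (fps K).

(** Reduction modulo z, the value at the base point. *)
Definition fev (f : O) : K := fcoef f 0.

Lemma fev_is_zmod_morphism : zmod_morphism fev. Proof. by []. Qed.
Lemma fev_is_monoid_morphism : monoid_morphism fev.
Proof. by split=> // f g; rewrite /fev fcoefM big_ord1. Qed.
HB.instance Definition _ :=
  GRing.isZmodMorphism.Build O K fev fev_is_zmod_morphism.
HB.instance Definition _ :=
  GRing.isMonoidMorphism.Build O K fev fev_is_monoid_morphism.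

Lemma derivf_prod n (F : 'I_n -> O) : derivf (\prod_i F i) =
  \sum_i \prod_k (if k == i then derivf (F k) else F k).
Proof.
elim: n F => [|n IH] F.
  by rewrite !big_ord0; apply/fpsP => k; rewrite /= mul0rn.
rewrite big_ord_recl derivfM [RHS]big_ord_recl big_ord_recl /=; congr (_ + _).
rewrite IH mulr_sumr; apply: eq_bigr => i _; rewrite [RHS]big_ord_recl /=.
by congr (_ * _); apply: eq_bigr => k _; rewrite (inj_eq lift_inj).
Qed.

Lemma derivf_signM (b : nat) (f : O) : derivf ((-1) ^+ b * f) = (-1) ^+ b * derivf f.
Proof.
by rewrite -signr_odd; case: (odd b); rewrite ?expr1 ?expr0 ?mulN1r ?mul1r ?derivfN.
Qed.

Lemma derivf_minor n k (x : 'I_k -> 'rV[O]_n) s :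
  derivf (minor x s) = \sum_i minor (upd x i (derivfm (x i))) s.
Proof.
rewrite /minor /determinant derivf_sum exchange_big /=; apply: eq_bigr => p _.
rewrite derivf_signM -mulr_sumr; congr (_ * _); rewrite derivf_prod.
apply: eq_bigr => i _; apply: eq_bigr => r _; rewrite !mxE /upd.
by case: eqP => [->|//]; rewrite !mxE.
Qed.

Section Frame.
Variables (m : nat) (w v : nat -> 'rV[O]_m.+1) (T A : nat -> nat -> O) (al : nat -> O).
Hypothesis uV : \matrix_(i < m.+1) v i \in unitmx.
Hypothesis wT : forall i, (i <= m)%N -> w i = \sum_(k < i.+1) T i k *: v k.
Hypothesis T0 : forall i, (i <= m)%N -> T i i != 0.
Hypothesis dv : forall i, (i < m)%N ->
  derivfm (v i) = al i *: v i.+1 + \sum_(k < i.+1) A i k *: v k.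
Variable j : nat.
Hypothesis jm : (j < m)%N.

Let vj (i : 'I_j.+1) := v i.
Let wj (i : 'I_j.+1) := w i.

(** Triangularity of [T] expresses w_0, ..., w_j through v_0, ..., v_j alone, so the two wedges
    differ by the determinant of the leading block of [T]. *)
Lemma minor_w s : minor wj s = (\prod_(i < j.+1) T i i) * minor vj s.
Proof.
pose Tj : 'M[O]_j.+1 := \matrix_(i, k) if (k <= i)%N then T i k else 0.
have -> : \prod_(i < j.+1) T i i = \det Tj.
  rewrite det_trig; first by apply: eq_bigr => i _; rewrite mxE leqnn.
  by apply/is_trig_mxP => i k ik; rewrite mxE leqNgt ik.
rewrite -det_mulmx; congr (\det _); apply/matrixP => i l; rewrite !mxE /wj wT; last first.
  by rewrite -ltnS (leq_trans (ltn_ord i))// ltnW.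
rewrite summxE (big_ord_widen j.+1 (fun k => (T i k *: v k) 0 (s l))); last exact: ltn_ord.
rewrite big_mkcond; apply: eq_bigr => k _; rewrite !mxE ltnS.
by case: ifP; rewrite ?mul0r.
Qed.

(** Replacing row i by v_(i+1) repeats a row unless i = j; the diagonal Frenet coefficients add up
    to a trace. *)
Lemma derivf_minor_v s : derivf (minor vj s) =
  (\sum_(i < j.+1) A i i) * minor vj s + al j * minor (upd vj ord_max (v j.+1)) s.
Proof.
rewrite derivf_minor.
have rowE (i : 'I_j.+1) : minor (upd vj i (derivfm (vj i))) s =
    A i i * minor vj s + al i * minor (upd vj i (v i.+1)) s.
  have im : (i < m)%N by rewrite (leq_trans _ jm).
  rewrite /vj dv// -[X in _ + X]scale1r minor_updD mul1r addrC; congr (_ + _).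
  rewrite minor_upd_sum big_ord_recr /= big1 ?add0r => [|k _].
    by rewrite -/(vj i) minor_upd_id.
  have kj : (k < j.+1)%N by rewrite (ltn_trans (ltn_ord k)).
  rewrite -/(vj (Ordinal kj)) minor_upd_dup ?mulr0// -val_eqE /= neq_ltn.
  by rewrite ltn_ord orbT.
rewrite (eq_bigr _ (fun i _ => rowE i)) big_split -mulr_suml /=; congr (_ + _).
rewrite big_ord_recr /= big1 ?add0r// => i _.
have ij : (i.+1 < j.+1)%N by rewrite ltnS.
rewrite -/(vj (Ordinal ij)) minor_upd_dup ?mulr0// -val_eqE /= neq_ltn.
by rewrite ltnSn.
Qed.

Local Notation N := #|incr m.+1 j.+1|.

(** A series is a unit when its value modulo z is nonzero, so the question becomes one of rank over
    the field. *)
Lemma minor_unit (y : nat -> 'rV[O]_m.+1) (x : 'I_j.+1 -> 'rV[O]_m.+1)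
    (B : 'M[K]_(j.+1, m.+1)) : row_free B ->
  (forall i, map_mx fev (x i) = row i B) ->
  exists a : 'I_N, minor x (tnth (enum_val a)) \is a GRing.unit.
Proof.
move=> fB xB; have [a a0] := increasing_minor fB; exists a.
rewrite unit_fcoef0 -/(fev _) -det_map_mx; move: a0; rewrite /minor.
congr (\det _ != 0); apply/matrixP => i l; rewrite !mxE.
by have /rowP/(_ (tnth (enum_val a) l)) := xB i; rewrite !mxE.
Qed.

(** The combination is the decomposable vector v_0 /\ ... /\ v_(j-1) /\ (c v_j + d v_(j+1)), nonzero
    modulo z because the frame stays independent there. The rows of [L] are its factors in the
    frame. *)
Lemma frame_minor_unit (c d : O) : c \is a GRing.unit \/ d \is a GRing.unit ->
  exists a : 'I_N, c * minor vj (tnth (enum_val a)) +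
    d * minor (upd vj ord_max (v j.+1)) (tnth (enum_val a)) \is a GRing.unit.
Proof.
move=> cd.
pose y := c *: v j + d *: v j.+1.
suff [a ua] : exists a : 'I_N,
    minor (upd vj ord_max y) (tnth (enum_val a)) \is a GRing.unit.
  exists a; move: ua; rewrite /y minor_updD.
  have e : minor (upd vj ord_max (v j)) (tnth (enum_val a)) =
    minor vj (tnth (enum_val a)) := minor_upd_id vj _ ord_max.
  by rewrite e.
pose V := \matrix_(i < m.+1) v i.
pose L : 'M[O]_(j.+1, m.+1) := \matrix_(i, l)
  if (i < j)%N then (l == i :> nat)%:R
  else c * (l == j :> nat)%:R + d * (l == j.+1 :> nat)%:R.
have vE (k : nat) (km : (k < m.+1)%N) : \sum_(l < m.+1) (l == k :> nat)%:R *: v l = v k.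
  rewrite (bigD1 (Ordinal km)) //= eqxx scale1r big1 ?addr0// => l.
  by rewrite -val_eqE /= => /negbTE ->; rewrite scale0r.
apply: (@minor_unit v _ (map_mx fev (L *m V))) => [|i]; last first.
  rewrite -map_row; congr map_mx; rewrite row_mul mulmx_sum_row /upd.
  under eq_bigr => l _ do rewrite rowK !mxE.
  have -> : (i == ord_max) = ~~ (i < j)%N.
    by rewrite -val_eqE /= eqn_leq -leqNgt -[(i <= j)%N]ltnS ltn_ord.
  case: (ltnP i j) => ij /=.
    by rewrite vE// (ltn_trans (ltn_ord i))// ltnS.
  under eq_bigr => l _ do rewrite scalerDl -!scalerA.
  by rewrite big_split -!scaler_sumr /= !vE// ltnS// ltnW.
rewrite map_mxM; have uV0 : map_mx fev V \in unitmx.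
  by rewrite unitmxE det_map_mx rmorph_unit// -unitmxE.
apply: inj_row_free => u; rewrite mulmxA => /(congr1 (mulmxr (invmx (map_mx fev V)))) /=.
rewrite mulmxK// mul0mx => /rowP uL.
have uLE (k : nat) (km : (k < m.+1)%N) : u 0 ord_max * fev (L ord_max (Ordinal km)) +
    \sum_(i < j) u 0 (widen_ord (leqnSn j) i) * (k == i :> nat)%:R = 0.
  have uk := uL (Ordinal km); rewrite [RHS]mxE in uk.
  rewrite -[RHS]uk [RHS]mxE big_ord_recr /= addrC.
  congr (_ + _); first by rewrite [in RHS]mxE.
  apply: eq_bigr => i _; rewrite [in RHS]mxE [in RHS]mxE /= ltn_ord.
  by rewrite rmorph_nat.
have uj : u 0 ord_max = 0.
  have sum0 (k : nat) : (j <= k)%N ->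
      \sum_(i < j) u 0 (widen_ord (leqnSn j) i) * (k == i :> nat)%:R = 0.
    move=> jk; rewrite big1// => i _.
    by rewrite gtn_eqF ?mulr0// (leq_trans (ltn_ord i)).
  have jm1 : (j.+1 < m.+1)%N by [].
  have jm0 : (j < m.+1)%N by exact: ltnW.
  case: cd; rewrite unit_fcoef0 -/(fev _) => c0.
    have := uLE j jm0; rewrite sum0// addr0 mxE /= ltnn eqxx ltn_eqF// mulr0 addr0 mulr1.
    by move=> /eqP; rewrite mulf_eq0 (negbTE c0) orbF => /eqP.
  have := uLE j.+1 jm1; rewrite sum0// addr0 mxE /= ltnn eqxx gtn_eqF// mulr0 add0r mulr1.
  by move=> /eqP; rewrite mulf_eq0 (negbTE c0) orbF => /eqP.
apply/rowP => i; rewrite [RHS]mxE; have [ij|ji] := ltnP i j; last first.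
  by rewrite -uj; congr (u 0 _); apply: val_inj => /=; apply/eqP; rewrite eqn_leq ji -ltnS ltn_ord.
have im : (i < m.+1)%N by rewrite (ltn_trans ij)// ltnW.
have := uLE i im; rewrite uj mul0r add0r (bigD1 (Ordinal ij)) //= eqxx mulr1.
rewrite big1 ?addr0 => [<-|l]; first by congr (u 0 _); apply: val_inj.
by rewrite -val_eqE /= eq_sym => /negbTE ->; rewrite mulr0.
Qed.

(* S is a multiple of v_0 /\ ... /\ v_j, whose derivative is, modulo itself,
   al_j v_0 /\ ... /\ v_(j-1) /\ v_(j+1). *)
Lemma osculating_order (S : 'rV[O]_N) a0 : S 0 a0 = 1 ->
  (forall a b, S 0 a * gwedge wj 0 b = S 0 b * gwedge wj 0 a) ->
  exists2 X : 'rV[O]_N, derivfm S = al j *: X & exists a, X 0 a \is a GRing.unit.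
Proof.
move=> S1 SO.
pose Om (a : 'I_N) := minor vj (tnth (enum_val a)).
pose Op (a : 'I_N) := minor (upd vj ord_max (v j.+1)) (tnth (enum_val a)).
have OmS a : Om a = S 0 a * Om a0.
  have := SO a a0; rewrite S1 mul1r !mxE !minor_w.
  rewrite mulrCA => e; apply/esym.
  suff : \prod_(i < j.+1) T i i != 0 by move/mulfI; apply.
  by apply/prodf_neq0 => i _; rewrite T0// -ltnS (leq_trans (ltn_ord i))// ltnW.
(* [Om a0] divides every [Om a], and one of these is a unit. *)
have u0 : Om a0 \is a GRing.unit.
  have [a] := @frame_minor_unit 1 0 (or_introl (unitr1 _)).
  by rewrite mul1r mul0r addr0 -/(Om a) OmS unitrM => /andP[].
have [a ua] := @frame_minor_unit (- Op a0) (Om a0) (or_intror u0).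
(* Obtained by differentiating Om b = S_b Om a0: the trace terms of [derivf_minor_v] cancel, leaving
   S_b' Om a0 = al_j (Op b - Op a0 S_b). *)
exists (\row_b ((Om a0)^-1 * (Op b - Op a0 * S 0 b))); last first.
  exists a; rewrite mxE unitrM unitrV u0 /=.
  move: ua; rewrite -/(Om a) -/(Op a) OmS.
  have -> : - Op a0 * (S 0 a * Om a0) + Om a0 * Op a = Om a0 * (Op a - Op a0 * S 0 a).
    by ring.
  by rewrite unitrM u0.
apply/rowP => b; rewrite !mxE.
have := derivf_minor_v (tnth (enum_val b)); rewrite -/(Om b) OmS derivfM -/(Op b).
have := derivf_minor_v (tnth (enum_val a0)); rewrite -/(Om a0) -/(Op a0) => -> e.
apply: (mulIr u0).
rewrite -[RHS]mulrA [_^-1 * _]mulrC divrK//.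
by move/(canRL (addrK _)): e => ->; ring.
Qed.

(** The vector [X] of [osculating_order] has a unit entry, so the least order among the entries of
    S' is that of al_j. *)
Lemma osculating_has_ord (S : 'rV[O]_N) a0 k : S 0 a0 = 1 ->
  (forall a b, S 0 a * gwedge wj 0 b = S 0 b * gwedge wj 0 a) ->
  has_ord k (al j) <->
  (forall l, (l < k)%N -> forall a, fcoef (derivf (S 0 a)) l = 0) /\
  exists a, fcoef (derivf (S 0 a)) k != 0.
Proof.
move=> S1 SO; have [X SX [a ua]] := osculating_order S1 SO.
have SE b : derivf (S 0 b) = al j * X 0 b.
  by have /rowP/(_ b) := SX; rewrite !mxE.
have hX : has_ord 0 (X 0 a) by apply/has_ord0.
split=> [hk|[h1 [b hb]]].
  have [h0 h1] := has_ordM hk hX; split=> [l lk b|].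
    rewrite SE fcoefM big1// => i _; case: hk => hk _.
    by rewrite hk ?mul0r// (leq_trans _ lk).
  by exists a; rewrite SE -[k]addn0.
have al0 : al j != 0.
  by apply: contraNneq hb; rewrite SE => ->; rewrite mul0r.
have [n hn] := has_ord_ex al0; suff -> : k = n by [].
have := has_ordM hn hX; rewrite addn0 -SE => -[n0 n1].
case: (ltngtP k n) => // [kn|nk]; last by rewrite h1 ?eqxx in n1.
move: hb; rewrite SE fcoefM big1 ?eqxx// => i _; case: hn => hn _.
by rewrite hn ?mul0r// (leq_trans _ kn).
Qed.
End Frame.
End OsculatingOrder.

(** * Taylor expansions *)

Section Jets.
Variable R : realType.
Local Notation C := R[i].
Local Notation plane := (R * R)%type.
Local Notation O := (fps C).
Implicit Types (F G : plane -> C) (z : plane) (U : set plane).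

(** The Taylor series at [z]. On holomorphic functions it respects sums and products and turns [wz]
    into [derivf], so it carries the analytic identities to power series. *)
Definition jet z F : O := Fps (fun n => iter n (@wz R) F z / n`!%:R).

Lemma jet_wz z F : jet z (wz F) = derivf (jet z F).
Proof.
apply/fpsP => n; rewrite /= -iterSr -[RHS]mulr_natr factS natrM invfM.
by rewrite [_^-1 * _^-1]mulrC mulrA divfK// pnatr_eq0.
Qed.

Lemma jet_eq U z F G : open U -> U z -> {in U, F =1 G} -> jet z F = jet z G.
Proof.
by move=> oU Uz FG; apply/fpsP => n /=; rewrite (iter_wz_eq n oU FG Uz).
Qed.

Lemma jetD U z F G : open U -> U z -> hol U F -> hol U G ->
  jet z (fun w => F w + G w) = jet z F + jet z G.
Proof.
move=> oU Uz hF hG; apply/fpsP => n; rewrite fcoefD /= -mulrDl; congr (_ / _).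
elim: n F G hF hG => [//|n IH] F G hF hG; rewrite !iterSr.
rewrite -(IH _ _ (hol_wz oU hF) (hol_wz oU hG)).
apply: iter_wz_eq oU _ Uz => w /set_mem Uw.
by rewrite wzD//; apply: hol_pderivable Uw.
Qed.

Lemma jet_cst z (c : C) n : fcoef (jet z (fun=> c)) n = if n == 0%N then c else 0.
Proof.
rewrite /=; case: n => [|n] /=; first by rewrite fact0 divr1.
have -> : iter n (@wz R) (fun=> c) = fun=> if n == 0%N then c else 0.
  elim: n => [//|n IH] /=; rewrite IH; apply/funext => w; exact: wz_cst.
by rewrite wz_cst mul0r.
Qed.

(** Coefficient n + 1 is read off from coefficient n of the derivative, where both Leibniz rules and
    the induction hypothesis apply. *)
Lemma jetM U z F G : open U -> U z -> hol U F -> hol U G ->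
  jet z (fun w => F w * G w) = jet z F * jet z G.
Proof.
move=> oU Uz hF hG; apply/fpsP => n; elim: n F G hF hG => [|n IH] F G hF hG.
  by rewrite fcoefM big_ord1 /= fact0 !divr1.
have n0 : (n.+1%:R : C) != 0 by rewrite pnatr_eq0.
apply: (mulIf n0); rewrite !mulr_natr.
rewrite -[LHS]/(fcoef (derivf (jet z (fun w => F w * G w))) n).
rewrite -[RHS]/(fcoef (derivf (jet z F * jet z G)) n) -jet_wz derivfM -!jet_wz.
have hF' := hol_wz oU hF; have hG' := hol_wz oU hG.
rewrite fcoefD -(IH _ _ hF' hG) -(IH _ _ hF hG') -fcoefD.
rewrite -(jetD oU Uz (holM oU hF' hG) (holM oU hF hG')).
congr (fcoef _ n); apply: jet_eq oU Uz _ => w /set_mem Uw.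
by rewrite wzM//; apply: hol_pderivable Uw.
Qed.

Lemma jet0 z : jet z (fun=> 0) = 0.
Proof. by apply/fpsP => n; rewrite jet_cst; case: eqP. Qed.

Lemma jet1 z : jet z (fun=> 1) = 1.
Proof. by apply/fpsP => n; rewrite jet_cst /=; case: eqP. Qed.

Lemma jetN U z F : open U -> U z -> hol U F -> jet z (fun w => - F w) = - jet z F.
Proof.
move=> oU Uz hF; apply/eqP; rewrite -addr_eq0; apply/eqP.
have hN : hol U (fun w => - F w).
  apply: hol_eq oU _ (holM oU (@hol_cst _ U (-1)) hF) => w _.
  by rewrite mulN1r.
rewrite -(jetD oU Uz hN hF) -[RHS](jet0 z).
by congr (jet z _); apply/funext => w; rewrite addNr.
Qed.

Lemma jet_sum U z (I : Type) (r : seq I) (F : I -> plane -> C) : open U -> U z ->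
  (forall i, hol U (F i)) ->
  jet z (fun w => \sum_(i <- r) F i w) = \sum_(i <- r) jet z (F i).
Proof.
move=> oU Uz hF; elim: r => [|i r IH].
  rewrite big_nil -[RHS](jet0 z); congr (jet z _).
  by apply/funext => w; rewrite big_nil.
rewrite big_cons -IH -(jetD oU Uz) => //; last exact: hol_sum.
by congr (jet z _); apply/funext => w; rewrite big_cons.
Qed.

Lemma jet_prod U z (I : Type) (r : seq I) (F : I -> plane -> C) : open U -> U z ->
  (forall i, hol U (F i)) ->
  jet z (fun w => \prod_(i <- r) F i w) = \prod_(i <- r) jet z (F i).
Proof.
move=> oU Uz hF; elim: r => [|i r IH].
  rewrite big_nil -[RHS](jet1 z); congr (jet z _).
  by apply/funext => w; rewrite big_nil.
rewrite big_cons -IH -(jetM oU Uz) => //; last exact: hol_prod.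
by congr (jet z _); apply/funext => w; rewrite big_cons.
Qed.

Lemma jet_signM U z (b : bool) F : open U -> U z -> hol U F ->
  jet z (fun w => (-1) ^+ b * F w) = (-1) ^+ b * jet z F.
Proof.
move=> oU Uz hF; case: b; rewrite ?expr1 ?expr0.
  rewrite mulN1r -(jetN oU Uz hF); congr (jet z _).
  by apply/funext => w; rewrite mulN1r.
by rewrite mul1r; congr (jet z _); apply/funext => w; rewrite mul1r.
Qed.

Lemma hol_signM U (b : bool) F : open U -> hol U F -> hol U (fun w => (-1) ^+ b * F w).
Proof. by move=> oU hF; exact: holM oU (@hol_cst _ U ((-1) ^+ b)) hF. Qed.

Lemma hol_det U k (F : plane -> 'M[C]_k) : open U ->
  (forall i j, hol U (fun w => F w i j)) -> hol U (fun w => \det (F w)).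
Proof.
move=> oU hF; apply: hol_sum => // s _; apply: hol_signM => //.
by apply: hol_prod => // i _; exact: hF.
Qed.

Lemma jet_det U z k (F : plane -> 'M[C]_k) : open U -> U z ->
  (forall i j, hol U (fun w => F w i j)) ->
  jet z (fun w => \det (F w)) = \det (\matrix_(i, j) jet z (fun w => F w i j)).
Proof.
move=> oU Uz hF; rewrite /determinant.
have hp (s : {perm 'I_k}) : hol U (fun w => \prod_i F w i (s i)).
  by apply: hol_prod => // i _; exact: hF.
rewrite (jet_sum _ oU Uz) => [|s]; last exact: hol_signM.
apply: eq_bigr => s _; rewrite (jet_signM _ oU Uz (hp s)); congr (_ * _).
rewrite (jet_prod _ oU Uz (fun i => hF i (s i))).
by apply: eq_bigr => i _; rewrite mxE.
Qed.

Definition jetm z m n (F : plane -> 'M[C]_(m, n)) : 'M[O]_(m, n) :=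
  \matrix_(i, j) jet z (fun w => F w i j).

Lemma jetm_dz z m n (F : plane -> 'M[C]_(m, n)) : jetm z (dz F) = derivfm (jetm z F).
Proof.
apply/matrixP => i j; rewrite !mxE -jet_wz; congr (jet z _).
by apply/funext => w; rewrite dzE.
Qed.

Lemma holomorphic_dz U m n (F : plane -> 'M[C]_(m, n)) : open U ->
  holomorphic_mx U F -> holomorphic_mx U (dz F).
Proof.
move=> oU /holomorphic_mxP hF; apply/holomorphic_mxP => i j.
by apply: hol_eq oU _ (hol_wz oU (hF i j)) => w _; rewrite dzE.
Qed.

Lemma holomorphic_iter_dz U n (h : plane -> 'rV[C]_n) k : open U ->
  holomorphic_mx U h -> holomorphic_mx U (iter k (@dz R 1 n) h).
Proof. by move=> oU hh; elim: k => [//|k IH] /=; exact: holomorphic_dz. Qed.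

Lemma jet_dotp U z n (F G : plane -> 'rV[C]_n) : open U -> U z ->
  holomorphic_mx U F -> holomorphic_mx U G ->
  hol U (fun w => dotp (F w) (G w)) /\
  jet z (fun w => dotp (F w) (G w)) = dotp (jetm z F) (jetm z G).
Proof.
move=> oU Uz /holomorphic_mxP hF /holomorphic_mxP hG.
have h a : hol U (fun w => F w 0 a * G w 0 a) by exact: holM.
split; first exact: hol_sum.
rewrite /dotp (jet_sum _ oU Uz h); apply: eq_bigr => a _.
by rewrite (jetM oU Uz) // !mxE.
Qed.

Lemma jet_natr z (b : bool) : jet z (fun=> b%:R) = b%:R.
Proof. by case: b; [exact: jet1|exact: jet0]. Qed.

Lemma jetm_xprod U z (F G : plane -> 'rV[C]_7) : open U -> U z ->
  holomorphic_mx U F -> holomorphic_mx U G ->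
  jetm z (fun w => xprod (F w) (G w)) = xprod (jetm z F) (jetm z G).
Proof.
move=> oU Uz /holomorphic_mxP hF /holomorphic_mxP hG.
apply/rowP => c; rewrite !mxE.
have hc a b : hol U (fun=> xcoef C a b c) by exact: hol_cst.
have h a b : hol U (fun w => xcoef C a b c * F w 0 a * G w 0 b).
  by apply: holM => //; exact: holM.
have -> : (fun w => xprod (F w) (G w) 0 c) =
    (fun w => \sum_a \sum_b xcoef C a b c * F w 0 a * G w 0 b).
  by apply/funext => w; rewrite mxE.
rewrite (jet_sum _ oU Uz) => [|a]; last by apply: hol_sum => // b _; exact: h.
apply: eq_bigr => a _; rewrite (jet_sum _ oU Uz) => [|b]; last exact: h.
apply: eq_bigr => b _; rewrite (jetM oU Uz (holM oU (hc a b) (hF 0 a)) (hG 0 b)).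
rewrite (jetM oU Uz (hc a b) (hF 0 a)) !mxE; congr (_ * _ * _).
have hN (x : bool) : hol U (fun=> x%:R : C) by exact: hol_cst.
have hNN (x : bool) : hol U (fun=> - x%:R : C) by exact: hol_cst.
rewrite /xcoef (jetD oU Uz (hN _) (hNN _)) (jetN oU Uz (hN _)).
by rewrite !jet_natr.
Qed.

Lemma jet_osculating U z n (h : plane -> 'rV[C]_n) j a : open U -> U z ->
  holomorphic_mx U h ->
  hol U (fun w => osculating_vector h j w 0 a) /\
  jet z (fun w => osculating_vector h j w 0 a) =
  gwedge (fun i : 'I_j.+1 => jetm z (iter i (@dz R 1 n) h)) 0 a.
Proof.
move=> oU Uz hh.
have -> : (fun w => osculating_vector h j w 0 a) =
    (fun w => \det (\matrix_(i < j.+1, l < j.+1)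
       iter i (@dz R 1 n) h w 0 (tnth (enum_val a) l))).
  by apply/funext => w; rewrite mxE.
have hE (i l : 'I_j.+1) : hol U (fun w => (\matrix_(i < j.+1, l < j.+1)
       iter i (@dz R 1 n) h w 0 (tnth (enum_val a) l)) i l).
  have /holomorphic_mxP/(_ 0 (tnth (enum_val a) l)) := holomorphic_iter_dz i oU hh.
  by apply: hol_eq oU _ => w _; rewrite mxE.
split; first exact: hol_det.
rewrite (jet_det oU Uz hE) mxE; congr (\det _); apply/matrixP => i l.
by rewrite !mxE; congr (jet z _); apply/funext => w; rewrite mxE.
Qed.

(** A zero Taylor series means flatness at [z], so [hol_flat_eq0] applies. *)
Lemma jet_eq0 U z F : open U -> U z -> hol U F -> jet z F = 0 ->
  \forall w \near z, F w = 0.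
Proof.
move=> oU Uz hF /fpsP j0.
have [n|e e0 he] := hol_flat_eq0 oU Uz hF.
  have := j0 n => /= /eqP; rewrite mulf_eq0 invr_eq0 pnatr_eq0 -leqn0 leqNgt.
  by rewrite fact_gt0 orbF => /eqP.
apply/nbhs_box; exists e => // w /boxE; exact: he.
Qed.
End Jets.

(** * The harmonic sequence away from isolated points *)

Section RowCalculus.
Variables (R : realType) (n : nat).
Local Notation C := R[i].
Local Notation plane := (R * R)%type.
Implicit Types (s t : plane -> 'rV[C]_n) (a : plane -> C) (z w : plane)
  (U : set plane).

Definition rderivable s z := forall l, pderivable (fun w => s w 0 l) z.

Lemma smooth_rderivable U s z : smooth_mx U s -> U z -> rderivable s z.
Proof. by move=> ss Uz l; exact: smoothC_pderivable (ss 0 l) Uz. Qed.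

Lemma pderivable_sum (I : Type) (r : seq I) (F : I -> plane -> C) z :
  (forall i, pderivable (F i) z) -> pderivable (fun w => \sum_(i <- r) F i w) z.
Proof.
move=> hF; have -> : (fun w => \sum_(i <- r) F i w) = \sum_(i <- r) F i.
  by apply/funext => w; rewrite fct_sumE.
elim/big_ind: _ => [|f g hf hg|//]; first exact: pderivable_cst.
exact: pderivableD.
Qed.

Lemma wz_sum (I : Type) (r : seq I) (F : I -> plane -> C) z :
  (forall i, pderivable (F i) z) ->
  wz (fun w => \sum_(i <- r) F i w) z = \sum_(i <- r) wz (F i) z.
Proof.
move=> hF; elim: r => [|i r IH].
  rewrite big_nil -[RHS](wz_cst (0 : C) z); congr (wz _ z).
  by apply/funext => w; rewrite big_nil.
rewrite big_cons -IH -wzD//; last exact: pderivable_sum.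
by congr (wz _ z); apply/funext => w; rewrite big_cons.
Qed.

Lemma wzb_sum (I : Type) (r : seq I) (F : I -> plane -> C) z :
  (forall i, pderivable (F i) z) ->
  wzb (fun w => \sum_(i <- r) F i w) z = \sum_(i <- r) wzb (F i) z.
Proof.
move=> hF; elim: r => [|i r IH].
  rewrite big_nil -[RHS](wzb_cst (0 : C) z); congr (wzb _ z).
  by apply/funext => w; rewrite big_nil.
rewrite big_cons -IH -wzbD//; last exact: pderivable_sum.
by congr (wzb _ z); apply/funext => w; rewrite big_cons.
Qed.

Lemma dz_lincomb (m : nat) (a : 'I_m -> plane -> C)
    (t : 'I_m -> plane -> 'rV[C]_n) z :
  (forall k, pderivable (a k) z) -> (forall k, rderivable (t k) z) ->
  dz (fun w => \sum_k a k w *: t k w) z =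
  \sum_k (wz (a k) z *: t k z + a k z *: dz (t k) z).
Proof.
move=> ha ht; apply/rowP => l; rewrite dzE summxE.
have -> : (fun w => (\sum_k a k w *: t k w) 0 l) = (fun w => \sum_k a k w * t k w 0 l).
  by apply/funext => w; rewrite summxE; apply: eq_bigr => k _; rewrite mxE.
rewrite wz_sum => [|k]; last exact: pderivableM (ha k) (ht k l).
by apply: eq_bigr => k _; rewrite (wzM (ha k) (ht k l)) 3!mxE dzE.
Qed.

Lemma dzbar_lincomb (m : nat) (a : 'I_m -> plane -> C)
    (t : 'I_m -> plane -> 'rV[C]_n) z :
  (forall k, pderivable (a k) z) -> (forall k, rderivable (t k) z) ->
  dzbar (fun w => \sum_k a k w *: t k w) z =
  \sum_k (wzb (a k) z *: t k z + a k z *: dzbar (t k) z).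
Proof.
move=> ha ht; apply/rowP => l; rewrite dzbarE summxE.
have -> : (fun w => (\sum_k a k w *: t k w) 0 l) = (fun w => \sum_k a k w * t k w 0 l).
  by apply/funext => w; rewrite summxE; apply: eq_bigr => k _; rewrite mxE.
rewrite wzb_sum => [|k]; last exact: pderivableM (ha k) (ht k l).
by apply: eq_bigr => k _; rewrite (wzbM (ha k) (ht k l)) 3!mxE dzbarE.
Qed.

Lemma near_dz s t z : {near z, s =1 t} -> dz s z = dz t z.
Proof.
move=> st; apply/rowP => l; rewrite !dzE; apply: near_wz.
by apply: filterS st => w ->.
Qed.

Lemma near_dzbar s t z : {near z, s =1 t} -> dzbar s z = dzbar t z.
Proof.
move=> st; apply/rowP => l; rewrite !dzbarE; apply: near_wzb.
by apply: filterS st => w ->.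
Qed.

Lemma pderivable_herm s t z : rderivable s z -> rderivable t z ->
  pderivable (fun w => herm (s w) (t w)) z.
Proof.
move=> hs ht; apply: pderivable_sum => l.
by apply: pderivableM; [exact: hs|apply: pderivableJ; exact: ht].
Qed.

Lemma wz_herm s t z : rderivable s z -> rderivable t z ->
  wz (fun w => herm (s w) (t w)) z = herm (dz s z) (t z) + herm (s z) (dzbar t z).
Proof.
move=> hs ht; rewrite wz_sum => [|l]; last first.
  by apply: pderivableM; [exact: hs|apply: pderivableJ; exact: ht].
rewrite -big_split; apply: eq_bigr => l _.
by rewrite (wzM (hs l) (pderivableJ (ht l))) (wzJ (ht l)) dzE dzbarE.
Qed.

Lemma wzb_herm s t z : rderivable s z -> rderivable t z ->
  wzb (fun w => herm (s w) (t w)) z = herm (dzbar s z) (t z) + herm (s z) (dz t z).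
Proof.
move=> hs ht; rewrite wzb_sum => [|l]; last first.
  by apply: pderivableM; [exact: hs|apply: pderivableJ; exact: ht].
rewrite -big_split; apply: eq_bigr => l _.
by rewrite (wzbM (hs l) (pderivableJ (ht l))) (wzbJ (ht l)) dzE dzbarE.
Qed.

Lemma wzb_dotp s t z : rderivable s z -> rderivable t z ->
  wzb (fun w => dotp (s w) (t w)) z = dotp (dzbar s z) (t z) + dotp (s z) (dzbar t z).
Proof.
move=> hs ht; rewrite wzb_sum => [|l]; last exact: pderivableM (hs l) (ht l).
rewrite -big_split; apply: eq_bigr => l _.
by rewrite (wzbM (hs l) (ht l)) !dzbarE.
Qed.

Implicit Types u v : 'rV[C]_n.

Lemma hermDl u v x : herm (u + v) x = herm u x + herm v x.
Proof. by rewrite -big_split; apply: eq_bigr => a _; rewrite mxE mulrDl. Qed.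

Lemma hermZl (c : C) u x : herm (c *: u) x = c * herm u x.
Proof. by rewrite mulr_sumr; apply: eq_bigr => a _; rewrite mxE mulrA. Qed.

Lemma hermC u v : herm u v = (herm v u)^*.
Proof.
rewrite rmorph_sum; apply: eq_bigr => a _.
by rewrite rmorphM /= conjCK mulrC.
Qed.

Lemma hermDr u v x : herm x (u + v) = herm x u + herm x v.
Proof. by rewrite hermC hermDl rmorphD /= -!hermC. Qed.

Lemma hermZr (c : C) u x : herm x (c *: u) = c^* * herm x u.
Proof. by rewrite hermC hermZl rmorphM /= -hermC. Qed.

Lemma herm0l u : herm 0 u = 0.
Proof. by have := hermZl 0 0 u; rewrite scale0r mul0r. Qed.

Lemma herm_sym0 u v : herm u v = 0 -> herm v u = 0.
Proof. by move=> h; rewrite hermC h rmorph0. Qed.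

Lemma herm_eq0 u : (herm u u == 0) = (u == 0).
Proof.
apply/eqP/eqP => [|->]; last exact: herm0l.
move=> /eqP; rewrite psumr_eq0 => [/allP h|a _]; last exact: mul_conjC_ge0.
apply/rowP => a; rewrite mxE; have := h a (mem_index_enum a).
by rewrite mul_conjC_eq0 => /eqP.
Qed.

Lemma row_neq0 u : u != 0 -> exists l, u 0 l != 0.
Proof.
move=> u0; apply: contrapT => h; case: (elimN eqP u0); apply/rowP => l.
by rewrite [RHS]mxE; apply: contrapT => /eqP ul; case: h; exists l.
Qed.

End RowCalculus.

(** * The harmonic sequence as orthogonalisation of the derivatives of the directrix *)

Section OrthogonalFrame.
Variables (R : realType) (n M : nat).
Local Notation C := R[i].
Local Notation plane := (R * R)%type.
Variables (U : set plane) (t : nat -> plane -> 'rV[C]_n).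
Hypothesis oU : open U.
Hypothesis ht : holomorphic_mx U (t 0%N).
Hypothesis st : forall k, (k <= M)%N -> smooth_mx U (t k).
Hypothesis tn0 : forall k w, (k <= M)%N -> U w -> t k w != 0.
Hypothesis tstep : forall k w, (k < M)%N -> U w ->
  herm (t k.+1 w) (t k w) = 0 /\
  exists b b', b != 0 /\ dz (t k) w = b *: t k.+1 w + b' *: t k w.

Definition tspan i w : {vspace 'rV[C]_n} := (\sum_(k < i) <[t k w]>)%VS.

Let H i := iter i (@dz R 1 n) (t 0%N).

Lemma mem_tspan k i w : (k < i)%N -> t k w \in tspan i w.
Proof.
by move=> ki; apply: (subvP (sumv_sup (Ordinal ki) _ (subvv _))); rewrite ?memv_line.
Qed.

Lemma tspanS i w x : x \in tspan i w -> x \in tspan i.+1 w.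
Proof.
by apply/subvP/subv_sumP => k _; rewrite -memvE mem_tspan// ltnS ltnW.
Qed.

Lemma tspan_le i j w x : (i <= j)%N -> x \in tspan i w -> x \in tspan j w.
Proof.
move=> ij; apply/subvP/subv_sumP => k _; rewrite -memvE mem_tspan//.
exact: leq_trans ij.
Qed.

Lemma tspanP i w x : x \in tspan i w -> exists c : 'I_i -> C, x = \sum_k c k *: t k w.
Proof.
case/memv_sumP => vs hvs ->.
have h (k : 'I_i) : exists c, vs k = c *: t k w by apply/vlineP/hvs.
by have [c hc] := choice h; exists c; apply: eq_bigr => k _.
Qed.

Lemma herm_suml m (F : 'I_m -> 'rV[C]_n) y :
  herm (\sum_k F k) y = \sum_k herm (F k) y.
Proof. by elim/big_rec2: _ => [|i x z _ <-]; rewrite ?herm0l ?hermDl. Qed.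

Lemma tspan_orth i w x y : (forall k, (k < i)%N -> herm (t k w) y = 0) ->
  x \in tspan i w -> herm x y = 0.
Proof.
move=> h /tspanP[c ->]; rewrite herm_suml big1// => k _.
by rewrite hermZl h ?mulr0.
Qed.

Lemma tspan_expand i w x : (forall k, (k < i)%N -> t k w != 0) ->
  (forall j k, (j < k < i)%N -> herm (t k w) (t j w) = 0) ->
  x \in tspan i w ->
  x = \sum_(k < i) (herm x (t k w) / herm (t k w) (t k w)) *: t k w.
Proof.
move=> t0 o /tspanP[c xE]; rewrite {1}xE; apply: eq_bigr => k _.
congr (_ *: _); rewrite xE herm_suml (bigD1 k) //= big1 => [|j jk].
  by rewrite addr0 hermZl mulfK// herm_eq0 t0.
rewrite hermZl; have := jk; rewrite -val_eqE neq_ltn => /orP[jlt|klt].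
  by rewrite (herm_sym0 (o _ _ _)) ?mulr0// jlt /=.
by rewrite o ?mulr0// klt /=.
Qed.

Lemma holomorphic_H i : holomorphic_mx U (H i).
Proof. exact: holomorphic_iter_dz. Qed.

Lemma t_rderivable k w : (k <= M)%N -> U w -> rderivable (t k) w.
Proof. by move=> /st; exact: smooth_rderivable. Qed.

Lemma H_rderivable k w : U w -> rderivable (H k) w.
Proof. by have [h _] := holomorphic_H k; exact: smooth_rderivable. Qed.

Lemma dzbar_H k w : U w -> dzbar (H k) w = 0.
Proof. by have [_ h] := holomorphic_H k; exact: h. Qed.

(** Up to scalars the t_i are the Gram-Schmidt vectors of h, h', h'', .... The properties are stated
    on all of [U] because each inductive step differentiates them. *)
Definition frame_prop i : Prop := forall w, U w ->
  [/\ forall k, (k < i)%N -> herm (t i w) (t k w) = 0,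
      exists2 c, c != 0 & H i w - c *: t i w \in tspan i w &
      dzbar (t i) w \in tspan i.+1 w].

Section Step.
Variable i : nat.
Hypothesis iM : (i <= M)%N.
Hypothesis orth : forall w, U w -> forall j k, (j < k <= i)%N -> herm (t k w) (t j w) = 0.
Hypothesis Hi : forall w, U w -> exists2 c, c != 0 & H i w - c *: t i w \in tspan i w.

(** Membership in a span gives coefficients only point by point; these explicit quotients can be
    differentiated. *)
Let a (k : 'I_i.+1) w := herm (H i w) (t k w) / herm (t k w) (t k w).

Lemma a_pderivable w k : U w -> pderivable (a k) w.
Proof.
move=> Uw; have kM : (k <= M)%N by rewrite (leq_trans _ iM)// -ltnS.
have tr := t_rderivable kM Uw.
apply: pderivableM; first exact: pderivable_herm (H_rderivable _ Uw) tr.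
by apply: pderivableV; [rewrite herm_eq0 tn0|exact: pderivable_herm].
Qed.

Lemma H_expand w : U w -> H i w = \sum_k a k w *: t k w.
Proof.
move=> Uw; have [c c0 hc] := Hi Uw; apply: tspan_expand.
- by move=> k ki; apply: tn0 => //; rewrite (leq_trans _ iM)// -ltnS.
- by move=> j k; rewrite ltnS; exact: orth.
- rewrite -[H i w](subrK (c *: t i w)); apply: memvD; first exact: tspanS.
  by apply: memvZ; exact: mem_tspan.
Qed.

Lemma a_neq0 w : U w -> a ord_max w != 0.
Proof.
move=> Uw; have [c c0 hc] := Hi Uw; rewrite /a /=.
have -> : herm (H i w) (t i w) = c * herm (t i w) (t i w).
  rewrite -[H i w](subrK (c *: t i w)) hermDl hermZl (tspan_orth _ hc) ?add0r//.
  by move=> k ki; apply/herm_sym0/orth => //; rewrite ki /=.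
by rewrite mulfK ?herm_eq0 ?tn0.
Qed.

Lemma near_H_expand w : U w -> {near w, H i =1 fun u => \sum_k a k u *: t k u}.
Proof. by move=> Uw; apply: open_near_eq oU Uw _ => u /set_mem; exact: H_expand. Qed.

Lemma ti_rderivable w (k : 'I_i.+1) : U w -> rderivable (t k) w.
Proof. by move=> Uw; apply: t_rderivable => //; rewrite (leq_trans _ iM)// -ltnS. Qed.

(** [H i] is holomorphic: the zbar-derivative of its expansion is zero and can be solved for that of
    t_i, whose coefficient is nonzero. *)
Lemma frame_dzbar w : U w ->
  (forall k, (k < i)%N -> dzbar (t k) w \in tspan k.+1 w) ->
  dzbar (t i) w \in tspan i.+1 w.
Proof.
move=> Uw hk; have := dzbar_H i Uw; rewrite (near_dzbar (near_H_expand Uw)).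
rewrite dzbar_lincomb; [|by move=> k; exact: a_pderivable|by move=> k; exact: ti_rderivable].
rewrite big_ord_recr /= addrA => /eqP; rewrite addrC addr_eq0 => /eqP e.
have -> : dzbar (t i) w = (a ord_max w)^-1 *: (a ord_max w *: dzbar (t i) w).
  by rewrite scalerA mulVf ?scale1r// a_neq0.
rewrite e; apply: memvZ; rewrite memvN; apply: memvD.
  apply: memv_suml => k _; apply: memvD; apply: memvZ; last first.
    by apply: (@tspan_le k.+1); [rewrite ltnS ltnW|exact: hk].
  by apply: mem_tspan; rewrite ltnS ltnW.
by apply: memvZ; exact: mem_tspan.
Qed.

(** Under d/dz of the expansion of [H i], only the last term reaches t_(i+1), with a nonzero
    factor. *)
Lemma frame_H_next w : (i < M)%N -> U w ->
  exists2 c, c != 0 & H i.+1 w - c *: t i.+1 w \in tspan i.+1 w.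
Proof.
move=> im Uw; have [_ [b [b' [b0 tE]]]] := tstep im Uw.
exists (a ord_max w * b); first by rewrite mulf_neq0// a_neq0.
have -> : H i.+1 w = dz (H i) w by [].
rewrite (near_dz (near_H_expand Uw)) dz_lincomb;
  [|by move=> k; exact: a_pderivable|by move=> k; exact: ti_rderivable].
rewrite big_ord_recr /= tE scalerDr !scalerA.
set A := \sum_(k < i) _.
have -> : A + (wz (a ord_max) w *: t i w + (a ord_max w * b *: t i.+1 w +
    (a ord_max w * b') *: t i w)) - (a ord_max w * b) *: t i.+1 w =
    A + (wz (a ord_max) w *: t i w + (a ord_max w * b') *: t i w).
  by apply/rowP => l; rewrite !mxE; ring.
apply: memvD; last by apply: memvD; apply: memvZ; exact: mem_tspan.
apply: memv_suml => k _; have kM : (k < M)%N by rewrite (ltn_trans _ im).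
have [_ [c [c' [_ ->]]]] := tstep kM Uw.
apply: memvD; first by apply: memvZ; apply: mem_tspan; rewrite ltnS ltnW.
apply: memvZ; apply: memvD; apply: memvZ; apply: mem_tspan; first by rewrite ltnS.
by rewrite ltnS ltnW.
Qed.

(** Apply d/dz to (t_i, t_k) = 0 for k < i. The zbar-derivative of t_k lies in the span of t_0, ...,
    t_k, orthogonal to t_i, so the z-derivative of t_i is orthogonal to t_k. *)
Lemma frame_orth_next w : (i < M)%N -> U w ->
  (forall k, (k < i)%N -> dzbar (t k) w \in tspan k.+1 w) ->
  forall k, (k < i.+1)%N -> herm (t i.+1 w) (t k w) = 0.
Proof.
move=> im Uw hk k; rewrite ltnS leq_eqVlt => /predU1P[->|ki].
  by have [] := tstep im Uw.
have [_ [b [b' [b0 tE]]]] := tstep im Uw.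
have kM : (k <= M)%N by rewrite (leq_trans (ltnW ki)).
have ik : {near w, (fun u => herm (t i u) (t k u)) =1 fun=> 0}.
  by apply: open_near_eq oU Uw _ => u /set_mem Uu; apply: orth; rewrite ?ki ?leqnn.
have := near_wz ik; rewrite wz_cst wz_herm; [|exact: t_rderivable..].
have o : herm (t i w) (t k w) = 0 by apply: orth; rewrite ?ki ?leqnn.
rewrite tE hermDl !hermZl o mulr0 addr0.
rewrite (herm_sym0 (tspan_orth _ (hk k ki))) => [|l]; last first.
  rewrite ltnS => lk; apply/herm_sym0/orth => //.
  by rewrite (leq_ltn_trans lk ki) leqnn.
by rewrite addr0 => /eqP; rewrite mulf_eq0 (negbTE b0) => /eqP.
Qed.
End Step.

Lemma frame_propP i : (i <= M)%N -> frame_prop i.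
Proof.
have [m] := ubnP i; elim: m i => // m IH i; rewrite ltnS => im iM w Uw.
have IHk k u : U u -> (k < i)%N -> [/\ forall j, (j < k)%N -> herm (t k u) (t j u) = 0,
      exists2 c, c != 0 & H k u - c *: t k u \in tspan k u &
      dzbar (t k) u \in tspan k.+1 u].
  by move=> Uu ki; apply: IH => //; rewrite ?(leq_trans ki)// ltnW// (leq_trans ki).
have orth_lt u : U u -> forall j k, (j < k < i)%N -> herm (t k u) (t j u) = 0.
  by move=> Uu j k /andP[jk ki]; have [ho _ _] := IHk k u Uu ki; exact: ho.
have dzb k u : U u -> (k < i)%N -> dzbar (t k) u \in tspan k.+1 u.
  by move=> Uu ki; have [] := IHk k u Uu ki.
have orth_i u : U u -> forall k, (k < i)%N -> herm (t i u) (t k u) = 0.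
  move=> Uu; case: i im iM IHk orth_lt dzb => [//|i] im iM IHk orth_lt dzb.
  apply: (@frame_orth_next i (ltnW iM) _ u iM Uu) => [w' Uw' j k|k ki].
  - by rewrite -ltnS; exact: orth_lt.
  - by apply: dzb => //; exact: ltnW.
have Hi u : U u -> exists2 c, c != 0 & H i u - c *: t i u \in tspan i u.
  move=> Uu; case: i im iM IHk orth_lt dzb orth_i => [|i] im iM IHk orth_lt dzb orth_i.
    by exists 1; rewrite ?oner_eq0// scale1r subrr mem0v.
  apply: (@frame_H_next i (ltnW iM) _ _ u iM Uu) => [w' Uw' j k|w' Uw'].
    by rewrite -ltnS; exact: orth_lt.
  by have [] := IHk i w' Uw' (ltnSn i).
split; [exact: orth_i|exact: Hi|].
apply: frame_dzbar => // [u Uu j k /andP[jk]|k ki]; last exact: dzb.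
rewrite leq_eqVlt => /predU1P[ki|ki]; first by rewrite ki in jk *; exact: orth_i.
by apply: orth_lt => //; rewrite jk.
Qed.
End OrthogonalFrame.

(** * Eigenvectors of the cross product with a real unit vector *)

Section AlmostComplexFrame.
Variable R : realType.
Local Notation C := R[i].
Local Notation plane := (R * R)%type.
Implicit Types (x y : 'rV[C]_7).

Definition cj x : 'rV[C]_7 := map_mx Num.conj x.

Lemma cjK x : cj (cj x) = x.
Proof. by apply/rowP => a; rewrite !mxE conjCK. Qed.

Lemma herm_dotp x y : herm x y = dotp x (cj y).
Proof. by apply: eq_bigr => a _; rewrite mxE. Qed.

Lemma dotp_herm x y : dotp x y = herm x (cj y).
Proof. by rewrite herm_dotp cjK. Qed.

Lemma xcoef_conj a b c : (xcoef C a b c)^* = xcoef C a b c.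
Proof. by rewrite /xcoef rmorphB /= !rmorph_nat. Qed.

Lemma cj_xprod x y : cj (xprod x y) = xprod (cj x) (cj y).
Proof.
apply/rowP => c; rewrite !mxE rmorph_sum; apply: eq_bigr => a _ /=.
rewrite rmorph_sum; apply: eq_bigr => b _ /=.
by rewrite !rmorphM /= xcoef_conj !mxE.
Qed.

Lemma cjZ (k : C) x : cj (k *: x) = k^* *: cj x.
Proof. by apply/rowP => a; rewrite !mxE rmorphM. Qed.

Lemma herm_cj x y : herm (cj x) (cj y) = (herm x y)^*.
Proof.
by rewrite rmorph_sum; apply: eq_bigr => a _; rewrite !mxE rmorphM.
Qed.

Lemma cj_eq0 x : (cj x == 0) = (x == 0).
Proof.
apply/eqP/eqP => [h|->]; last by apply/rowP => a; rewrite !mxE rmorph0.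
by rewrite -(cjK x) h; apply/rowP => a; rewrite !mxE rmorph0.
Qed.

Lemma dzbar_xprod (s t : plane -> 'rV[C]_7) z : rderivable s z -> rderivable t z ->
  dzbar (fun w => xprod (s w) (t w)) z =
  xprod (dzbar s z) (t z) + xprod (s z) (dzbar t z).
Proof.
move=> hs ht; apply/rowP => c; rewrite dzbarE !mxE.
have -> : (fun w => xprod (s w) (t w) 0 c) =
    (fun w => \sum_a \sum_b xcoef C a b c * s w 0 a * t w 0 b).
  by apply/funext => w; rewrite mxE.
have h1 a b : pderivable (fun w => xcoef C a b c * s w 0 a) z.
  exact: pderivableM (@pderivable_cst _ (xcoef C a b c) z) (hs a).
have h2 a b : pderivable (fun w => xcoef C a b c * s w 0 a * t w 0 b) z.
  exact: pderivableM (h1 a b) (ht b).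
rewrite wzb_sum => [|a]; last by apply: pderivable_sum => b; exact: h2.
rewrite -big_split; apply: eq_bigr => a _ /=.
rewrite wzb_sum => [|b]; last exact: h2.
rewrite -big_split; apply: eq_bigr => b _ /=.
rewrite (wzbM (h1 a b) (ht b)) (wzbM (@pderivable_cst _ (xcoef C a b c) z) (hs a)).
by rewrite wzb_cst mul0r add0r !dzbarE.
Qed.

Lemma orthogonal_full (e : nat -> 'rV[C]_7) y : (forall i, (i < 7)%N -> e i != 0) ->
  (forall i j, (i < j < 7)%N -> herm (e i) (e j) = 0) ->
  (forall i, (i < 7)%N -> herm y (e i) = 0) -> y = 0.
Proof.
move=> e0 eo ye.
pose E : 'M[C]_7 := \matrix_(i < 7) e i.
pose Es : 'M[C]_7 := \matrix_(a, i) (e i 0 a)^*.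
have dE : \det (E *m Es) != 0.
  have EE i j : (E *m Es) i j = herm (e i) (e j).
    by rewrite mxE; apply: eq_bigr => a _; rewrite !mxE.
  rewrite det_trig; last by apply/is_trig_mxP => i j ij; rewrite EE eo ?ij /=.
  by apply/prodf_neq0 => i _; rewrite EE herm_eq0 e0.
have uEs : Es \in unitmx.
  by rewrite unitmxE unitfE; apply: contraNneq dE => d0; rewrite det_mulmx d0 mulr0.
have : y *m Es = 0.
  apply/rowP => i; rewrite !mxE -[RHS](ye i)//.
  by apply: eq_bigr => a _; rewrite mxE.
by move=> /(congr1 (mulmxr (invmx Es))) /=; rewrite mulmxK// mul0mx.
Qed.

Section Pointwise.
Variable F : 'rV[C]_7.
Hypothesis F_real : cj F = F.
Hypothesis F_unit : dotp F F = 1.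

Lemma xF_xF x : dotp F x = 0 -> xprod F (xprod F x) = - x.
Proof. by move=> h; rewrite xprod_xprod h F_unit scale0r scale1r sub0r. Qed.

Lemma xF_skew x y : dotp (xprod F x) y = - dotp x (xprod F y).
Proof.
rewrite xprod_cycle [dotp x _]dotpC (xprod_cycle F y x) [xprod y x]xprodC.
by rewrite -[- xprod x y]scaleN1r dotpZl mulN1r opprK.
Qed.

Lemma xF_hskew x y : herm (xprod F x) y = - herm x (xprod F y).
Proof. by rewrite !herm_dotp cj_xprod F_real xF_skew. Qed.

Lemma dotp_F_xF x : dotp F (xprod F x) = 0.
Proof. by rewrite dotpC xprod_cycle xprod_cycle xprodvv dotp0l. Qed.

Lemma eigen_dotp_F (k : C) x : k != 0 -> xprod F x = k *: x -> dotp F x = 0.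
Proof.
move=> k0 e; have := dotp_F_xF x; rewrite e dotpZr => /eqP.
by rewrite mulf_eq0 (negbTE k0) => /eqP.
Qed.

Lemma i_neq0 : 'i != 0 :> C. Proof. exact: neq0Ci. Qed.

Lemma xF_cj x : xprod F x = - 'i *: x -> xprod F (cj x) = 'i *: cj x.
Proof.
move=> e; rewrite -{1}F_real -cj_xprod e cjZ rmorphN /= conjCi opprK //.
Qed.

(** Multiplication by the real vector [F] is skew-Hermitian, so different eigenvalues have
    orthogonal eigenvectors. *)
Lemma eigen_orth x y : xprod F x = - 'i *: x -> xprod F y = 'i *: y -> herm x y = 0.
Proof.
move=> ex ey; have := xF_hskew x y; rewrite ex ey hermZl hermZr conjCi.
move/eqP; rewrite -subr_eq0 opprK -mulr2n mulrn_eq0 /= mulf_eq0 oppr_eq0.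
by rewrite (negbTE i_neq0) => /eqP.
Qed.

(** The polarised identity, applied with [x] and with [y], makes the product an eigenvector for both
    i and -i. *)
Lemma eigen_xprod x y : xprod F x = 'i *: x -> xprod F y = - 'i *: y ->
  dotp x y = 0 -> xprod x y = 0.
Proof.
move=> ex ey xy.
have Fx : dotp F x = 0 by exact: eigen_dotp_F i_neq0 ex.
have Fy : dotp F y = 0 by apply: eigen_dotp_F ey; rewrite oppr_eq0 i_neq0.
have := xprod_polar F x y; have := xprod_polar F y x.
rewrite ex ey Fx Fy xy [dotp y x]dotpC xy !scale0r !addr0 mul0rn !scale0r subr0.
rewrite !xprodZr [xprod y x]xprodC.
set n := xprod x y; have -> : xprod F (- n) = - xprod F n.
  by rewrite -scaleN1r xprodZr scaleN1r.
move=> h1 h2.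
have hX : xprod F n = 'i *: n by apply/eqP; rewrite -subr_eq0 -scaleNr h2.
move: h1; rewrite hX scalerN -opprD -scalerDl => /eqP.
by rewrite oppr_eq0 scaler_eq0 -mulr2n mulrn_eq0 /= (negbTE i_neq0) => /eqP.
Qed.

(* If u := F x h - i h is not 0, then F, t1, t2, u and the conjugates of t1, t2, u
   form an orthogonal basis, and F x h + i h is orthogonal to all of them. *)
Lemma eigen_split t1 t2 h : t1 != 0 -> t2 != 0 ->
  xprod F t1 = - 'i *: t1 -> xprod F t2 = - 'i *: t2 -> herm t1 t2 = 0 ->
  dotp F h = 0 -> herm h t1 = 0 -> herm h t2 = 0 ->
  dotp h t1 = 0 -> dotp h t2 = 0 -> dotp h h = 0 ->
  xprod F h - 'i *: h = 0 \/ xprod F h + 'i *: h = 0.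
Proof.
move=> t10 t20 e1 e2 t12 Fh ht1 ht2 hd1 hd2 hh.
pose u := xprod F h - 'i *: h; pose p := xprod F h + 'i *: h.
have i2 : 'i * 'i = -1 :> C by rewrite -expr2 sqrCi.
have eu : xprod F u = - 'i *: u.
  rewrite /u xprodDr -scaleNr xprodZr (xF_xF Fh) scalerDr scalerA.
  by rewrite mulrNN i2 scaleN1r addrC.
have ep : xprod F p = 'i *: p.
  by rewrite /p xprodDr xprodZr (xF_xF Fh) scalerDr scalerA i2 scaleN1r addrC.
have [u0|u0] := eqVneq u 0; [by left|right].
have ut1 : herm u t1 = 0.
  by rewrite /u -scaleNr hermDl hermZl xF_hskew e1 hermZr ht1 !mulr0 oppr0 addr0.
have ut2 : herm u t2 = 0.
  by rewrite /u -scaleNr hermDl hermZl xF_hskew e2 hermZr ht2 !mulr0 oppr0 addr0.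
have pt x : xprod F x = - 'i *: x -> dotp h x = 0 -> herm p (cj x) = 0.
  move=> ex hx; rewrite -dotp_herm /p dotpDl dotpZl xF_skew ex dotpZr hx.
  by rewrite !mulr0 oppr0 addr0.
have pcu : herm p (cj u) = 0.
  rewrite -dotp_herm /p /u -scaleNr !(dotpDl, dotpDr) !(dotpZl, dotpZr) xF_skew.
  rewrite (xF_xF Fh) -[- h]scaleN1r dotpZr [dotp (xprod F h) h]dotpC hh.
  by ring.
have Fm x : xprod F x = - 'i *: x -> herm F x = 0 /\ herm F (cj x) = 0.
  move=> ex; have Fx : dotp F x = 0.
    by apply: eigen_dotp_F ex; rewrite oppr_eq0 i_neq0.
  split; last by rewrite -dotp_herm.
  by apply: herm_sym0; rewrite herm_dotp F_real dotpC.
have F0 : F != 0.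
  by apply: contraTneq isT => F0; move/eqP: F_unit; rewrite F0 dotp0l eq_sym oner_eq0.
have cc x y : herm x y = 0 -> herm (cj x) (cj y) = 0.
  by move=> xy; rewrite herm_cj xy rmorph0.
have mp x y : xprod F x = - 'i *: x -> xprod F y = - 'i *: y -> herm x (cj y) = 0.
  by move=> ex ey; apply: eigen_orth ex (xF_cj ey).
pose e := nth 0 [:: F; t1; t2; u; cj t1; cj t2; cj u].
apply: (@orthogonal_full e) => [i|i j|i].
- by case: i => [|[|[|[|[|[|[|i]]]]]]] //=; rewrite ?cj_eq0.
- have t1u := herm_sym0 ut1; have t2u := herm_sym0 ut2.
  have [F1 F1'] := Fm _ e1; have [F2 F2'] := Fm _ e2; have [F3 F3'] := Fm _ eu.
  have := cc _ _ t12; have := cc _ _ t1u; have := cc _ _ t2u => c2 c1 c12.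
  by case: i => [|[|[|[|[|[|[|i]]]]]]]; case: j => [|[|[|[|[|[|[|j]]]]]]] //= ij;
    first [exact: mp|by rewrite ?andbF in ij].
- case: i => [|[|[|[|[|[|[|i]]]]]]] //= _.
  + by rewrite herm_dotp F_real dotpC; exact: eigen_dotp_F i_neq0 ep.
  + by apply/herm_sym0; exact: eigen_orth e1 ep.
  + by apply/herm_sym0; exact: eigen_orth e2 ep.
  + by apply/herm_sym0; exact: eigen_orth eu ep.
  + exact: pt.
  + exact: pt.
Qed.
End Pointwise.
End AlmostComplexFrame.

Lemma dotp_sqrD (A : comNzRingType) n (c : A) (x y : 'rV[A]_n) :
  dotp x x = 0 -> dotp x y = 0 -> dotp (x + c *: y) (x + c *: y) = c * c * dotp y y.
Proof.
move=> xx xy; rewrite dotpDl 2!dotpDr 2!dotpZl 2!dotpZr xx [dotp y x]dotpC xy.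
by rewrite !mulr0 !add0r mulrA.
Qed.

(** * Isotropy and eigenvalues along an almost complex curve *)

Section LocalGeometry.
Variable R : realType.
Local Notation C := R[i].
Local Notation plane := (R * R)%type.
Variables (U : set plane) (t : nat -> plane -> 'rV[C]_7) (f : plane -> 'rV[R]_7).
Hypothesis oU : open U.
Hypothesis ht : holomorphic_mx U (t 0%N).
Hypothesis st : forall k, (k <= 3)%N -> smooth_mx U (t k).
Hypothesis tn0 : forall k w, (k <= 3)%N -> U w -> t k w != 0.
Hypothesis tstep : forall k w, (k < 3)%N -> U w ->
  herm (t k.+1 w) (t k w) = 0 /\
  exists b b', b != 0 /\ dz (t k) w = b *: t k.+1 w + b' *: t k w.
Hypothesis tf : t 3%N = fun w => map_mx (real_complex R) (f w).
Hypothesis f_unit : forall w, \sum_a f w 0 a ^+ 2 = 1.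
Hypothesis f_acc : forall w, U w ->
  partial_row true f w = cross (f w) (partial_row false f w).
Hypothesis df : forall w, U w -> dz (t 3%N) w != 0.

Local Notation F := (t 3%N).
Let H i := iter i (@dz R 1 7) (t 0%N).
Let Fr i w (iM : (i <= 3)%N) := frame_propP oU ht st tn0 tstep iM (w := w).

Lemma F_real w : cj (F w) = F w.
Proof. by apply/rowP => a; rewrite tf !mxE; exact: conjc_real. Qed.

Lemma F_dotp1 w : dotp (F w) (F w) = 1.
Proof.
transitivity ((\sum_a f w 0 a ^+ 2)%:C); last by rewrite f_unit.
by rewrite rmorph_sum; apply: eq_bigr => a _; rewrite tf !mxE -rmorphM expr2.
Qed.

Lemma t_rd k w : (k <= 3)%N -> U w -> rderivable (t k) w.
Proof. by move=> k3; exact: smooth_rderivable (st k3). Qed.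

Lemma dz_F w : U w -> dz F w = cj (dzbar F w).
Proof.
move=> Uw; apply/rowP => l; rewrite dzE [RHS]mxE dzbarE -wzJ; last exact: t_rd.
by congr (wz _ w); apply/funext => u; have /rowP/(_ l) := F_real u; rewrite mxE => ->.
Qed.

Lemma orthF w k : (k < 3)%N -> U w -> herm (F w) (t k w) = 0.
Proof. by move=> k3 Uw; have [h _ _] := Fr (leqnn 3) Uw; exact: h. Qed.

Lemma orth_lt w j k : (j < k <= 3)%N -> U w -> herm (t k w) (t j w) = 0.
Proof. by move=> /andP[jk k3] Uw; have [h _ _] := Fr k3 Uw; exact: h. Qed.

Lemma dotp_F_span w i x : (i <= 3)%N -> U w -> x \in tspan t i w -> dotp x (F w) = 0.
Proof.
move=> i3 Uw xi; rewrite dotp_herm F_real; apply: tspan_orth xi => k ki.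
by apply/herm_sym0/orthF => //; exact: leq_trans i3.
Qed.

Lemma dz_span w k : (k < 3)%N -> U w -> dz (t k) w \in tspan t k.+2 w.
Proof.
move=> k3 Uw; have [_ [b [b' [_ ->]]]] := tstep k3 Uw.
by apply: memvD; apply: memvZ; apply: mem_tspan.
Qed.

Lemma dzbar_span w k : (k <= 3)%N -> U w -> dzbar (t k) w \in tspan t k.+1 w.
Proof. by move=> k3 Uw; have [_ _] := Fr k3 Uw. Qed.

Lemma wzb_eq0 (a : plane -> C) w : U w -> (forall u, U u -> a u = 0) -> wzb a w = 0.
Proof.
move=> Uw a0; rewrite -(wzb_cst (0 : C) w); apply: near_wzb.
by apply: open_near_eq oU Uw _ => u /set_mem; exact: a0.
Qed.

(** The zbar-derivative of (t_k, t_j) = 0: between different lines d/dzbar is minus the adjoint of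
    d/dz, so it lowers the index where d/dz raises it. *)
Lemma herm_dzbar w j k : (j < k <= 3)%N -> U w ->
  herm (dzbar (t k) w) (t j w) = - herm (t k w) (dz (t j) w).
Proof.
move=> /andP[jk k3] Uw.
have j3 : (j <= 3)%N by rewrite (leq_trans (ltnW jk)).
have := @wzb_eq0 (fun u => herm (t k u) (t j u)) w Uw
  (fun u Uu => @orth_lt u j k (introT andP (conj jk k3)) Uu).
rewrite wzb_herm; [|exact: t_rd..].
by move/eqP; rewrite addr_eq0 => /eqP.
Qed.

Lemma herm_dzbar0 w j k : (j.+1 < k <= 3)%N -> U w ->
  herm (dzbar (t k) w) (t j w) = 0.
Proof.
move=> /andP[jk k3] Uw; rewrite herm_dzbar ?(ltnW jk)//.
have j3 : (j < 3)%N by rewrite (leq_trans _ k3)// ltnW.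
rewrite (herm_sym0 (tspan_orth _ (dz_span j3 Uw))) ?oppr0// => l lj.
by apply/herm_sym0/orth_lt => //; rewrite (leq_trans lj).
Qed.

Lemma herm_dzbar_neq0 w j : (j < 3)%N -> U w ->
  herm (dzbar (t j.+1) w) (t j w) != 0.
Proof.
move=> j3 Uw; rewrite herm_dzbar ?ltnSn// oppr_eq0.
have [ho [b [b' [b0 ->]]]] := tstep j3 Uw.
rewrite hermDr !hermZr ho mulr0 addr0 mulf_neq0 ?conjC_eq0//.
by rewrite herm_eq0 tn0.
Qed.

Lemma dzbar_two w j : (j < 2)%N -> U w -> exists c c', c' != 0 /\
  dzbar (t j.+1) w = c *: t j.+1 w + c' *: t j w.
Proof.
move=> j2 Uw; have j3 : (j < 3)%N by rewrite ltnW.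
have jM : (j.+1 <= 3)%N by [].
have e := tspan_expand _ _ (dzbar_span jM Uw).
rewrite {}e => [|k k3|l k /andP[lk kj]]; last 2 first.
- by apply: tn0 => //; rewrite -ltnS (leq_trans k3).
- by apply: orth_lt => //; rewrite lk -ltnS (leq_trans kj).
rewrite !big_ord_recr /= big1 ?add0r => [|k _]; last first.
  by rewrite herm_dzbar0 ?mul0r ?scale0r// ltnS ltn_ord.
eexists; eexists; split; last by rewrite addrC.
by rewrite mulf_neq0 ?invr_eq0 ?herm_eq0 ?tn0 ?herm_dzbar_neq0// ltnW.
Qed.

(** The component along [F] vanishes because (F, F) = 1 with [F] real, those along t_0 and t_1 by
    [herm_dzbar0]. Reality also makes the derivative conjugate to dz F, which is nonzero. *)
Lemma dzbar_F w : U w -> exists2 e, e != 0 & dzbar F w = e *: t 2%N w.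
Proof.
move=> Uw; have g0 : dzbar F w != 0.
  by have := df Uw; rewrite dz_F// cj_eq0.
have gF : herm (dzbar F w) (F w) = 0.
  have := @wzb_eq0 (fun u => dotp (F u) (F u) - 1) w Uw.
  rewrite wzbD; [|exact: pderivable_sum (fun l => pderivableM (t_rd (leqnn 3) Uw l) (t_rd (leqnn 3) Uw l))|exact: pderivable_cst].
  rewrite wzb_cst addr0 wzb_dotp; [|exact: t_rd..].
  rewrite [dotp (F w) _]dotpC -mulr2n dotp_herm F_real => h.
  have F1 u : U u -> dotp (F u) (F u) - 1 = 0 by rewrite F_dotp1 subrr.
  by have /eqP := h F1; rewrite mulrn_eq0 => /eqP.
have e := tspan_expand _ _ (dzbar_span (leqnn 3) Uw).
have {}e : dzbar F w = (herm (dzbar F w) (t 2%N w) / herm (t 2%N w) (t 2%N w)) *: t 2%N w.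
  rewrite {1}e => [|k k3|l k /andP[lk kj]]; last 2 first.
  - by apply: tn0.
  - by apply: orth_lt => //; rewrite lk.
  rewrite !big_ord_recr big_ord0 /= gF (@herm_dzbar0 w 0 3)// (@herm_dzbar0 w 1 3)// !mul0r !scale0r addr0 !add0r //.
exists (herm (dzbar F w) (t 2%N w) / herm (t 2%N w) (t 2%N w)) => //.
by apply: contraNneq g0 => h; rewrite e h scale0r.
Qed.

(** As [F] is real, orthogonality to it is also bilinear; d/dzbar of (t_i, F) = 0 then replaces [F]
    by a multiple of t_2. *)
Lemma isotropic2 w i : (i < 3)%N -> U w -> dotp (t i w) (t 2%N w) = 0.
Proof.
move=> i3 Uw; have iM : (i <= 3)%N := ltnW i3.
have := @wzb_eq0 (fun u => dotp (t i u) (F u)) w Uw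
  (fun u Uu => dotp_F_span i3 Uu (mem_tspan _ _ (ltnSn i))).
rewrite wzb_dotp; [|exact: t_rd..].
rewrite (dotp_F_span _ Uw (dzbar_span iM Uw))// add0r.
have [e e0 ->] := dzbar_F Uw; rewrite dotpZr => /eqP.
by rewrite mulf_eq0 (negbTE e0) => /eqP.
Qed.

Lemma dotp_span0 w i x y : (forall k, (k < i)%N -> dotp (t k w) y = 0) ->
  x \in tspan t i w -> dotp x y = 0.
Proof. by rewrite dotp_herm => h; apply: tspan_orth => k /h; rewrite dotp_herm. Qed.

(** d/dzbar of (t_i, t_(j+1)) = 0: the first factor stays in a span already known to be isotropic to
    t_(j+1), the second drops to t_j. *)
Lemma isotropic_step w i j : (i <= j)%N -> (j < 2)%N -> U w ->
  (forall u k, U u -> (k <= j.+1)%N -> dotp (t k u) (t j.+1 u) = 0) ->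
  dotp (t i w) (t j w) = 0.
Proof.
move=> ij j2 Uw h; have j3 : (j < 3)%N by rewrite ltnW.
have i3 : (i <= 3)%N by rewrite (leq_trans ij)// ltnW.
have := @wzb_eq0 (fun u => dotp (t i u) (t j.+1 u)) w Uw
  (fun u Uu => h u i Uu (leq_trans ij (leqnSn j))).
rewrite wzb_dotp; [|exact: t_rd..].
have -> : dotp (dzbar (t i) w) (t j.+1 w) = 0.
  apply: dotp_span0 (dzbar_span i3 Uw) => k ki; apply: h => //.
  by rewrite (leq_trans _ (leqnSn j))// (leq_trans _ ij).
have [c [c' [c0 ->]]] := dzbar_two j2 Uw.
rewrite add0r dotpDr !dotpZr h ?mulr0 ?add0r//; last by rewrite (leq_trans ij).
by move/eqP; rewrite mulf_eq0 (negbTE c0) => /eqP.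
Qed.

Lemma isotropic w i j : (i < 3)%N -> (j < 3)%N -> U w -> dotp (t i w) (t j w) = 0.
Proof.
have iso2 u k : U u -> (k <= 2)%N -> dotp (t k u) (t 2%N u) = 0.
  by move=> Uu k2; exact: isotropic2.
have iso1 u k : U u -> (k <= 1)%N -> dotp (t k u) (t 1%N u) = 0.
  by move=> Uu k1; exact: isotropic_step.
have iso0 u k : U u -> (k <= 0)%N -> dotp (t k u) (t 0%N u) = 0.
  by move=> Uu k0; exact: isotropic_step.
move=> i3 j3 Uw; wlog ij : i j i3 j3 / (i <= j)%N.
  by move=> hw; case/orP: (leq_total i j) => h; [exact: hw|rewrite dotpC; exact: hw].
by case: j j3 ij => [|[|[|]]] // _ ij; [exact: iso0|exact: iso1|exact: iso2].
Qed.

Lemma H_span w i : (i <= 3)%N -> U w -> H i w \in tspan t i.+1 w.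
Proof.
move=> i3 Uw; have [_ [c c0 h] _] := Fr i3 Uw.
rewrite -[H i w](subrK (c *: t i w)); apply: memvD; first exact: tspanS.
by apply: memvZ; exact: mem_tspan.
Qed.

Lemma H_isotropic w i : (i < 3)%N -> U w -> dotp (H i w) (H i w) = 0.
Proof.
move=> i3 Uw; have iM : (i <= 3)%N := ltnW i3.
apply: dotp_span0 (H_span iM Uw) => k ki; rewrite dotpC.
apply: dotp_span0 (H_span iM Uw) => l li.
by apply: isotropic => //; [exact: leq_trans i3|exact: leq_trans i3].
Qed.

(** [H 3] is c F plus an element of the isotropic span of t_0, t_1, t_2, which is orthogonal to [F];
    the value is c^2. *)
Lemma H3_dotp w : U w -> dotp (H 3 w) (H 3 w) != 0.
Proof.
move=> Uw; have [_ [c c0 h] _] := Fr (leqnn 3) Uw.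
set x := H 3 w - c *: F w in h; have -> : H 3 w = x + c *: F w by rewrite subrK.
have xF := dotp_F_span (leqnn 3) Uw h.
have xx : dotp x x = 0.
  apply: (@dotp_span0 w 3 _ _ _ h) => k k3; rewrite dotpC.
  by apply: (@dotp_span0 w 3 _ _ _ h) => l l3; exact: isotropic.
have -> : dotp (x + c *: F w) (x + c *: F w) = c * c.
  by rewrite dotp_sqrD// F_dotp1 mulr1.
by rewrite mulf_neq0.
Qed.

Lemma map_cross (a b : 'rV[R]_7) :
  map_mx (real_complex R) (cross a b) =
  xprod (map_mx (real_complex R) a) (map_mx (real_complex R) b).
Proof.
apply/rowP => c; rewrite !mxE rmorph_sum; apply: eq_bigr => i _ /=.
rewrite rmorph_sum; apply: eq_bigr => j _ /=.
by rewrite !rmorphM /= !mxE /cross_coef /xcoef rmorphB /= !rmorph_nat.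
Qed.

Lemma dzbar_real w : dzbar F w = 2^-1 *: (map_mx (real_complex R) (partial_row false f w)
  + 'i *: map_mx (real_complex R) (partial_row true f w)).
Proof.
have pE b l : partialC b (fun u => F u 0 l) w = (partial b (fun u => f u 0 l) w)%:C.
  have rE : (fun u => complex.Re (F u 0 l)) = (fun u => f u 0 l).
    by apply/funext => u; rewrite tf mxE.
  have iE : (fun u => complex.Im (F u 0 l)) = cst 0.
    by apply/funext => u; rewrite tf mxE.
  by rewrite /partialC rE iE /partial derive_cst.
by apply/rowP => l; rewrite 2!mxE !pE !mxE mulrC.
Qed.

(** The almost complex equation makes the zbar-derivative (X + i F x X) / 2 with X the x-derivative,
    and F x (F x X) = -X since X is orthogonal to [F]. *)
Lemma eigen_g w : U w -> xprod (F w) (dzbar F w) = - 'i *: dzbar F w.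
Proof.
move=> Uw; rewrite dzbar_real f_acc// map_cross.
have -> : map_mx (real_complex R) (f w) = F w by rewrite tf.
set X := map_mx _ _.
have FX : dotp (F w) X = 0.
  have [e _ ge] := dzbar_F Uw.
  have : dotp (F w) (dzbar F w) = 0.
    by rewrite ge dotpZr dotpC (dotp_F_span (leqnn 3) Uw) ?mulr0// mem_tspan.
  rewrite dzbar_real f_acc// map_cross.
  have -> : map_mx (real_complex R) (f w) = F w by rewrite tf.
  rewrite dotpZr dotpDr dotpZr dotp_F_xF mulr0 addr0 => /eqP.
  by rewrite mulf_eq0 invr_eq0 pnatr_eq0 => /eqP.
rewrite xprodZr xprodDr xprodZr xF_xF ?F_dotp1// scalerA [- 'i * _]mulrC -scalerA.
congr (_ *: _); rewrite scalerDr scalerA mulNr -expr2 sqrCi opprK scale1r.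
by rewrite scalerN scaleNr addrC.
Qed.

Lemma eigen_t2 w : U w -> xprod (F w) (t 2%N w) = - 'i *: t 2%N w.
Proof.
move=> Uw; have := eigen_g Uw; have [e e0 ->] := dzbar_F Uw.
rewrite xprodZr [- 'i *: _]scalerA [- 'i * e]mulrC -scalerA => /eqP.
by rewrite -subr_eq0 -scalerBr scaler_eq0 (negbTE e0) subr_eq0 => /eqP.
Qed.

Lemma dzbarZ (k : C) (s : plane -> 'rV[C]_7) w : rderivable s w ->
  dzbar (fun u => k *: s u) w = k *: dzbar s w.
Proof.
move=> hs; apply/rowP => l; rewrite dzbarE [RHS]mxE dzbarE.
have -> : (fun u => (k *: s u) 0 l) = (fun u => k * s u 0 l).
  by apply/funext => u; rewrite mxE.
by rewrite (wzbM (@pderivable_cst _ k w) (hs l)) wzb_cst mul0r add0r.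
Qed.

Lemma rderivable_xprod (s r : plane -> 'rV[C]_7) w :
  rderivable s w -> rderivable r w -> rderivable (fun u => xprod (s u) (r u)) w.
Proof.
move=> hs hr c.
have -> : (fun u => xprod (s u) (r u) 0 c) =
    (fun u => \sum_a \sum_b xcoef C a b c * s u 0 a * r u 0 b).
  by apply/funext => u; rewrite mxE.
apply: pderivable_sum => a; apply: pderivable_sum => b.
by apply: pderivableM (hr b); exact: pderivableM (@pderivable_cst _ (xcoef C a b c) w) (hs a).
Qed.

(** d/dzbar of the equation for t_2: the derivative of [F] contributes t_2 x t_2 = 0, and that of
    t_2 has a nonzero component along t_1. *)
Lemma eigen_t1 w : U w -> xprod (F w) (t 1%N w) = - 'i *: t 1%N w.
Proof.
move=> Uw.
have : dzbar (fun u => xprod (F u) (t 2%N u)) w = dzbar (fun u => - 'i *: t 2%N u) w.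
  by apply: near_dzbar; apply: open_near_eq oU Uw _ => u /set_mem; exact: eigen_t2.
rewrite dzbarZ; last exact: t_rd.
rewrite dzbar_xprod; [|exact: t_rd..].
have [e _ ->] := dzbar_F Uw; have [c [c' [c0 ->]]] := @dzbar_two w 1 isT Uw.
rewrite xprodZl xprodvv scaler0 add0r xprodDr !xprodZr (eigen_t2 Uw) scalerDr.
rewrite !scalerA [c * _]mulrC [- 'i * c']mulrC -!scalerA => /addrI /eqP.
by rewrite -subr_eq0 -scalerBr scaler_eq0 (negbTE c0) subr_eq0 => /eqP.
Qed.

Lemma dzbar_t0 w : U w -> dzbar (t 0%N) w = 0.
Proof. by case: ht => _; exact. Qed.

Lemma dzbar_eigen_part (k : C) w : U w -> 
  rderivable (fun u => xprod (F u) (t 0%N u) + k *: t 0%N u) w /\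
  dzbar (fun u => xprod (F u) (t 0%N u) + k *: t 0%N u) w = xprod (dzbar F w) (t 0%N w).
Proof.
move=> Uw; have F' := t_rd (leqnn 3) Uw; have h' := t_rd (leq0n 3) Uw.
have d0 := dzbar_t0 Uw.
have X' := rderivable_xprod F' h'.
have k' l : pderivable (fun u => k * t 0%N u 0 l) w.
  exact: pderivableM (@pderivable_cst _ k w) (h' l).
have eE l : (fun u => (xprod (F u) (t 0%N u) + k *: t 0%N u) 0 l) =
    (fun u => xprod (F u) (t 0%N u) 0 l + k * t 0%N u 0 l).
  by apply/funext => u; rewrite mxE [X in _ + X]mxE.
split; first by move=> l; rewrite eE; exact: pderivableD (X' l) (k' l).
apply/rowP => l; rewrite dzbarE eE wzbD//.
rewrite (wzbM (@pderivable_cst _ k w) (h' l)) wzb_cst mul0r add0r.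
have -> : wzb (fun u => t 0%N u 0 l) w = 0 by rewrite -dzbarE d0 mxE.
by rewrite mulr0 addr0 -dzbarE dzbar_xprod// d0 xprod0r addr0.
Qed.

(* By eigen_split, the product of any entries of u and p vanishes. Where u is not
   0, its dzbar-derivative gives dzbar p = 0, that is t_2 x t_0 = 0; polarising
   conj(t_2) x (t_2 x t_0) = 0 then yields |t_2|^2 t_0 = 0. *)
Lemma eigen_t0 w : U w -> xprod (F w) (t 0%N w) = 'i *: t 0%N w.
Proof.
move=> Uw.
pose u z := xprod (F z) (t 0%N z) + (- 'i) *: t 0%N z.
pose p z := xprod (F z) (t 0%N z) + 'i *: t 0%N z.
have up z : U z -> u z = 0 \/ p z = 0.
  move=> Uz; rewrite /u scaleNr.
  have o i : (i < 3)%N -> dotp (t 0%N z) (t i z) = 0 by move=> i3; exact: isotropic.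
  apply: (@eigen_split _ _ (F_real z) (F_dotp1 z) (t 1%N z) (t 2%N z)).
  - exact: tn0.
  - exact: tn0.
  - exact: eigen_t1.
  - exact: eigen_t2.
  - by apply: herm_sym0; exact: orth_lt.
  - by rewrite dotpC (dotp_F_span (leqnn 3) Uz)// mem_tspan.
  - by apply: herm_sym0; exact: orth_lt.
  - by apply: herm_sym0; exact: orth_lt.
  - exact: o.
  - exact: o.
  - exact: o.
have [u0|u0] := eqVneq (u w) 0.
  by apply/eqP; rewrite -subr_eq0 -scaleNr -/(u w) u0.
have pw : p w = 0.
  by case: (up w Uw) => h; [case: (elimN eqP u0 h)|exact: h].
have [a ua] := row_neq0 u0.
have [u' du] := dzbar_eigen_part (- 'i) Uw.
have [p' dp] := dzbar_eigen_part 'i Uw.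
have gh : xprod (dzbar F w) (t 0%N w) = 0.
  rewrite -dp; apply/rowP => b; rewrite dzbarE mxE.
  have := @wzb_eq0 (fun z => u z 0 a * p z 0 b) w Uw.
  rewrite (wzbM (u' a) (p' b)) -/(p w) pw mxE mulr0 add0r => h.
  have /h/eqP : forall z, U z -> u z 0 a * p z 0 b = 0.
    have m0 c : (0 : 'rV[C]_7) 0 c = 0 by rewrite mxE.
    by move=> z Uz; case: (up z Uz) => ->; rewrite m0 ?mul0r ?mulr0.
  by rewrite mulf_eq0 => /orP[|/eqP//]; rewrite -[X in X == 0]/(u w 0 a) (negbTE ua).
have t2h : xprod (t 2%N w) (t 0%N w) = 0.
  move: gh; have [e e0 ->] := dzbar_F Uw; rewrite xprodZl => /eqP.
  by rewrite scaler_eq0 (negbTE e0) => /eqP.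
have eh : xprod (F w) (t 0%N w) = - 'i *: t 0%N w.
  by apply/eqP; rewrite scaleNr -addr_eq0 -/(p w) pw.
have qh0 : dotp (cj (t 2%N w)) (t 0%N w) = 0.
  by rewrite dotpC -herm_dotp; apply: herm_sym0; exact: orth_lt.
have qh : xprod (cj (t 2%N w)) (t 0%N w) = 0.
  exact: (@eigen_xprod _ (F w) _ _ (xF_cj (F_real w) (eigen_t2 Uw)) eh qh0).
have := xprod_polar (cj (t 2%N w)) (t 2%N w) (t 0%N w).
rewrite t2h qh qh0 (@isotropic w 2 0)// !xprod0r !scale0r !add0r => /eqP.
rewrite eq_sym oppr_eq0 scaler_eq0 (negbTE (tn0 (leq0n 3) Uw)) orbF mulrn_eq0 /=.
by rewrite dotpC -herm_dotp herm_eq0 (negbTE (tn0 _ Uw)).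
Qed.

(** h' is a combination of t_1 and h = t_0, which have opposite eigenvalues and zero bilinear
    product. *)
Lemma H_null w : U w -> xprod (H 0 w) (H 1 w) = 0.
Proof.
move=> Uw; rewrite /H /=; have [_ [b [b' [_ ->]]]] := @tstep 0 w isT Uw.
rewrite xprodDr !xprodZr xprodvv scaler0 addr0.
rewrite (@eigen_xprod _ (F w) _ _ (eigen_t0 Uw) (eigen_t1 Uw)) ?scaler0//.
exact: isotropic.
Qed.
End LocalGeometry.

(** * Orders of ramification *)

Section IsotropicJets.
Variable K : numFieldType.
Local Notation O := (fps K).

(** Induction on the gap j - i: the derivative of a product of gap d + 1 is one of gap d plus one of
    gap d + 2. For gap 1 the derivative of (w_i, w_i) = 0 is twice the product. *)
Lemma isotropic_derivs n (w : nat -> 'rV[O]_n) m : (forall i, w i.+1 = derivfm (w i)) ->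
  (forall i, (i <= m)%N -> dotp (w i) (w i) = 0) ->
  forall i j, (i + j <= m.*2.+1)%N -> dotp (w i) (w j) = 0.
Proof.
move=> dw w0.
have step d i : (i + (i + d) <= m.*2.+1)%N -> dotp (w i) (w (i + d)%N) = 0.
  have [k] := ubnP d; elim: k d i => // k IH [|[|d]] i; rewrite ltnS => dk id.
  - by rewrite addn0 w0//; lia.
  - have := derivf_dotp (w i) (w i); rewrite w0 ?derivf0; last by lia.
    rewrite -dw [dotp (w i.+1) _]dotpC addn1 => /fpsP h; apply/fpsP => l.
    by have := h l; rewrite fcoefD -mulr2n => /esym/eqP; rewrite mulrn_eq0 => /eqP.
  - have := derivf_dotp (w i) (w (i + d.+1)%N); rewrite IH ?derivf0; [|lia..].
    rewrite -!dw -[(i + d.+1)%N]addSnnS IH; [|lia..].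
    by rewrite add0r addSnnS -addnS.
move=> i j ij; wlog ij' : i j ij / (i <= j)%N.
  move=> hw; case/orP: (leq_total i j) => h; first exact: hw.
  by rewrite dotpC; apply: hw => //; rewrite addnC.
by rewrite -(subnKC ij') step// subnKC.
Qed.
End IsotropicJets.

(** * From a punctured neighbourhood to the Taylor expansion at its centre *)

Section Punctured.
Variable R : realType.
Local Notation C := R[i].
Local Notation plane := (R * R)%type.
Implicit Types (z w : plane) (U V : set plane) (F : plane -> C).

Definition punctured z (e : R) : set plane :=
  [set w | 0 < nbox z w] `&` [set w | nbox z w < e].

Lemma open_nbox_lt z (e : R) : open [set w | nbox z w < e].
Proof.
have -> : [set w | nbox z w < e] = nbox z @^-1` [set x | x < e] by [].
by apply: open_comp => [w _|]; [exact: nbox_continuous|exact: open_lt].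
Qed.

Lemma open_punctured z e : open (punctured z e).
Proof. by apply: openI; [exact: open_nbox_gt0|exact: open_nbox_lt]. Qed.

Lemma nbox0P z w : (nbox z w <= 0) = (w == z).
Proof.
rewrite /nbox ge_max !normr_le0 !subr_eq0 -pair_eqE //.
Qed.

Lemma punctured_near z (P : set plane) : (\forall w \near z^', P w) ->
  exists2 e, 0 < e & punctured z e `<=` P.
Proof.
rewrite /dnbhs near_withinE => /nbhs_box[e e0 h]; exists e => // w [/= w0 we].
by apply: h; [exact/boxE|rewrite -nbox0P -ltNge].
Qed.

Lemma punctured_ex z e V : 0 < e -> nbhs z V -> exists2 w, V w & punctured z e w.
Proof.
move=> e0 /nbhs_box[d d0 h]; pose r := Num.min e d / 2.
have m0 : 0 < Num.min e d by rewrite lt_min e0.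
have r0 : 0 < r by rewrite divr_gt0.
have rm : r < Num.min e d by rewrite ltr_pdivrMr// ltr_pMr// ltr1n.
have nE : nbox z (z.1 + r, z.2) = r.
  by rewrite /nbox /= addrC addKr subrr normr0 gtr0_norm// max_l// ltW.
move: rm; rewrite lt_min => /andP[re rd].
exists (z.1 + r, z.2); first by apply/h/boxE; rewrite nE.
by split; rewrite /= nE.
Qed.

Lemma continuous_eq0 z e (g : plane -> R) : 0 < e -> {for z, continuous g} ->
  (forall w, punctured z e w -> g w = 0) -> g z = 0.
Proof.
move=> e0 cg g0; apply: contrapT => /eqP gz.
have /(punctured_ex e0)[w /= gw /g0 w0] : nbhs z (g @^-1` [set x | x != 0]).
  by apply: cg; apply: open_nbhs_nbhs; split=> //; exact: open_neq.
by rewrite w0 eqxx in gw.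
Qed.

Lemma jet_punctured_eq0 U z e F : open U -> U z -> hol U F -> 0 < e ->
  (forall w, punctured z e w -> F w = 0) -> jet z F = 0.
Proof.
move=> oU Uz hF e0 F0.
have Fz : F z = 0.
  case: (hF) => -[h1 h2] _; apply: complex_eqP.
    apply: (continuous_eq0 e0 (h1 [::] z Uz).1) => w /F0 /= ->//.
  by apply: (continuous_eq0 e0 (h2 [::] z Uz).1) => w /F0 /= ->.
have Ez : [set w | nbox z w < e] z.
  by apply: (@le_lt_trans _ _ 0) => //; rewrite nbox0P.
have FE : {in [set w | nbox z w < e], F =1 fun=> 0}.
  move=> w /set_mem /= we; have [->//|wz] := eqVneq w z.
  by apply: F0; split=> //=; rewrite ltNge nbox0P.
by rewrite (jet_eq (@open_nbox_lt z e) Ez FE) jet0.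
Qed.

(** A zero Taylor series would make [F] vanish near [z], hence at points of the punctured square. *)
Lemma jet_punctured_neq0 U z e F : open U -> U z -> hol U F -> 0 < e ->
  (forall w, punctured z e w -> F w != 0) -> jet z F != 0.
Proof.
move=> oU Uz hF e0 F0; apply/eqP => /(jet_eq0 oU Uz hF) /(punctured_ex e0)[w /= Fw].
by move=> /F0; rewrite Fw eqxx.
Qed.

Lemma fcoef_derivf_jet z F l :
  (fcoef (derivf (jet z F)) l == 0) = (iter l (@wz R) (wz F) z == 0).
Proof.
by rewrite -jet_wz /= mulf_eq0 invr_eq0 pnatr_eq0 -[l`! == _]leqn0 leqNgt fact_gt0 orbF.
Qed.

Lemma chart_coordinate b : coordinate setT (@chart R b).
Proof.
split; [exact: openT| |move=> z _]; last first.
  exists b, setT, id; split => //; first exact: openT.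
  apply/holomorphic_mxP => i j.
  have [h _] := zeta_hol setT (0 : plane).
  apply: hol_eq openT _ h => w _; rewrite mxE !ord1 eqxx mulr1n /zeta /= !subr0 //.
move=> [x y] [x' y'] _ _; case: b => /=; last by case=> -> ->.
have pE (a c : R) : ((a, c) == 0 :> plane) = (a == 0) && (c == 0) by [].
have d0 (a c : R) : (a, c) != 0 :> plane -> a ^+ 2 + c ^+ 2 != 0.
  by rewrite pE paddr_eq0 ?sqr_ge0// !sqrf_eq0.
case: eqVneq => [->|/d0 n]; case: eqVneq => [->|/d0 n'] //= [].
set d := x ^+ 2 + y ^+ 2 in n *; set d' := x' ^+ 2 + y' ^+ 2 in n' *.
rewrite !mulNr => ex /oppr_inj ey.
(* The squared length of (x/d, -y/d) is 1/d, so the image determines d and with it x and y. *)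
have dd : d^-1 = d'^-1.
  have e (a c : R) : a ^+ 2 + c ^+ 2 != 0 -> (a ^+ 2 + c ^+ 2)^-1 =
    (a / (a ^+ 2 + c ^+ 2)) ^+ 2 + (c / (a ^+ 2 + c ^+ 2)) ^+ 2 by move=> ?; field.
  by rewrite /d /d' (e x y n) (e x' y' n') -/d -/d' ex ey.
have dI : injective ( *%R^~ d^-1) by apply: mulIf; rewrite invr_eq0.
by move: ex ey; rewrite -dd => /dI -> /dI ->.
Qed.
End Punctured.

Lemma holomorphic_xprod (R : realType) (U : set (R * R)) (F G : R * R -> 'rV[R[i]]_7) : open U ->
  holomorphic_mx U F -> holomorphic_mx U G ->
  holomorphic_mx U (fun w => xprod (F w) (G w)).
Proof.
move=> oU /holomorphic_mxP hF /holomorphic_mxP hG; apply/holomorphic_mxP => i c.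
have h : hol U (fun w => \sum_a \sum_b xcoef R[i] a b c * F w 0 a * G w 0 b).
  apply: hol_sum => // a _; apply: hol_sum => // b _.
  apply: holM (hG 0 b) => //; apply: holM (hF 0 a) => //; exact: hol_cst.
by apply: hol_eq oU _ h => w _; rewrite mxE.
Qed.

(** * Taylor expansions of a lift of the directrix curve *)

Section DirectrixJets.
Variable R : realType.
Local Notation C := R[i].
Local Notation plane := (R * R)%type.
Implicit Types (z w : plane) (U V : set plane).

Lemma line_eq n (u v : 'rV[C]_n) : v != 0 -> <[u]>%VS = <[v]>%VS ->
  exists2 b, b != 0 & v = b *: u.
Proof.
move=> v0 uv; have /vlineP[b vb] : v \in <[u]>%VS by rewrite uv memv_line.
by exists b => //; apply: contraNneq v0 => b0; rewrite vb b0 scale0r.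
Qed.

Lemma smooth_mxS m n U V (F : plane -> 'M[C]_(m, n)) : U `<=` V ->
  smooth_mx V F -> smooth_mx U F.
Proof.
by move=> UV h i j; have [h1 h2] := h i j; split=> l z /UV; [exact: h1|exact: h2].
Qed.

Lemma holomorphic_mxS m n U V (F : plane -> 'M[C]_(m, n)) : U `<=` V ->
  holomorphic_mx V F -> holomorphic_mx U F.
Proof.
move=> UV [h1 h2]; split; first exact: smooth_mxS h1.
by move=> z /UV; exact: h2.
Qed.

Lemma local_liftS n (psi : sphere R -> {vspace 'rV[C]_n}) phi U V s : open U ->
  U `<=` V -> local_lift psi phi V s -> local_lift psi phi U s.
Proof. by move=> oU UV [_ h]; split=> // z /UV; exact: h. Qed.

(** The lift [s'] is chosen independently of [s], so it agrees with [dz_perp s] only up to a nonzero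
    scalar. *)
Lemma dz_perp_next n (psi' : sphere R -> {vspace 'rV[C]_n}) (s s' : plane -> 'rV[C]_n)
    (p : sphere R) w : s w != 0 -> dz_perp s w != 0 ->
  psi' p = <[dz_perp s w]>%VS -> psi' p = <[s' w]>%VS ->
  herm (s' w) (s w) = 0 /\
  exists b b', b != 0 /\ dz s w = b *: s' w + b' *: s w.
Proof.
move=> s0 d0 -> /esym/(line_eq d0)[b b0 dE].
have o : herm (dz_perp s w) (s w) = 0.
  rewrite /dz_perp -scaleNr hermDl hermZl mulNr divfK ?subrr//.
  by rewrite herm_eq0.
split; last first.
  exists b, (herm (dz s w) (s w) / herm (s w) (s w)); split=> //.
  by rewrite -dE /dz_perp subrK.
by move: o; rewrite dE hermZl => /eqP; rewrite mulf_eq0 (negbTE b0) => /eqP.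
Qed.

Lemma dz_neq0 n (s : plane -> 'rV[C]_n) w : dz_perp s w != 0 -> dz s w != 0.
Proof.
by apply: contraNneq => d0; rewrite /dz_perp d0 herm0l mul0r scale0r subrr.
Qed.

Lemma holomorphic_lift_smooth n (psi : sphere R -> {vspace 'rV[C]_n}) phi V h :
  holomorphic_lift psi phi V h -> smooth_lift psi phi V h.
Proof. by case=> h1 [h2 _]. Qed.

Lemma real_lift (f : sphere R -> 'rV[R]_7) (phi : plane -> sphere R) :
  almost_complex_curve f -> coordinate setT phi ->
  smooth_lift (proj_class f) phi setT (fun w => map_mx (real_complex R) (f (phi w))).
Proof.
case=> f1 facc co; have [fs _] := facc _ _ co.
split.
  split=> [|w _]; first exact: openT.
  split=> //; apply/eqP => /rowP h.
  have := f1 (phi w); rewrite big1 => [/eqP|a _]; first by rewrite eq_sym oner_eq0.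
  by have := h a; rewrite !mxE => -[->]; rewrite expr0n.
move=> i j; rewrite !ord1; split.
  apply: smooth_on_eq openT _ (fs j) => w _; by rewrite mxE.
apply: smooth_on_eq openT _ (@smooth_on_cst R setT 0) => w _; by rewrite mxE.
Qed.

Variables (f : sphere R -> 'rV[R]_7) (psi : 'I_7 -> sphere R -> {vspace 'rV[C]_7}).
Hypothesis facc : almost_complex_curve f.
Hypothesis hs : harmonic_sequence f psi.
Variables (phi : plane -> sphere R) (z0 : plane).
Hypothesis co : coordinate setT phi.

Lemma lifts_ex : exists V (t : nat -> plane -> 'rV[C]_7),
  [/\ V z0, holomorphic_lift (psi ord0) phi V (t 0%N),
     forall k, (k <= 3)%N -> smooth_lift (psi (inord k)) phi V (t k) &
     t 3%N = fun w => map_mx (real_complex R) (f (phi w))].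
Proof.
case: hs => hm p3 h0 _.
have [V0 [h [V0z _ hl]]] := h0 _ _ co z0 Logic.I.
have [V1 [s1 [V1z _ sl1]]] := (hm (inord 1)).1 _ _ co z0 Logic.I.
have [V2 [s2 [V2z _ sl2]]] := (hm (inord 2)).1 _ _ co z0 Logic.I.
have sl3 := real_lift facc co; rewrite -p3 in sl3.
have o0 : open V0 by case: hl => -[].
have o1 : open V1 by case: sl1 => -[].
have o2 : open V2 by case: sl2 => -[].
pose V := V0 `&` (V1 `&` V2).
have oV : open V by apply: openI => //; exact: openI.
have VV0 : V `<=` V0 by move=> w [].
have VV1 : V `<=` V1 by move=> w [_ []].
have VV2 : V `<=` V2 by move=> w [_ []].
pose t k := if k is k.+1 then if k is k.+1 then if k is k.+1 then
  (fun w => map_mx (real_complex R) (f (phi w))) else s2 else s1 else h.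
have hl' : holomorphic_lift (psi ord0) phi V h.
  by case: hl => l m; split; [exact: local_liftS l|exact: holomorphic_mxS m].
exists V, t; split=> // k.
case: k => [|[|[|[|//]]]] _.
- have -> : inord 0 = ord0 :> 'I_7 by apply: val_inj; rewrite /= inordK.
  exact: holomorphic_lift_smooth.
- by case: sl1 => l m; split; [exact: local_liftS l|exact: smooth_mxS m].
- by case: sl2 => l m; split; [exact: local_liftS l|exact: smooth_mxS m].
- by case: sl3 => l m; split; [exact: local_liftS l|exact: smooth_mxS m].
Qed.

Lemma directrix_jets : exists V h,
  [/\ V z0, holomorphic_lift (psi ord0) phi V h,
      forall i, (i <= 2)%N -> let w := jetm z0 (iter i (@dz R 1 7) h) in dotp w w = 0,
      let w := jetm z0 (iter 3 (@dz R 1 7) h) in dotp w w != 0 &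
      xprod (jetm z0 h) (jetm z0 (dz h)) = 0].
Proof.
have [V [t [Vz hl sl t3]]] := lifts_ex; exists V, (t 0%N).
have oV : open V by case: hl => -[].
have nxt k : (k <= 3)%N -> \forall w \near z0^', dz_perp (t k) w != 0 /\
    psi (inord k.+1) (phi w) = <[dz_perp (t k) w]>%VS.
  move=> k3; case: hs => _ _ _ hn.
  apply: (hn (inord k) (inord k.+1) _ _ _ co _ _ _ (sl k k3) _ Vz) => //.
  have k7 : (k.+1 < 7)%N by lia.
  by rewrite (inordK k7) inordK// ltnW.
(* The case k = 3 provides the nonvanishing of the z-derivative of f. *)
have [e e0 eP] : exists2 e, 0 < e & punctured z0 e `<=` [set w | V w /\
    forall k, (k <= 3)%N -> dz_perp (t k) w != 0 /\
    psi (inord k.+1) (phi w) = <[dz_perp (t k) w]>%VS].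
  apply: punctured_near.
  have n0 := nxt 0 isT; have n1 := nxt 1 isT; have n2 := nxt 2 isT; have n3 := nxt 3 isT.
  have nV : \forall w \near z0^', V w.
    by apply: nbhs_dnbhs; exact: open_nbhs_nbhs.
  apply: filterS (filterI nV (filterI n0 (filterI n1 (filterI n2 n3)))).
  move=> w [Vw [h0 [h1 [h2 h3]]]]; split; first exact: Vw.
  case=> [|[|[|[|k]]]] k3; [exact: h0|exact: h1|exact: h2|exact: h3|].
  by case: (notF k3).
pose U := punctured z0 e.
have UV : U `<=` V by move=> w /eP[].
have oU : open U := @open_punctured _ _ _.
have hol0 : holomorphic_mx V (t 0%N) by case: hl.
have htU : holomorphic_mx U (t 0%N) by exact: holomorphic_mxS hol0.
have st k : (k <= 3)%N -> smooth_mx U (t k).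
  by move=> k3; have [_] := sl k k3; exact: smooth_mxS.
have tn0 k w : (k <= 3)%N -> U w -> t k w != 0.
  by move=> k3 Uw; have [[_ h] _] := sl k k3; have [] := h w (UV w Uw).
have tstep k w : (k < 3)%N -> U w -> herm (t k.+1 w) (t k w) = 0 /\
    exists b b', b != 0 /\ dz (t k) w = b *: t k.+1 w + b' *: t k w.
  move=> k3 Uw; have [_ h] := eP w Uw; have [d0 dE] := h k (ltnW k3).
  apply: (dz_perp_next _ d0 dE); first exact: tn0 (ltnW k3) Uw.
  by have [[_ h'] _] := sl k.+1 k3; have [] := h' w (UV w Uw).
have [f1 /(_ _ _ co)[_ acc]] := facc.
have accU w : U w -> partial_row true (fun u => f (phi u)) w =
  cross (f (phi w)) (partial_row false (fun u => f (phi u)) w) by move=> _; exact: acc.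
have df w : U w -> dz (t 3%N) w != 0.
  by move=> Uw; apply: dz_neq0; have [_ h] := eP w Uw; have [] := h 3%N isT.
have hH i : holomorphic_mx V (iter i (@dz R 1 7) (t 0%N)).
  exact: holomorphic_iter_dz.
have hD i := jet_dotp oV Vz (hH i) (hH i).
split=> //.
- move=> i i2 /=; have [h1 <-] := hD i.
  apply: (jet_punctured_eq0 oV Vz h1 e0) => w Uw.
  exact: (H_isotropic oU htU st tn0 tstep t3 (fun u => f1 (phi u)) df).
- rewrite /=; have [h1 <-] := hD 3%N.
  apply: (jet_punctured_neq0 oV Vz h1 e0) => w Uw.
  exact: (H3_dotp oU htU st tn0 tstep t3 (fun u => f1 (phi u)) df Uw).
- rewrite -(jetm_xprod oV Vz (hH 0%N) (hH 1%N)).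
  apply/rowP => a; rewrite mxE [RHS]mxE.
  have := holomorphic_xprod oV (hH 0%N) (hH 1%N) => /holomorphic_mxP/(_ 0 a) h1.
  apply: (jet_punctured_eq0 oV Vz h1 e0) => w Uw.
  by rewrite (H_null oU htU st tn0 tstep t3 (fun u => f1 (phi u)) accU df Uw) mxE.
Qed.
End DirectrixJets.

Lemma hol_near_neq0 (R : realType) (U : set (R * R)) (F : R * R -> R[i]) z : open U -> U z ->
  hol U F -> F z != 0 -> \forall w \near z, F w != 0.
Proof.
move=> oU Uz [[h1 h2] _] Fz.
have nz (g : R * R -> R) : {for z, continuous g} -> g z != 0 -> \forall w \near z, g w != 0.
  move=> cg gz; have : nbhs (g z) [set x | x != 0].
    by apply: open_nbhs_nbhs; split=> //; exact: open_neq.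
  exact: cg.
have [r0|r0] := eqVneq (complex.Re (F z)) 0; last first.
  apply: filterS (nz _ (h1 [::] z Uz).1 r0) => w /=.
  by apply: contraNneq => ->.
have i0 : complex.Im (F z) != 0.
  by apply: contraNneq Fz => i0; apply/eqP/complex_eqP.
apply: filterS (nz _ (h2 [::] z Uz).1 i0) => w /=.
by apply: contraNneq => ->.
Qed.

(** * Ramification orders as orders of the Frenet coefficients *)

Section RamificationOrder.
Variables (R : realType) (m : nat).
Local Notation C := R[i].
Local Notation O := (fps C).
Local Notation plane := (R * R)%type.
Variables (psi : sphere R -> {vspace 'rV[C]_m.+1}) (p : sphere R).
Local Notation phi := (@chart R (centre_chart p)).
Local Notation z0 := (centre p).
Variables (V : set plane) (h : plane -> 'rV[C]_m.+1).
Hypothesis Vz : V z0.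
Hypothesis hl : holomorphic_lift psi phi V h.
Let w i := jetm z0 (iter i (@dz R 1 m.+1) h).
Variables (v : nat -> 'rV[O]_m.+1) (T A : nat -> nat -> O) (al : nat -> O).
Hypothesis uV : \matrix_(i < m.+1) v i \in unitmx.
Hypothesis wT : forall i, (i <= m)%N -> w i = \sum_(k < i.+1) T i k *: v k.
Hypothesis T0 : forall i, (i <= m)%N -> T i i != 0.
Hypothesis dv : forall i, (i < m)%N ->
  derivfm (v i) = al i *: v i.+1 + \sum_(k < i.+1) A i k *: v k.
Variables (j : nat) (sigma : sphere R -> {vspace 'rV[C]_#|incr m.+1 j.+1|}).
Hypothesis jm : (j < m)%N.
Hypothesis os : osculating_curve psi sigma.

Let oV : open V. Proof. by case: hl => -[]. Qed.
Let hh : holomorphic_mx V h. Proof. by case: hl. Qed.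

(** Proportionality to the osculating vector is written by cross-multiplication, which holds
    trivially at the zeros of that vector and so everywhere. *)
Lemma osculating_jet V' (s : plane -> 'rV[C]_#|incr m.+1 j.+1|) : V' z0 ->
  holomorphic_lift sigma phi V' s -> forall a b,
  jetm z0 s 0 a * gwedge (fun i : 'I_j.+1 => w i) 0 b =
  jetm z0 s 0 b * gwedge (fun i : 'I_j.+1 => w i) 0 a.
Proof.
move=> V'z [[oV' sl] hs] a b.
pose W := V `&` V'.
have oW : open W by exact: openI.
have Wz : W z0 by [].
have hsW c : hol W (fun u => s u 0 c).
  have /holomorphic_mxP/(_ 0 c) := hs; apply: holS; by move=> u [].
have hhW : holomorphic_mx W h by apply: holomorphic_mxS hh => u [].
have hoW (c : 'I_#|incr m.+1 j.+1|) := jet_osculating c oW Wz hhW.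
rewrite !mxE -/(minor _ _).
have gE c : gwedge (fun i : 'I_j.+1 => w i) 0 c = jet z0 (fun u => osculating_vector h j u 0 c).
  by rewrite (hoW c).2.
have := gE a; have := gE b; rewrite !mxE => -> ->.
rewrite -(jetM oW Wz (hsW a) (hoW b).1) -(jetM oW Wz (hsW b) (hoW a).1).
apply: jet_eq oW Wz _ => u /set_mem[Vu V'u].
have [-> |o0] := eqVneq (osculating_vector h j u) 0; first by rewrite !mxE !mulr0.
have sE := os.2 _ _ (@chart_coordinate R _) _ _ (@subsetT _ V) hl _ Vu o0.
have [s0 sE'] := sl u V'u.
have [k k0 ->] := line_eq o0 (etrans (esym sE') sE).
by rewrite !mxE mulrCA [RHS]mulrCA [s u 0 b * _]mulrC.
Qed.

Lemma normalized_lift : exists V' s a,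
  [/\ V' z0, holomorphic_lift sigma phi V' s & forall z, V' z -> s z 0 a = 1].
Proof.
have [V1 [s [V1z _ [[oV1 sl] hs]]]] := os.1 _ _ (@chart_coordinate R (centre_chart p)) z0 Logic.I.
have [s0 _] := sl z0 V1z.
have [a sa] := row_neq0 s0.
have /holomorphic_mxP hs' := hs.
have [e e0 he] : exists2 e, 0 < e & [set u | nbox z0 u < e] `<=` [set u | V1 u /\ s u 0 a != 0].
  have : \forall u \near z0, V1 u /\ s u 0 a != 0.
    near=> u; split; first by near: u; exact: open_nbhs_nbhs.
    near: u; exact: hol_near_neq0 oV1 V1z (hs' 0 a) sa.
  by move=> /nbhs_box[e e0 he]; exists e => // u /= ue; apply: he; exact/boxE.
pose V2 : set plane := [set u | nbox z0 u < e].
have oV2 : open V2 by exact: open_nbox_lt.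
have V21 : V2 `<=` V1 by move=> u /he[].
have sV2 u : V2 u -> s u 0 a != 0 by move=> /he[].
have V2z : V2 z0 by apply: (@le_lt_trans _ _ 0); rewrite ?nbox0P.
exists V2, (fun u => (s u 0 a)^-1 *: s u), a; split=> //; last first.
  by move=> u /sV2 su; rewrite mxE mulVf.
split.
  split=> // u V2u; have [su sE] := sl u (V21 u V2u); have a0 := sV2 u V2u.
  split; first by rewrite scaler_eq0 invr_eq0 negb_or a0.
  rewrite sE; apply/eqP; rewrite eqEsubv -!memvE memvZ ?memv_line// andbT.
  apply/vlineP; exists (s u 0 a); by rewrite scalerA mulfV// scale1r.
apply/holomorphic_mxP => i b; rewrite !ord1.
have ha c : hol V2 (fun u => s u 0 c) := holS V21 (hs' 0 c).
apply: hol_eq oV2 _ (holM oV2 (holV oV2 sV2 (ha a)) (ha b)) => u _.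
by rewrite mxE.
Unshelve. all: by end_near.
Qed.

(** The order computed from any normalised lift is that of al_j, so it does not depend on the lift
    or on the affine chart. *)
Lemma ramification_orderP k : ramification_order sigma p k <-> has_ord k (al j).
Proof.
have key V' s a : V' z0 -> holomorphic_lift sigma phi V' s ->
    (forall z, V' z -> s z 0 a = 1) ->
  has_ord k (al j) <->
  (forall l, (l < k)%N -> iter l (@dz R 1 _) (dz s) z0 = 0) /\
  iter k (@dz R 1 _) (dz s) z0 != 0.
  move=> V'z sl s1.
  have oV' : open V' by case: sl => -[].
  have S1 : jetm z0 s 0 a = 1.
    rewrite mxE -[RHS](jet1 z0); apply: jet_eq oV' V'z _ => u /set_mem; exact: s1.
  have itE l b : (fcoef (derivf (jetm z0 s 0 b)) l == 0) =
      (iter l (@dz R 1 _) (dz s) z0 0 b == 0).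
    rewrite mxE fcoef_derivf_jet iter_dzE.
    by have -> : (fun u => dz s u 0 b) = wz (fun u => s u 0 b)
      by apply/funext => u; rewrite dzE.
  apply: iff_trans (osculating_has_ord uV wT T0 dv jm k S1 (osculating_jet V'z sl)) _.
  split=> -[h1 h2]; split.
  - move=> l lk; apply/rowP => b; rewrite [RHS]mxE; apply/eqP; rewrite -itE.
    by apply/eqP; exact: h1.
  - have [b hb] := h2; apply: contraNneq hb => e; rewrite itE e mxE//.
  - by move=> l lk b; apply/eqP; rewrite itE h1// mxE.
  - by have [b hb] := row_neq0 h2; exists b; rewrite itE.
split=> [[V' [s [a [V'z sl s1 ? ?]]]]|hk].
  by apply/(key V' s a).
have [V' [s [a [V'z sl s1]]]] := normalized_lift.
by have [ord1 ord2] := (key V' s a V'z sl s1).1 hk; exists V', s, a.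
Qed.
End RamificationOrder.

(** Each series divides the other up to a unit, which bounds either order by the other. *)
Lemma has_ord_eq (K : numFieldType) (a b : fps K) m :
  (exists u c, u \is a GRing.unit /\ u * a = c * b) ->
  (exists u c, u \is a GRing.unit /\ u * b = c * a) ->
  has_ord m a <-> has_ord m b.
Proof.
move=> h1 h2; suff key (x y : fps K) : (exists u c, u \is a GRing.unit /\ u * x = c * y) ->
    (exists u c, u \is a GRing.unit /\ u * y = c * x) -> has_ord m x -> has_ord m y.
  by split; exact: key.
move=> [u [c [uu ux]]] [u' [c' [uu' uy]]] hx.
have le_ord k n (q g r : fps K) : has_ord k q -> has_ord n g -> q = r * g -> (n <= k)%N.
  move=> hq hg e; rewrite leqNgt; apply/negP => kn; case: hq => _ /eqP; apply.
  rewrite e fcoefM big1// => i _; case: hg => g0 _; rewrite g0 ?mulr0//.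
  by rewrite (leq_ltn_trans (leq_subr _ _)).
have ux0 := has_ord_Munit uu hx.
have y0 : y != 0 by apply: contraTneq (has_ord_neq0 ux0) => y0; rewrite ux y0 mulr0 eqxx.
have [n hn] := has_ord_ex y0.
suff -> : m = n by [].
apply/eqP; rewrite eqn_leq (le_ord _ _ _ _ _ (has_ord_Munit uu' hn) hx uy).
by rewrite (le_ord _ _ _ _ _ ux0 hn ux).
Qed.

Theorem lemma4 (R : realType) (f : sphere R -> 'rV[R]_7)
    (psi : 'I_7 -> sphere R -> {vspace 'rV[R[i]%C]_7})
    (sigma : forall j : nat, sphere R -> {vspace 'rV[R[i]%C]_#|incr 7 j.+1|}) :
  almost_complex_curve f ->
  linearly_full f ->
  harmonic_sequence f psi ->
  (forall j : nat, (j <= 5)%N -> osculating_curve (psi ord0) (sigma j)) ->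
  let Rind (j : nat) := ramification_index (sigma j.-1) in
  (forall j : nat, (1 <= j <= 6)%N -> Rind j = Rind (7 - j)%N) /\
  Rind 3 = Rind 1.
Proof.
move=> facc _ hs os Rind.
have key p : exists al : nat -> fps R[i],
  [/\ forall j k, (j <= 5)%N -> ramification_order (sigma j) p k <-> has_ord k (al j),
      forall j, (j <= 5)%N -> exists u c, u \is a GRing.unit /\ u * al j = c * al (5 - j)%N &
      (exists u c, u \is a GRing.unit /\ u * al 0%N = c * al 2%N) /\
      (exists u c, u \is a GRing.unit /\ u * al 2%N = c * al 0%N)].
  have [V [h [Vz hl sq w33 null]]] :=
    directrix_jets facc hs (centre p) (@chart_coordinate R (centre_chart p)).
  pose w i := jetm (centre p) (iter i (@dz R 1 7) h).
  have dw i : w i.+1 = derivfm (w i) by rewrite -jetm_dz.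
  have iso : forall i j, (i + j <= 5)%N -> dotp (w i) (w j) = 0.
    (* Isotropy of w_0, w_1, w_2 gives the bound 2 * 2 + 1 = 5. *)
    exact: (@isotropic_derivs _ _ _ 2 dw sq).
  have [v [T [A [al [uV wT T0 dv al0]]]]] := frenet_frame dw (wronskian_neq0 dw iso w33).
  exists al; split.
  - by move=> j k j5; exact: (ramification_orderP Vz hl uV wT T0 dv _ (os j j5)).
  (* The first is a unit because its indices add up to 6. *)
  - move=> j j5; exists (dotp (v j.+1) (v (5 - j)%N)), (- dotp (v j) (v (6 - j)%N)).
    split; first by have := gram_unit uV wT T0 iso (i := j.+1); rewrite subSS; apply.
    rewrite mulrC (order_symmetry uV wT T0 dv iso)//.
    by rewrite mulNr mulrC.
  - exact: (al0_al2 uV wT T0 dv al0 iso null).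
have ram i j : (i <= 5)%N -> (j <= 5)%N ->
    (forall p k, ramification_order (sigma i) p k <-> ramification_order (sigma j) p k) ->
    ramification_index (sigma i) = ramification_index (sigma j).
  move=> i5 j5 e; apply: eq_fsbigr => p _; rewrite /ramification; congr xget.
  by apply/seteqP; split=> k /=; apply e.
split=> [j /andP[j1 j6]|].
  rewrite /Rind; apply: ram => [||p k]; [lia|lia|].
  have [al [rE sym _]] := key p.
  apply: iff_trans (rE _ _ _) _; first by lia.
  apply: iff_trans _ (iff_sym (rE _ _ _)); last by lia.
  (* R_j belongs to sigma_(j-1), so the reflection of j in 7 becomes the reflection of j - 1 in
     5. *)
  have -> : (7 - j).-1 = (5 - j.-1)%N by lia.
  apply: has_ord_eq; first by apply: sym; lia.
  have := sym (5 - j.-1)%N; rewrite subKn; last by lia.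
  by apply; lia.
apply: ram => // p k; have [al [rE _ [h1 h2]]] := key p.
apply: iff_trans (rE 2 k isT) (iff_trans _ (iff_sym (rE 0 k isT))).
exact: has_ord_eq.
Qed.
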